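(* Let $\gamma\in(0,2)$, $\beta=\frac{2}{2-\gamma}$, $\alpha=\gamma\beta=\frac{2\gamma}{2-\gamma}$, and let $\Omega\subset\mathbb{R}^n$ be a domain with locally Lipschitz boundary. Let $u\ge0$ be a stable critical point of $E_\gamma^{\mathrm{AP}}$ in $\Omega$ or, equivalently, let $v=\beta u^{1/\beta}$ be a stable critical point of $E_\alpha^{\mathrm{M}}$ in $\Omega$. Assume that $v\in C^\infty(\overline{\{v>0\}}\cap\Omega)$, that the free boundary $\partial\{u>0\}$ is a smooth hypersurface in $\Omega$, and that $|\nabla v|>0$ in $\{v>0\}\cap\Omega$. Then $$\frac{2-\gamma}{2}\,\frac{\gamma}{2}\int_{\{u>0\}\cap\Omega}u^\gamma\,\frac{u^\gamma-|\nabla u|^2}{u^2}\,\varphi^2\,dx\le\int_{\{u>0\}\cap\Omega}u^\gamma|\nabla\varphi|^2\,dx$$ or, equivalently, $$\frac{\alpha}{2}\int_{\{v>0\}\cap\Omega}v^\alpha\,\frac{1-|\nabla v|^2}{v^2}\,\varphi^2\,dx\le\int_{\{v>0\}\cap\Omega}v^\alpha|\nabla\varphi|^2\,dx,$$ for every $\varphi\in C^1_c(\Omega)$.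
   Context: The Alt-Phillips functional and the modified functional are $$E_\gamma^{\mathrm{AP}}[u]=\int_\Omega\big(|\nabla u|^2+u^\gamma\chi_{\{u>0\}}\big)\,dx,\qquad E_\alpha^{\mathrm{M}}[v]=\int_\Omega v^\alpha\chi_{\{v>0\}}\big(|\nabla v|^2+1\big)\,dx .$$ Both are of the form $E[w]=\int_\Omega G(w)(|\nabla w|^2+F(w))\,dx$: for $E_\gamma^{\mathrm{AP}}$ take $G=1$, $F(w)=w^\gamma\chi_{\{w>0\}}$; for $E_\alpha^{\mathrm{M}}$ take $G(w)=w^\alpha\chi_{\{w>0\}}$, $F=1$. Variations are inner (domain) variations $w_\varepsilon=w\circ T_\varepsilon^{-1}$, $T_\varepsilon(x)=x+\varepsilon\Phi(x)$, with $\Phi\in C^\infty(\Omega;\mathbb{R}^n)$ compactly supported in $\Omega$. Write $D\Phi=(\Phi^i_j)$ with $\Phi^i_j=\partial_{x_j}\Phi^i$, $w_i=\partial_{x_i}w$, and sum over repeated indices. A function $w\geq 0$ is a critical point of $E$ if $$\int_\Omega G(w)(|\nabla w|^2+F(w))\,\mathrm{div}\,\Phi\,dx-2\int_\Omega G(w)\nabla w\cdot D\Phi\nabla w\,dx=0$$ for all such $\Phi$, and it is a stable critical point if, in addition, $$\int_\Omega G(w)(|\nabla w|^2+F(w))\frac{(\mathrm{div}\,\Phi)^2-\mathrm{Tr}\,(D\Phi)^2}{2}\,dx+\int_\Omega G(w)|D\Phi^{\intercal}\nabla w|^2\,dx+\int_\Omega G(w)\big(2w_iw_j\Phi^i_l\Phi^l_j-2(\nabla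 w\cdot D\Phi\nabla w)\,\mathrm{div}\,\Phi\big)\,dx\ge0$$ for all such $\Phi$. Under $v=\beta u^{1/\beta}$ (i.e. $u=(v/\beta)^\beta$), one has $\nabla v=u^{-\gamma/2}\nabla u$ in $\{u>0\}=\{v>0\}$, and nonnegative (stable) critical points of the two functionals correspond to each other. The notation $v\in C^\infty(\overline{\{v>0\}}\cap\Omega)$ means that $v$ restricted to its positivity set is smooth up to the free boundary $\partial\{v>0\}\cap\Omega$. *)

(* Defs.v *)
From HB Require Import structures.
From mathcomp Require Import all_boot all_order all_algebra.
From mathcomp Require Import all_classical all_reals all_analysis.
Set Implicit Arguments.
Unset Strict Implicit.
Unset Printing Implicit Defensive.
Import Order.TTheory GRing.Theory Num.Theory.
Import numFieldNormedType.Exports.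
Local Open Scope classical_set_scope.
Local Open Scope ring_scope.

Definition rV_display : measure_display. Proof. exact. Qed.

Section rV_measurable.
Context {R : realType} (n : nat).

Let coors (i : 'I_n) (x : 'rV[R]_n) : measurableTypeR R := x ord0 i.

Let rV_set0 : g_sigma_preimage coors set0.
Proof. exact: sigma_algebra0. Qed.

Let rV_setC A : g_sigma_preimage coors A -> g_sigma_preimage coors (~` A).
Proof. exact: sigma_algebraC. Qed.

Let rV_bigcup (F : _^nat) : (forall i, g_sigma_preimage coors (F i)) ->
  g_sigma_preimage coors (\bigcup_i (F i)).
Proof. exact: sigma_algebra_bigcup. Qed.

(* The Borel sigma-algebra of R^n, generated by the n coordinates. *)
HB.instance Definition _ := @isMeasurable.Build rV_display
  'rV[R]_n (g_sigma_preimage coors) rV_set0 rV_setC rV_bigcup.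

Lemma measurable_coord (i : 'I_n) :
  measurable_fun [set: 'rV[R]_n] (fun x => x ord0 i : measurableTypeR R).
Proof.
move=> _ Y mY; rewrite setTI; apply: sub_sigma_algebra => /=.
rewrite -bigcup_seq/=; exists i => /=; first by rewrite mem_index_enum.
by exists Y => //; rewrite setTI.
Qed.

Lemma measurable_fun_rV d (T : measurableType d) (f : T -> 'rV[R]_n) :
  (forall i, measurable_fun [set: T] (fun t => f t ord0 i : measurableTypeR R)) ->
  measurable_fun [set: T] f.
Proof.
move=> mf _ A mA.
have sub : g_sigma_preimage (fun i => coors i \o f) `<=` measurable.
  apply: smallest_sub; first exact: sigma_algebra_measurable.
  rewrite -bigcup_seq; apply: bigcup_sub => i _.
  by move=> B [C mC <-]; exact: mf.
by apply: sub; rewrite g_sigma_preimage_comp; exists A.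
Qed.

End rV_measurable.

Section rV_cons.
Context {R : realType} (n : nat).

Definition rV_cons (p : measurableTypeR R * 'rV[R]_n) : 'rV[R]_n.+1 :=
  row_mx (p.1 : R)%:M p.2.

Definition rV_uncons (x : 'rV[R]_n.+1) : measurableTypeR R * 'rV[R]_n :=
  (x ord0 ord0, \row_j x ord0 (lift ord0 j)).

Lemma rV_cons0 p : rV_cons p ord0 ord0 = p.1.
Proof.
have -> : (ord0 : 'I_n.+1) = lshift n (ord0 : 'I_1) by exact: val_inj.
by rewrite /rV_cons (row_mxEl (p.1 : R)%:M p.2) mxE eqxx.
Qed.

Lemma rV_consS p j : rV_cons p ord0 (lift ord0 j) = p.2 ord0 j.
Proof.
have -> : lift ord0 j = rshift 1 j by exact: val_inj.
by rewrite /rV_cons (row_mxEr (p.1 : R)%:M p.2).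
Qed.

Lemma rV_consK : cancel rV_cons rV_uncons.
Proof.
move=> p; rewrite /rV_uncons rV_cons0 [RHS]surjective_pairing; congr pair.
by apply/rowP => j; rewrite mxE rV_consS.
Qed.

Lemma rV_unconsK : cancel rV_uncons rV_cons.
Proof.
move=> x; apply/rowP => i; case: (unliftP ord0 i) => [j|] ->.
  by rewrite rV_consS mxE.
by rewrite rV_cons0.
Qed.

Lemma measurable_rV_cons : measurable_fun setT rV_cons.
Proof.
apply: measurable_fun_rV => i; case: (unliftP ord0 i) => [j|] ->.
  under eq_fun do rewrite rV_consS.
  by apply: (measurableT_comp (measurable_coord j)).
under eq_fun do rewrite rV_cons0.
exact: measurable_fst.
Qed.

Lemma measurable_rV_uncons : measurable_fun setT rV_uncons.
Proof.
apply/measurable_fun_pairP; split; first exact: measurable_coord.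
apply: measurable_fun_rV => j.
rewrite /rV_uncons /comp /=; under eq_fun do rewrite mxE.
exact: measurable_coord.
Qed.

Variable l : {sigma_finite_measure set (measurableTypeR R) -> \bar R}.
Variable m : {sigma_finite_measure set 'rV[R]_n -> \bar R}.

Definition rV_prod : set 'rV[R]_n.+1 -> \bar R :=
  pushforward (l \x m)%E rV_cons.

HB.instance Definition _ := Measure.copy rV_prod
  (measure_function_pushforward__canonical__measure_function_Measure
     (l \x m)%E measurable_rV_cons).

Let rV_prod_sigma_finite : sigma_finite setT rV_prod.
Proof.
have /sigma_finiteP[F [TF ndF Foo]] := sigma_finiteT l.
have /sigma_finiteP[G [TG ndG Goo]] := sigma_finiteT m.
exists (fun k => rV_uncons @^-1` (F k `*` G k)).
  rewrite -preimage_bigcup; apply/esym; rewrite -subTset => x _ /=.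
  have [i _ Fi] : (\bigcup_i F i) (rV_uncons x).1 by rewrite -TF.
  have [j _ Gj] : (\bigcup_i G i) (rV_uncons x).2 by rewrite -TG.
  exists (maxn i j) => //; split.
    by move: Fi; exact/subsetPset/ndF/leq_maxl.
  by move: Gj; exact/subsetPset/ndG/leq_maxr.
move=> k; have [mF Fk] := Foo k; have [mG Gk] := Goo k.
have mFG : measurable (F k `*` G k) by exact: measurableX.
split; first by rewrite -[X in measurable X]setTI; exact: measurable_rV_uncons.
rewrite /rV_prod /pushforward -comp_preimage.
rewrite (_ : _ \o _ = id); last by apply/funext => p; exact: rV_consK.
by rewrite preimage_id product_measure1E// lte_mul_pinfty// ge0_fin_numE.
Qed.

HB.instance Definition _ := Measure_isSigmaFinite.Build _ _ _ rV_prod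
  rV_prod_sigma_finite.

End rV_cons.

(* Lebesgue measure on R^n: the n-fold product of Lebesgue measure on R. *)
Fixpoint lebesgue_rV {R : realType} (n : nat) :
    {sigma_finite_measure set 'rV[R]_n -> \bar R} :=
  match n with
  | 0 => dirac (0 : 'rV[R]_0)
  | n'.+1 => rV_prod (@lebesgue_measure R) (lebesgue_rV n')
  end.

Lemma lebesgue_rV_box (R : realType) n (A : 'I_n -> set (measurableTypeR R)) :
  (forall i, measurable (A i)) ->
  lebesgue_rV n [set x : 'rV[R]_n | forall i, A i (x ord0 i)] =
  (\prod_(i < n) lebesgue_measure (A i))%E.
Proof.
elim: n A => [|n IH] A mA.
  by rewrite big_ord0 /= diracE mem_set//= => -[].
rewrite big_ord_recl -IH; last by move=> i; exact: mA.
rewrite -product_measure1E//.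
  rewrite /= /rV_prod /pushforward; congr (_ _); apply/seteqP; split.
    move=> p /= pA; split=> [|j]; first by rewrite -rV_cons0; exact: pA.
    by rewrite -rV_consS; exact: pA.
  move=> p [/= p1 p2] i; case: (unliftP ord0 i) => [j|] ->.
    by rewrite rV_consS; exact: p2.
  by rewrite rV_cons0.
rewrite (_ : mkset _ = \bigcap_(i in [set: 'I_n])
    ((fun x : 'rV[R]_n => x ord0 i : measurableTypeR R) @^-1` A (lift ord0 i))).
  apply: fin_bigcap_measurable => // i _.
  by rewrite -[X in measurable X]setTI; exact: measurable_coord.
by apply/seteqP; split=> x /= xA i; [move=> _|]; exact: xA.
Qed.

Section calculus.
Context {R : realType} {n : nat}.
Implicit Types (f w : 'rV[R]_n -> R) (Phi : 'rV[R]_n -> 'rV[R]_n).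
Implicit Types (U Omega : set 'rV[R]_n).

Definition vdot m (a b : 'cV[R]_m) : R := \sum_i a i ord0 * b i ord0.

(* The library norm `|_| on matrices is the sup norm. *)
Definition enorm m (a : 'cV[R]_m) : R := Num.sqrt (vdot a a).

Definition partial (i : 'I_n) f : 'rV[R]_n -> R :=
  fun x => 'D_(delta_mx ord0 i) f x.

Definition grad f x : 'cV[R]_n := \col_i partial i f x.

(* (Dvec Phi x) i j is the derivative of the i-th component in direction j. *)
Definition Dvec Phi x : 'M[R]_n :=
  \matrix_(i, j) partial j (fun y => Phi y ord0 i) x.

Definition divergence Phi x : R := \tr (Dvec Phi x).

Definition iter_partial (s : seq 'I_n) f := foldr partial f s.

Definition C1_on U f := forall x, U x ->
  {for x, continuous f} /\
  forall i, derivable f x (delta_mx ord0 i) /\ {for x, continuous (partial i f)}.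

Definition smooth_on U f := forall s, C1_on U (iter_partial s f).

(* f \in C^oo(closure U `&` Omega) for U open: f is smooth in U, all its partial
   derivatives extend continuously to closure U `&` Omega, and the extension
   of f itself is f. *)
Definition smooth_up_to_boundary U Omega f :=
  [/\ open U, smooth_on U f, {within closure U `&` Omega, continuous f} &
    forall s, exists g : 'rV[R]_n -> R,
      {within closure U `&` Omega, continuous g} /\
      (forall x, U x -> g x = iter_partial s f x)].

Definition compactly_supported_in (V : nmodType) Omega (f : 'rV[R]_n -> V) :=
  let supp := closure [set x | f x != 0] in compact supp /\ supp `<=` Omega.

Definition test_field Omega Phi :=
  (forall i, smooth_on setT (fun x => Phi x ord0 i)) /\
  compactly_supported_in Omega Phi.

Definition C1c Omega f := C1_on setT f /\ compactly_supported_in Omega f.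

Definition domain Omega := [/\ open Omega, connected Omega & Omega !=set0].

Definition frontier U := closure U `\` interior U.

Definition height (e x : 'rV[R]_n) : R := vdot e^T x^T.

(* Orthogonal projection onto the hyperplane e^\perp, for a unit vector e. *)
Definition hproj (e x : 'rV[R]_n) : 'rV[R]_n := x - height e x *: e.

(* Near each boundary point, Omega is the part of the space lying strictly on
   one side of the graph of a Lipschitz function over a hyperplane. The graph
   function is defined on all of R^n but used only on the hyperplane. *)
Definition locally_lipschitz_boundary Omega := forall p, frontier Omega p ->
  exists (N : set 'rV[R]_n) (e : 'rV[R]_n) (g : 'rV[R]_n -> R),
    [/\ open_nbhs p N, enorm e^T = 1, lipschitz g &
      forall x, N x -> (Omega x <-> g (hproj e x) < height e x)].

(* Gamma is locally the graph of a smooth function over a hyperplane. *)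
Definition smooth_hypersurface (Gamma : set 'rV[R]_n) := forall p, Gamma p ->
  exists (N : set 'rV[R]_n) (e : 'rV[R]_n) (g : 'rV[R]_n -> R),
    [/\ open_nbhs p N, enorm e^T = 1, smooth_on setT g &
      forall x, N x -> (Gamma x <-> g (hproj e x) = height e x)].

Definition positivity_set Omega w := [set x | Omega x /\ 0 < w x].

Definition free_boundary Omega w :=
  frontier (positivity_set Omega w) `&` Omega.

End calculus.

(* Inner variations of w |-> \int_Omega G(w) (|grad w|^2 + F(w)). Gradients are
   classical: w is meant to be Lipschitz near every point of Omega and
   differentiable off a null set. *)
Section variations.
Context {R : realType} {n : nat}.
Variables (Omega : set 'rV[R]_n) (G F : R -> R) (w : 'rV[R]_n -> R).
Implicit Type Phi : 'rV[R]_n -> 'rV[R]_n.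
Local Notation mu := (lebesgue_rV n).

Definition first_variation Phi : \bar R :=
  (\int[mu]_(x in Omega)
     (G (w x) * (enorm (grad w x) ^+ 2 + F (w x)) * divergence Phi x)%:E
   - 2%:E * \int[mu]_(x in Omega)
     (G (w x) * vdot (grad w x) (Dvec Phi x *m grad w x))%:E)%E.

Definition second_variation Phi : \bar R :=
  (\int[mu]_(x in Omega)
     (G (w x) * (enorm (grad w x) ^+ 2 + F (w x)) *
      ((divergence Phi x ^+ 2 - \tr (Dvec Phi x *m Dvec Phi x)) / 2))%:E
   + \int[mu]_(x in Omega)
     (G (w x) * enorm ((Dvec Phi x)^T *m grad w x) ^+ 2)%:E
   + \int[mu]_(x in Omega)
     (G (w x) *
      (2 * (\sum_i \sum_j \sum_l
              partial i w x * partial j w x * Dvec Phi x i l * Dvec Phi x l j)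
       - 2 * vdot (grad w x) (Dvec Phi x *m grad w x) * divergence Phi x))%:E)%E.

Definition critical_point :=
  (forall x, Omega x -> 0 <= w x) /\
  forall Phi, test_field Omega Phi -> first_variation Phi = 0%E.

Definition stable_critical_point :=
  critical_point /\
  forall Phi, test_field Omega Phi -> (0 <= second_variation Phi)%E.

End variations.

Section functionals.
Context {R : realType} {n : nat}.
Implicit Types (Omega : set 'rV[R]_n) (w : 'rV[R]_n -> R).

Definition chi_pos : R -> R := \1_[set t : R | 0 < t].

Definition stable_critical_AP gamma Omega w :=
  stable_critical_point Omega (fun=> 1) (fun t => t `^ gamma * chi_pos t) w.

Definition stable_critical_M alpha Omega w :=
  stable_critical_point Omega (fun t => t `^ alpha * chi_pos t) (fun=> 1) w.

(* c * \int_D f <= \int_D g, both integrals being convergent: the library gives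
   a value to the integral of any function. *)
Definition integral_le (c : R) (D : set 'rV[R]_n) (f g : 'rV[R]_n -> R) :=
  [/\ (lebesgue_rV n).-integrable D (EFin \o f),
      (lebesgue_rV n).-integrable D (EFin \o g) &
      (c%:E * \int[lebesgue_rV n]_(x in D) (f x)%:E <=
       \int[lebesgue_rV n]_(x in D) (g x)%:E)%E].

End functionals.

(* Main.v *)
Require Import Defs.
From mathcomp Require Import all_boot all_order all_algebra.
From mathcomp Require Import all_classical all_reals all_analysis.
From mathcomp Require Import measurable_realfun ring lra.
Set Implicit Arguments.
Unset Strict Implicit.
Unset Printing Implicit Defensive.
Import Order.TTheory GRing.Theory Num.Theory.
Import numFieldNormedType.Exports.
Local Open Scope classical_set_scope.
Local Open Scope ring_scope.

(* Let U = {v > 0}. On U, criticality is the equation v Delta v = (alpha/2) (1 - |grad v|^2),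
   so |grad v| = 1 on the free boundary and |grad v| is bounded below on compact sets. For a
   test field Phi and phi = grad v . Phi, the integrand of the second variation is
     v^alpha |grad phi|^2 - (alpha/2) v^alpha (1 - |grad v|^2) / v^2 phi^2 + div Y
   with grad v . Y = O(v^alpha). Cutting off where v is small gives first the integrability of
   v^(alpha-1), from the field v^alpha grad v, and then that div Y integrates to 0; stability
   is thus the claimed inequality for phi = grad v . Phi. A general phi is the limit of such
   functions: take Phi = phi grad v / |grad v|^2 with phi mollified and, near each point of
   the free boundary, grad v / |grad v|^2 translated along a direction in which v grows, so
   that only values at points where v is bounded away from 0 enter; every term is dominated
   by a multiple of v^(alpha-1). For u = (v/beta)^beta, grad u is a multiple of grad v, and
   the two functionals have the same variations up to the factor beta^(-alpha). *)

(** The obstacle is the free boundary: [v] is smooth up to it but not across it, and [alpha - 1] is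
    negative for small [gamma], so no integration by parts on U is automatic. The equation pays
    twice. It replaces the factor (1 - |grad v|^2) / v^2 of the potential by a multiple of Delta v /
    v, and Delta v stays bounded up to the free boundary. It also removes from grad v . Y the terms
    of order v^(alpha-1), which are present in Y itself; a cutoff in v costs one power of v when it
    is differentiated, and v^alpha is just enough to pay for it. The passage to general phi has an
    obstacle of its own: stability speaks of fields that are smooth on all of Omega, while N = grad
    v / |grad v|^2 is available on U alone. The direction in which N can be translated depends on
    the point, whence a partition of unity. The limit is taken in the quadratic form, where
    pointwise convergence of the functions and their gradients under a uniform bound suffices. *)

Section ContinuityAt.
Context {R : realType} {T : topologicalType}.
Implicit Types (f g : T -> R) (x : T).

Lemma continuous_atD f g x : {for x, continuous f} -> {for x, continuous g} ->
  {for x, continuous (fun y => f y + g y)}.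
Proof. exact: continuousD. Qed.

Lemma continuous_atM f g x : {for x, continuous f} -> {for x, continuous g} ->
  {for x, continuous (fun y => f y * g y)}.
Proof. exact: continuousM. Qed.

Lemma continuous_at_comp (h : R -> R) f x : {for x, continuous f} ->
  {for f x, continuous h} -> {for x, continuous (fun y => h (f y))}.
Proof. exact: continuous_comp. Qed.

Lemma continuous_at_sum (I : Type) (r : seq I) (F : I -> T -> R) x :
  (forall i, {for x, continuous (F i)}) ->
  {for x, continuous (fun y => \sum_(i <- r) F i y)}.
Proof.
move=> cF; elim: r => [|i r IH].
  rewrite (_ : (fun _ => _) = fun=> 0); first exact: cst_continuous.
  by apply/funext => y; rewrite big_nil.
rewrite (_ : (fun _ => _) = fun y => F i y + \sum_(j <- r) F j y).
  exact: continuous_atD.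
by apply/funext => y; rewrite big_cons.
Qed.

End ContinuityAt.

(** * Differential calculus *)

Section PartialDerivatives.
Context {R : realType} {n : nat}.
Implicit Types (U : set 'rV[R]_n) (f g : 'rV[R]_n -> R) (x : 'rV[R]_n).
Local Notation e_ i := (delta_mx ord0 i : 'rV[R]_n).

Lemma nbhs_line (P : set 'rV[R]_n) x (v : 'rV[R]_n) :
  nbhs x P -> \forall h \near (0 : R), P (h *: v + x).
Proof.
move=> Px; have : (fun h : R => h *: v + x) @ 0 --> (0 : R) *: v + x.
  by apply: cvgD; [apply: cvgZr_tmp; exact: cvg_id|exact: cvg_cst].
rewrite scale0r add0r; exact.
Qed.

Lemma near_eq_derivable_dir f g x v :
  nbhs x [set y | f y = g y] -> derivable f x v -> derivable g x v.
Proof.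
have [->|v0] := eqVneq v 0; first by move=> _ _; exact: derivable0.
by move=> fg; apply: near_eq_derivable.
Qed.

Lemma partial_near i f g x : nbhs x [set y | f y = g y] -> partial i f x = partial i g x.
Proof.
rewrite /partial; have [->|v0] := eqVneq (e_ i) 0; first by rewrite !derive0.
by move=> fg; apply: near_eq_derive.
Qed.

Lemma open_near_eq U f g x : open U -> U x -> (forall y, U y -> f y = g y) ->
  nbhs x [set y | f y = g y].
Proof.
move=> oU Ux fg; have : nbhs x U by exact: open_nbhs_nbhs.
by apply: filterS => y; exact: fg.
Qed.

Lemma partialD i f g x : derivable f x (e_ i) -> derivable g x (e_ i) ->
  partial i (fun y => f y + g y) x = partial i f x + partial i g x.
Proof. by move=> df dg; rewrite /partial [LHS](deriveD df dg). Qed.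

Lemma partialB i f g x : derivable f x (e_ i) -> derivable g x (e_ i) ->
  partial i (fun y => f y - g y) x = partial i f x - partial i g x.
Proof. by move=> df dg; rewrite /partial [LHS](deriveB df dg). Qed.

Lemma partialM i f g x : derivable f x (e_ i) -> derivable g x (e_ i) ->
  partial i (fun y => f y * g y) x = partial i f x * g x + f x * partial i g x.
Proof.
by move=> df dg; rewrite /partial [LHS](deriveM df dg) /GRing.scale/= addrC mulrC.
Qed.

Lemma partial_cst i (c : R) x : partial i (fun=> c) x = 0.
Proof. exact: derive_cst. Qed.

Lemma derivable_line f x v :
  derivable f x v <-> derivable (fun h : R => f (h *: v + x)) 0 1.
Proof. exact: (@derivable1P R _ R f x v). Qed.

Lemma derive_line f x v : 'D_v f x = 'D_1 (fun h : R => f (h *: v + x)) 0.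
Proof.
rewrite /derive; apply: (congr1 (fun F : R -> R => lim (F @ 0^'))); apply/funext => h /=.
by rewrite addr0 scale0r add0r scaler1.
Qed.

(** Only the derivative of [f] along [v] is at hand, not differentiability, so the one-variable
    chain rule is applied to the restriction of [f] to the line through [x] along [v]. *)
Lemma is_derive_comp1 (h : R -> R) (h' : R) f x v :
  derivable f x v -> is_derive (f x) 1 h h' ->
  is_derive x v (h \o f) (h' * 'D_v f x).
Proof.
move=> /derivable_line df [dh hE].
set k := fun t : R => f (t *: v + x).
have k0 : k 0 = f x by rewrite /k scale0r add0r.
have dhk : derivable h (k 0) 1 by rewrite k0.
have dk : derivable (h \o k) (0 : R) 1.
  have /derivable1_diffP df' : derivable k 0 1 := df.
  move/derivable1_diffP : dhk => dhk.
  by apply/derivable1_diffP; exact: differentiable_comp.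
have E := @derive1_comp R k h 0 df dhk.
rewrite (derive1E (h \o k)) (derive1E h) (derive1E k) k0 hE in E.
apply: (@DeriveDef _ _ _ _ _ _ _ ((derivable_line (h \o f) x v).2 dk)).
rewrite derive_line (derive_line f); exact: E.
Qed.

Lemma C1_on_continuous U f x : C1_on U f -> U x -> {for x, continuous f}.
Proof. by move=> cf /cf[]. Qed.

Lemma C1_on_derivable U f x i : C1_on U f -> U x -> derivable f x (e_ i).
Proof. by move=> cf /cf[_ /(_ i)[]]. Qed.

Lemma C1_on_partial U f x i : C1_on U f -> U x ->
  {for x, continuous (partial i f)}.
Proof. by move=> cf /cf[_ /(_ i)[]]. Qed.

Arguments C1_on_derivable [U f x] i.
Arguments C1_on_partial [U f x] i.

Lemma near_eq_continuous f g x : nbhs x [set y | f y = g y] ->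
  {for x, continuous f} -> {for x, continuous g}.
Proof.
move=> fg cf; rewrite /prop_for /continuous_at -(nbhs_singleton fg).
apply: cvg_trans cf; move=> A /= fA; apply: filterS2 fg fA => y /= <-.
exact.
Qed.

Lemma C1_on_near U f g x : open U -> U x -> nbhs x [set y | f y = g y] ->
   C1_on U f ->
   {for x, continuous g} /\
   forall i, derivable g x (e_ i) /\ {for x, continuous (partial i g)}.
Proof.
move=> oU Ux fg /(_ _ Ux)[cf df]; split; first exact: near_eq_continuous fg cf.
move=> i; have [dfi cfi] := df i; split; first exact: near_eq_derivable_dir fg dfi.
apply: near_eq_continuous cfi.
have := near_join fg; apply: filterS => y; exact: partial_near.
Qed.

Lemma C1_on_eq U f g : open U -> (forall x, U x -> f x = g x) ->
  C1_on U f -> C1_on U g.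
Proof. by move=> oU fg cf x Ux; apply: (C1_on_near oU) cf => //; exact: open_near_eq fg. Qed.

Lemma C1_on_sub U V f : V `<=` U -> C1_on U f -> C1_on V f.
Proof. by move=> VU cf x /VU/cf. Qed.

Lemma C1_on_local U f : (forall x, U x -> exists2 V, V x & C1_on V f) -> C1_on U f.
Proof. by move=> H x /H[V Vx /(_ _ Vx)]. Qed.

Lemma C1_onP U f (df : 'I_n -> 'rV[R]_n -> R) : open U ->
  (forall x, U x -> {for x, continuous f}) ->
  (forall i x, U x -> is_derive x (e_ i) f (df i x)) ->
  (forall i x, U x -> {for x, continuous (df i)}) -> C1_on U f.
Proof.
move=> oU cf dfE cdf x Ux; split; first exact: cf.
move=> i; split; first by have [] := dfE i x Ux.
apply: near_eq_continuous (cdf i x Ux); apply: (@open_near_eq U) => // y Uy.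
by rewrite /partial (@derive_val _ _ _ _ _ _ _ (dfE i y Uy)).
Qed.

Lemma C1_on_cst U (c : R) : C1_on U (fun=> c).
Proof.
move=> x Ux; split; first exact: cst_continuous.
move=> i; split; first exact: derivable_cst.
rewrite (_ : partial i _ = fun=> 0); last by apply/funext => y; exact: partial_cst.
exact: cst_continuous.
Qed.

Lemma C1_onD U f g : open U -> C1_on U f -> C1_on U g ->
  C1_on U (fun x => f x + g x).
Proof.
move=> oU cf cg.
apply: (@C1_onP _ _ (fun i x => partial i f x + partial i g x)) => //.
- move=> x Ux; exact: continuous_atD (C1_on_continuous cf Ux) (C1_on_continuous cg Ux).
- move=> i x Ux; have df := C1_on_derivable i cf Ux; have dg := C1_on_derivable i cg Ux.
  exact: (@DeriveDef _ _ _ _ _ _ _ (derivableD df dg) (partialD df dg)).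
- by move=> i x Ux; exact: continuous_atD (C1_on_partial i cf Ux) (C1_on_partial i cg Ux).
Qed.

Lemma C1_onM U f g : open U -> C1_on U f -> C1_on U g ->
  C1_on U (fun x => f x * g x).
Proof.
move=> oU cf cg.
apply: (@C1_onP _ _ (fun i x => partial i f x * g x + f x * partial i g x)) => //.
- move=> x Ux; apply: continuous_atM; [exact: (C1_on_continuous cf Ux)|exact: (C1_on_continuous cg Ux)].
- move=> i x Ux; have df := C1_on_derivable i cf Ux; have dg := C1_on_derivable i cg Ux.
  exact: (@DeriveDef _ _ _ _ _ _ _ (derivableM df dg) (partialM df dg)).
- move=> i x Ux; apply: continuous_atD; apply: continuous_atM.
  + exact: (C1_on_partial i cf Ux).
  + exact: (C1_on_continuous cg Ux).
  + exact: (C1_on_continuous cf Ux).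
  + exact: (C1_on_partial i cg Ux).
Qed.

Lemma C1_on_comp U (h h' : R -> R) f : open U -> C1_on U f ->
  (forall x, U x -> is_derive (f x) 1 h (h' (f x))) ->
  (forall x, U x -> {for f x, continuous h'}) ->
  C1_on U (h \o f) /\
  forall i x, U x -> partial i (h \o f) x = h' (f x) * partial i f x.
Proof.
move=> oU cf dh ch; split.
  apply: (@C1_onP _ _ (fun i x => h' (f x) * partial i f x)) => //.
  - move=> x Ux; apply: continuous_at_comp; first exact: (C1_on_continuous cf Ux).
    apply/differentiable_continuous/derivable1_diffP.
    exact: (@ex_derive _ _ _ _ _ _ _ (dh x Ux)).
  - move=> i x Ux; exact: is_derive_comp1 (C1_on_derivable i cf Ux) (dh x Ux).
  - move=> i x Ux; apply: continuous_atM; last exact: (C1_on_partial i cf Ux).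
    by apply: continuous_at_comp; [exact: (C1_on_continuous cf Ux)|exact: ch].
move=> i x Ux; rewrite /partial.
by rewrite (@derive_val _ _ _ _ _ _ _ (is_derive_comp1 (C1_on_derivable i cf Ux) (dh x Ux))).
Qed.

(** The class C^(k+1), with index shifted by one. [smooth_on] speaks of all iterated partial
    derivatives at once; this form allows induction on the order for products and compositions. *)
Fixpoint Ck (k : nat) U f : Prop :=
  if k is k'.+1 then C1_on U f /\ forall i, Ck k' U (partial i f)
  else C1_on U f.

Lemma Ck_C1 k U f : Ck k U f -> C1_on U f.
Proof. by case: k => //= k []. Qed.

Lemma CkS k U f : Ck k.+1 U f -> Ck k U f.
Proof.
elim: k f => [f []//|k IH f [cf dcf]]; split=> // i.
exact/IH/dcf.
Qed.

Lemma smooth_on_partial U f i : smooth_on U f -> smooth_on U (partial i f).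
Proof.
move=> sf s; have := sf (rcons s i).
by rewrite /iter_partial foldr_rcons.
Qed.

Lemma smooth_onP U f : smooth_on U f <-> forall k, Ck k U f.
Proof.
split=> [sf k|].
  elim: k f sf => [f sf|k IH f sf]; first exact: sf [::].
  by split; [exact: sf [::]|move=> i; apply: IH; exact: smooth_on_partial].
move=> Cf s; elim/last_ind: s f Cf => [f Cf|s i IH f Cf]; first exact: Cf 0.
rewrite /iter_partial foldr_rcons; apply: IH => k.
by have [_ /(_ i)] := Cf k.+1.
Qed.

Lemma smooth_on_C1 U f : smooth_on U f -> C1_on U f.
Proof. by move=> /(_ [::]). Qed.

Lemma Ck_eq k U f g : open U -> (forall x, U x -> f x = g x) ->
  Ck k U f -> Ck k U g.
Proof.
move=> oU; elim: k f g => [|k IH] f g fg; first exact: C1_on_eq.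
move=> [cf dcf]; split=> [|i]; first exact: C1_on_eq cf.
by apply: IH (dcf i) => x Ux; apply: partial_near; exact: open_near_eq fg.
Qed.

Lemma Ck_sub k U V f : V `<=` U -> Ck k U f -> Ck k V f.
Proof.
move=> VU; elim: k f => [|k IH] f; first exact: C1_on_sub.
move=> [cf dcf]; split=> [|i]; first exact: C1_on_sub cf.
exact: IH (dcf i).
Qed.

Lemma Ck_local k U f : (forall x, U x -> exists2 V, V x & Ck k V f) -> Ck k U f.
Proof.
elim: k f => [|k IH] f H; first exact: C1_on_local.
split; first by apply: C1_on_local => x /H[V Vx /Ck_C1]; exists V.
by move=> i; apply: IH => x /H[V Vx [_ /(_ i)]]; exists V.
Qed.

Lemma Ck_cst k U c : Ck k U (fun=> c).
Proof.
elim: k c => [|k IH] c; first exact: C1_on_cst.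
split; first exact: C1_on_cst.
move=> i; rewrite (_ : partial i _ = fun=> 0)//.
by apply/funext => x; exact: partial_cst.
Qed.

Lemma CkD k U f g : open U -> Ck k U f -> Ck k U g -> Ck k U (fun x => f x + g x).
Proof.
move=> oU; elim: k f g => [|k IH] f g; first exact: C1_onD.
move=> [cf dcf] [cg dcg]; split=> [|i]; first exact: C1_onD.
apply: (Ck_eq oU) (IH _ _ (dcf i) (dcg i)) => x Ux.
by rewrite partialD//; [exact: (C1_on_derivable i cf Ux)|exact: (C1_on_derivable i cg Ux)].
Qed.

Lemma CkM k U f g : open U -> Ck k U f -> Ck k U g -> Ck k U (fun x => f x * g x).
Proof.
move=> oU; elim: k f g => [|k IH] f g; first exact: C1_onM.
move=> Cf Cg; have [cf dcf] := Cf; have [cg dcg] := Cg.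
split=> [|i]; first exact: C1_onM.
apply: (@Ck_eq _ _ (fun x => partial i f x * g x + f x * partial i g x)) => //.
  move=> x Ux; rewrite partialM//; first exact: (C1_on_derivable i cf Ux).
  exact: (C1_on_derivable i cg Ux).
apply: CkD => //; first exact: IH (dcf i) (CkS Cg).
exact: IH (CkS Cf) (dcg i).
Qed.

(** The induction on [k] covers all [t] simultaneously, since the derivative of [h t] involves other
    members of the family. The families used are the real powers, indexed by the exponent, and
    [flat], indexed by [m]. *)
Lemma Ck_comp (T : Type) (h : T -> R -> R) (h' : T -> seq (R * T)) k U f :
  open U -> Ck k U f ->
  (forall t x, U x ->
     is_derive (f x) 1 (h t) (\sum_(c <- h' t) c.1 * h c.2 (f x))) ->
  (forall t x, U x -> {for f x, continuous (h t)}) ->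
  forall t, Ck k U (h t \o f).
Proof.
move=> oU cf dh ch t.
have C t' := @C1_on_comp U (h t') (fun y => \sum_(c <- h' t') c.1 * h c.2 y) f oU (Ck_C1 cf) (dh t').
have c' t' x : U x -> {for f x, continuous (fun y => \sum_(c <- h' t') c.1 * h c.2 y)}.
  move=> Ux; apply: continuous_at_sum => c; apply: continuous_atM; last exact: ch.
  exact: cst_continuous.
elim: k f cf dh ch t C c' => [|k IH] f cf dh ch t C c'; first by case: (C t (c' t)).
split; first by case: (C t (c' t)).
move=> i; have [_ P] := C t (c' t).
apply: (@Ck_eq _ _ (fun x => (\sum_(c <- h' t) c.1 * h c.2 (f x)) * partial i f x)) => //.
  by move=> x Ux; rewrite P.
have {}IH t' : Ck k U (h t' \o f) by exact: IH (CkS cf) dh ch t' C c'.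
apply: CkM => //; last exact: (cf.2 i).
elim: (h' t) => [|c s IHs].
  by apply: (Ck_eq oU) (Ck_cst k U 0) => x _; rewrite big_nil.
apply: (@Ck_eq _ _ (fun x => c.1 * h c.2 (f x) + \sum_(c <- s) c.1 * h c.2 (f x))) => //.
  by move=> x _; rewrite big_cons.
apply: (CkD oU _ IHs); apply: (CkM oU _ (IH _)); exact: (Ck_cst k U c.1).
Qed.

End PartialDerivatives.

Arguments C1_on_derivable {R n} [U f x] i.
Arguments C1_on_partial {R n} [U f x] i.

Section SmoothFunctions.
Context {R : realType} {n : nat}.
Implicit Types (U V : set 'rV[R]_n) (f g : 'rV[R]_n -> R) (x : 'rV[R]_n).
Local Notation e_ i := (delta_mx ord0 i : 'rV[R]_n).

Lemma is_derive_line f x v (s : R) : derivable f (s *: v + x) v ->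
  is_derive s 1 (fun t => f (t *: v + x)) ('D_v f (s *: v + x)).
Proof.
have E : (fun h : R => f ((h *: (1 : R) + s) *: v + x)) =
         (fun h : R => f (h *: v + (s *: v + x))).
  by apply/funext => h; rewrite scalerDl addrA /GRing.scale/= mulr1.
move=> df; apply: (@DeriveDef _ _ _ _ _ _ _).
  apply: (derivable1P _ _ _).2; rewrite E; exact: (derivable_line f _ v).1.
rewrite (derive_line f) /derive.
apply: (congr1 (fun F : R -> R => lim (F @ 0^'))); apply/funext => h /=.
have := congr1 (@^~ h) E => /= ->.
by rewrite addr0 scale0r add0r /GRing.scale /= mulr1.
Qed.

Lemma smooth_on_eq U f g : open U -> (forall x, U x -> f x = g x) ->
  smooth_on U f -> smooth_on U g.
Proof. by move=> oU fg /smooth_onP Cf; apply/smooth_onP => k; exact: Ck_eq (Cf k). Qed.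

Lemma smooth_on_sub U V f : V `<=` U -> smooth_on U f -> smooth_on V f.
Proof. by move=> VU /smooth_onP Cf; apply/smooth_onP => k; exact: Ck_sub (Cf k). Qed.

Lemma smooth_on_local U f :
  (forall x, U x -> exists2 V, V x & smooth_on V f) -> smooth_on U f.
Proof.
move=> H; apply/smooth_onP => k; apply: Ck_local => x /H[V Vx /smooth_onP Cf].
by exists V.
Qed.

Lemma smooth_on_cst U (c : R) : smooth_on U (fun=> c).
Proof. by apply/smooth_onP => k; exact: Ck_cst. Qed.

Lemma smooth_onD U f g : open U -> smooth_on U f -> smooth_on U g ->
  smooth_on U (fun x => f x + g x).
Proof. by move=> oU /smooth_onP Cf /smooth_onP Cg; apply/smooth_onP => k; exact: CkD. Qed.

Lemma smooth_onM U f g : open U -> smooth_on U f -> smooth_on U g ->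
  smooth_on U (fun x => f x * g x).
Proof. by move=> oU /smooth_onP Cf /smooth_onP Cg; apply/smooth_onP => k; exact: CkM. Qed.

Lemma smooth_onN U f : open U -> smooth_on U f -> smooth_on U (fun x => - f x).
Proof.
move=> oU sf; apply: (@smooth_on_eq _ (fun x => -1 * f x)) => //.
  by move=> x _; rewrite mulN1r.
by apply: smooth_onM => //; exact: smooth_on_cst.
Qed.

Lemma smooth_onB U f g : open U -> smooth_on U f -> smooth_on U g ->
  smooth_on U (fun x => f x - g x).
Proof. by move=> oU sf sg; exact: smooth_onD oU sf (smooth_onN oU sg). Qed.

Lemma smooth_on_sum (I : Type) (r : seq I) U (F : I -> 'rV[R]_n -> R) : open U ->
  (forall i, smooth_on U (F i)) -> smooth_on U (fun x => \sum_(i <- r) F i x).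
Proof.
move=> oU sF; elim: r => [|i r IH].
  by refine (smooth_on_eq oU _ (smooth_on_cst (U:=U) 0)) => x _; rewrite big_nil.
refine (smooth_on_eq oU _ (smooth_onD oU (sF i) IH)) => x _.
by rewrite big_cons.
Qed.

(* Smoothness is inherited by a family of functions whose derivatives are linear
   combinations of members of the family. *)
Lemma smooth_on_comp (T : Type) (h : T -> R -> R) (h' : T -> seq (R * T)) U f :
  open U -> smooth_on U f ->
  (forall t x, U x ->
     is_derive (f x) 1 (h t) (\sum_(c <- h' t) c.1 * h c.2 (f x))) ->
  forall t, smooth_on U (fun x => h t (f x)).
Proof.
move=> oU /smooth_onP Cf dh t; apply/smooth_onP => k.
apply: (Ck_comp oU (Cf k) dh) => t' x Ux.
apply/differentiable_continuous/derivable1_diffP.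
exact: (@ex_derive _ _ _ _ _ _ _ (dh t' x Ux)).
Qed.

Lemma smooth_on_powR U f (a : R) : open U -> (forall x, U x -> 0 < f x) ->
  smooth_on U f -> smooth_on U (fun x => f x `^ a).
Proof.
move=> oU f0 sf.
apply: (@smooth_on_comp R (fun a y => y `^ a) (fun a => [:: (a, a - 1)])) => //.
move=> t x Ux; rewrite big_seq1/=; exact: is_derive1_powR (f0 x Ux).
Qed.

Lemma smooth_onV U f : open U -> (forall x, U x -> 0 < f x) ->
  smooth_on U f -> smooth_on U (fun x => (f x)^-1).
Proof.
move=> oU f0 sf; refine (smooth_on_eq oU _ (smooth_on_powR (-1) oU f0 sf)) => x Ux.
by rewrite powR_inv1// ltW// f0.
Qed.

Lemma partial_shift i f c x : partial i (fun y => f (y + c)) x = partial i f (x + c).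
Proof.
rewrite /partial /derive; apply: (congr1 (fun F : R -> R => lim (F @ 0^'))).
by apply/funext => h /=; rewrite addrA.
Qed.

Lemma derivable_shift f c x v : derivable f (x + c) v -> derivable (fun y => f (y + c)) x v.
Proof.
rewrite /derivable (_ : (fun h => _ *: (f (h *: v + (x + c)) - _)) =
  fun h => h^-1 *: (f (h *: v + x + c) - f (x + c)))//.
by apply/funext => h; rewrite addrA.
Qed.

Lemma continuous_at_shift f (c : 'rV[R]_n) x : {for x + c, continuous f} ->
  {for x, continuous (fun y : 'rV[R]_n => f (y + c))}.
Proof.
move=> cf; have ct : {for x, continuous ((id : 'rV[R]_n -> 'rV[R]_n) + cst c)}.
  by apply: continuousD; [exact: cvg_id|exact: cst_continuous].
exact: (continuous_comp ct cf).
Qed.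

Lemma smooth_on_shift U f c : smooth_on U f ->
  smooth_on [set x | U (x + c)] (fun x => f (x + c)).
Proof.
move=> /smooth_onP Cf; apply/smooth_onP => k; have := Cf k.
have C1 g : C1_on U g -> C1_on [set x | U (x + c)] (fun x => g (x + c)).
  move=> cg x /cg[cgx dg]; split; first exact: continuous_at_shift.
  move=> i; have [dgi cgi] := dg i; split; first exact: derivable_shift.
  rewrite (_ : partial i _ = fun y => partial i g (y + c)).
    exact: continuous_at_shift.
  by apply/funext => y; exact: partial_shift.
elim: k f {Cf} => [|k IH] f; first exact: C1.
move=> [cf dcf]; split; first exact: C1 cf.
move=> i; rewrite (_ : partial i _ = fun y => partial i f (y + c)).
  exact: IH (dcf i).
by apply/funext => y; exact: partial_shift.
Qed.

Lemma is_derive_coord i j x : is_derive x (e_ j) (fun y => y ord0 i) (i == j)%:R.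
Proof.
have E : (fun h : R => h^-1 *: (((h *: e_ j + x) ord0 i) - x ord0 i)) @ 0^' --> ((i == j)%:R : R).
  apply: cvg_near_cst; near=> h; rewrite !mxE eqxx /= addrK /GRing.scale/= mulrA mulVf ?mul1r//.
  by near: h; exact: nbhs_dnbhs_neq.
by apply: DeriveDef; [apply/cvg_ex; eexists; exact: E|exact/cvg_lim].
Unshelve. all: by end_near. Qed.

Lemma smooth_on_coord U i : smooth_on U (fun x => x ord0 i).
Proof.
apply/smooth_onP; suff C1 : C1_on U (fun x => x ord0 i).
  case=> [//|k]; split=> // j.
  rewrite (_ : partial j _ = fun=> (i == j)%:R); first exact: Ck_cst.
  apply/funext => x; exact: (@derive_val _ _ _ _ _ _ _ (is_derive_coord i j x)).
apply: (@C1_on_sub _ _ setT) => //.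
apply: (@C1_onP _ _ _ _ (fun j _ => (i == j)%:R)) => //; first exact: openT.
- move=> x _; exact: coord_continuous.
- by move=> j x _; exact: is_derive_coord.
- by move=> j x _; exact: cst_continuous.
Qed.

End SmoothFunctions.

(** * Symmetry of second partial derivatives *)

Section Schwarz.
Context {R : realType} {n : nat}.
Implicit Types (U : set 'rV[R]_n) (f : 'rV[R]_n -> R) (x : 'rV[R]_n).
Local Notation e_ i := (delta_mx ord0 i : 'rV[R]_n).

Lemma MVT0 (f df : R -> R) (h : R) : 0 < h ->
  (forall s, 0 <= s <= h -> is_derive s 1 f (df s)) ->
  exists2 s, 0 <= s <= h & f h - f 0 = df s * h.
Proof.
move=> h0 dfE.
have [s| |s] := @MVT R f df 0 h h0.
- by rewrite in_itv/= => /andP[? ?]; apply: dfE; rewrite !ltW.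
- apply: derivable_within_continuous => s; rewrite in_itv/= => sh.
  by have [] := dfE s sh.
- by rewrite in_itv/= subr0 => /andP[? ?] E; exists s => //; rewrite !ltW.
Qed.

Lemma is_derive_C1_line U f x i (s : R) : C1_on U f -> U (s *: e_ i + x) ->
  is_derive s 1 (fun t => f (t *: e_ i + x)) (partial i f (s *: e_ i + x)).
Proof. by move=> cf Us; exact: (is_derive_line (C1_on_derivable i cf Us)). Qed.

(** Two applications of the mean value theorem: to the difference of [f] in direction j, along
    direction i, and then to [partial i f] along direction j. The intermediate point lies in the
    square, and no continuity of the mixed derivative is needed yet. *)
Lemma mixed_difference U f x i j (h : R) : 0 < h ->
  C1_on U f -> C1_on U (partial i f) ->
  (forall s t, 0 <= s <= h -> 0 <= t <= h -> U (s *: e_ i + (t *: e_ j + x))) ->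
  exists s t, [/\ 0 <= s <= h, 0 <= t <= h &
   (f (h *: e_ i + (h *: e_ j + x)) - f (h *: e_ i + x)) -
   (f (h *: e_ j + x) - f x) =
   partial j (partial i f) (t *: e_ j + (s *: e_ i + x)) * h * h].
Proof.
move=> h0 cf cif Usq.
have h00 : (0 : R) <= (0 : R) <= h by rewrite lexx ltW.
have hhh : 0 <= h <= h by rewrite lexx ltW.
have [|s sh sE] := @MVT0 (fun s => f (s *: e_ i + (h *: e_ j + x)) - f (s *: e_ i + x))
  (fun s => partial i f (s *: e_ i + (h *: e_ j + x)) - partial i f (s *: e_ i + x)) h h0.
  move=> s sh; apply: is_deriveB.
    by apply: (is_derive_C1_line (x := h *: e_ j + x) cf); exact: Usq.
  apply: (is_derive_C1_line (x := x) cf).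
  by have := Usq s 0 sh h00; rewrite scale0r add0r.
have [|t th tE] := @MVT0 (fun t => partial i f (t *: e_ j + (s *: e_ i + x)))
  (fun t => partial j (partial i f) (t *: e_ j + (s *: e_ i + x))) h h0.
  move=> t th; apply: (is_derive_C1_line (x := s *: e_ i + x) cif).
  by rewrite addrCA; exact: Usq.
exists s, t; split=> //.
move: sE tE; rewrite !scale0r !add0r => -> <-.
by rewrite [X in partial i f X - _]addrCA.
Qed.

Lemma nbhs_square (W : set 'rV[R]_n) x i j : nbhs x W ->
  exists2 h : R, 0 < h & forall s t, 0 <= s <= h -> 0 <= t <= h ->
    W (s *: e_ i + (t *: e_ j + x)).
Proof.
move=> /nbhs_ballP[r /= r0 xW]; pose N := `|e_ i| + `|e_ j| + 1.
have N0 : 0 < N by rewrite ltr_wpDl// addr_ge0.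
exists (r / 2 / N); first by rewrite !divr_gt0.
move=> s t /andP[s0 sh] /andP[t0 th]; apply: xW.
rewrite -ball_normE /ball_/= addrA opprD addrCA subrr addr0 normrN.
rewrite (le_lt_trans (ler_normD _ _))// !normrZ (ger0_norm s0) (ger0_norm t0).
have : s * `|e_ i| + t * `|e_ j| <= r / 2 / N * N.
  rewrite /N !mulrDr mulr1 -[leLHS]addr0; apply: lerD; last by rewrite !divr_ge0 ?ltW.
  by apply: lerD; rewrite ler_wpM2r.
by rewrite divfK ?gt_eqF// => /le_lt_trans; apply; rewrite gtr_pMr// invf_lt1// ltr1n.
Qed.

Lemma dist_common (a b c d e : R) :
  `|a - c| < e / 2 -> `|b - d| < e / 2 -> c = d -> `|a - b| <= e.
Proof.
move=> ac bd cd; rewrite (_ : a - b = (a - c) - (b - d)); last by rewrite cd; ring.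
by rewrite (le_trans (ler_normB _ _))// (splitr e) lerD// ltW.
Qed.

(** The second difference is symmetric in [i] and [j], so on every small square the two mixed
    derivatives take a common value, possibly at different points. Continuity at [x] turns this into
    equality up to any [e]. *)
Lemma partialC U f x i j : open U -> U x -> C1_on U f ->
  C1_on U (partial i f) -> C1_on U (partial j f) ->
  partial j (partial i f) x = partial i (partial j f) x.
Proof.
move=> oU Ux cf cif cjf.
apply/eqP; rewrite -subr_eq0 -normr_eq0; apply/eqP/le_anti; rewrite normr_ge0 andbT.
apply/ler_addgt0Pr => e e0; rewrite add0r.
have e20 : 0 < e / 2 by rewrite divr_gt0.
pose g1 := partial j (partial i f); pose g2 := partial i (partial j f).
have n1 : nbhs x [set y | `|g1 x - g1 y| < e / 2].
  by have /cvgrPdist_lt/(_ _ e20) := C1_on_partial j cif Ux.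
have n2 : nbhs x [set y | `|g2 x - g2 y| < e / 2].
  by have /cvgrPdist_lt/(_ _ e20) := C1_on_partial i cjf Ux.
have [h h0 sq] := nbhs_square i j (filterI (open_nbhs_nbhs (conj oU Ux)) (filterI n1 n2)).
have [s [t [sh th E1]]] := mixed_difference h0 cf cif (fun s t sh th => (sq s t sh th).1).
have sq' s' t' : 0 <= s' <= h -> 0 <= t' <= h -> U (s' *: e_ j + (t' *: e_ i + x)).
  by move=> sh' th'; rewrite addrCA; have [] := sq t' s' th' sh'.
have [s' [t' [sh' th' E2]]] := mixed_difference h0 cf cjf sq'.
have E : g1 (t *: e_ j + (s *: e_ i + x)) = g2 (t' *: e_ i + (s' *: e_ j + x)).
  have hn0 : h != 0 by rewrite gt_eqF.
  apply: (mulIf hn0); apply: (mulIf hn0); apply: etrans (esym E1) _.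
  apply: etrans E2; rewrite [h *: e_ j + (h *: e_ i + x)]addrCA; ring.
have [_ [/= A1 _]] := sq s t sh th; have [_ [_ /= A2]] := sq t' s' th' sh'.
rewrite [t *: _ + _]addrCA in E.
exact: dist_common A1 A2 E.
Qed.

End Schwarz.

(** * Smooth steps and bumps *)

Section Bump.
Context {R : realType}.
Implicit Types (s t : R) (m : nat).

(* The index m makes the family closed under differentiation, as smooth_on_comp requires. *)
Definition flat m s : R := if 0 < s then s^-1 ^+ m * expR (- s^-1) else 0.

Lemma flat_ge0 m s : 0 <= flat m s.
Proof.
rewrite /flat; case: ifPn => // s0.
by rewrite mulr_ge0 ?expR_ge0// exprn_ge0// invr_ge0 ltW.
Qed.

Lemma flat_gt0 m s : 0 < s -> 0 < flat m s.
Proof. by move=> s0; rewrite /flat s0 mulr_gt0 ?expR_gt0// exprn_gt0// invr_gt0. Qed.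

Lemma flat_eq0 m s : s <= 0 -> flat m s = 0.
Proof. by move=> s0; rewrite /flat ltNge s0. Qed.

(** The square in [s] makes the difference quotients at 0 tend to 0. The bound is t <= exp t at t =
    1 / ((m + 2) s), raised to the power m + 2. *)
Lemma flat_le m s : flat m s <= m.+2%:R ^+ m.+2 * s ^+ 2.
Proof.
rewrite /flat; case: ifPn => [s0|_]; last by rewrite mulr_ge0 ?sqr_ge0// exprn_ge0// ler0n.
set k : R := m.+2%:R; have k0 : 0 < k by rewrite ltr0n.
have y0 : 0 < s^-1 / k by rewrite divr_gt0// invr_gt0.
have H : (s^-1 / k) ^+ m.+2 <= expR s^-1.
  rewrite (_ : expR s^-1 = expR (s^-1 / k) ^+ m.+2); last by rewrite -expRM_natr divfK// lt0r_neq0.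
  have E : s^-1 / k <= expR (s^-1 / k).
    by apply: le_trans (expR_ge1Dx _); rewrite lerDr.
  by apply: lerXn2r E; rewrite nnegrE ltW// expR_gt0.
rewrite expRN -ler_pdivlMr ?invr_gt0 ?expR_gt0// invrK.
rewrite -(ler_pM2l (x := k ^+ m.+2 * s ^+ 2)) in H; last by rewrite mulr_gt0// exprn_gt0.
apply: le_trans H; rewrite le_eqVlt; apply/orP; left; apply/eqP.
rewrite exprMn (_ : s^-1 ^+ m.+2 = s^-1 ^+ m * s^-1 ^+ 2); last by rewrite -exprD addn2.
rewrite [k^-1 ^+ _]exprVn.
have : k ^+ m.+2 != 0 by rewrite gt_eqF// exprn_gt0.
by move: (k ^+ _) (s^-1 ^+ m) => K a K0; field; rewrite K0 gt_eqF.
Qed.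

Lemma is_derive_flat m s :
  is_derive s 1 (flat m) (- m%:R * flat m.+1 s + flat m.+2 s).
Proof.
have [s0|s0|->] := ltgtP s 0.
- rewrite !(flat_eq0 _ (ltW s0)) mulr0 addr0.
  apply: (@near_eq_is_derive _ _ _ (cst (0 : R))).
  by near=> t; rewrite /= flat_eq0//; apply: ltW; near: t; exact: lt_nbhsl.
- apply: (@near_eq_is_derive _ _ _ (fun t => t^-1 ^+ m * expR (- t^-1))).
    by near=> t; rewrite /flat ifT//; near: t; exact: lt_nbhsr.
  have s_neq0 : s != 0 by rewrite gt_eqF.
  have dV : is_derive s 1 (fun t : R => t^-1) (- s^-1 ^+ 2).
    have := @is_deriveV _ id s 1 1 s_neq0 (is_derive_id _ _).
    by rewrite /GRing.scale/= mulr1 -exprVn.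
  have dE : is_derive s 1 (fun t : R => expR (- t^-1)) (expR (- s^-1) * s^-1 ^+ 2).
    have dN : is_derive s 1 (fun t : R => - t^-1) (s^-1 ^+ 2).
      by rewrite -[X in is_derive _ _ _ X]opprK; exact: is_deriveN.
    have := @is_derive1_comp _ expR (fun t : R => - t^-1) s _ _ (is_derive_expR _) dN.
    exact.
  have dX : is_derive s 1 (fun t : R => t^-1 ^+ m) (m%:R * s^-1 ^+ m.-1 * (- s^-1 ^+ 2)).
    have := @is_deriveX _ _ (fun t : R => t^-1) m s 1 _ dV.
    rewrite (_ : (fun t : R => t^-1) ^+ m = fun t => t^-1 ^+ m)//.
    by apply/funext => t; rewrite exprfctE.
  apply: is_derive_eq.
  rewrite /flat s0 /GRing.scale/=; case: m dX => [|m] _; first by rewrite !expr0 /=; ring.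
  by rewrite /= !exprS; ring.
- rewrite !flat_eq0// mulr0 addr0.
  have H : (fun h : R => h^-1 *: (flat m (h *: 1 + 0) - flat m 0)) @ 0^' --> (0 : R).
    set C : R := m.+2%:R ^+ m.+2.
    have HN : `|h| @[h --> (0 : R)^'] --> `|0 : R|.
      by apply: cvg_norm => A nA; exact: nbhs_dnbhs nA.
    have H0 : C * `|h| @[h --> (0 : R)^'] --> (0 : R).
      by rewrite -[X in _ --> X](mulr0 C); apply: cvgMr; rewrite normr0 in HN.
    apply: (@squeeze_cvgr _ _ _ _ (fun h => - (C * `|h|)) (fun h => C * `|h|)).
    + near=> h; have h0 : h != 0 by near: h; exact: nbhs_dnbhs_neq.
      rewrite -ler_norml (flat_eq0 _ (lexx 0)) subr0 addr0 /GRing.scale/= mulr1 normrM.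
      rewrite normfV ler_pdivrMl ?normr_gt0// (ger0_norm (flat_ge0 _ _)).
      by apply: le_trans (flat_le _ _) _; rewrite [leRHS]mulrCA -[`|h| * _]expr2 real_normK ?num_real.
    + by rewrite -[X in _ --> X]oppr0; exact: cvgN.
    + exact: H0.
  by apply: DeriveDef; [apply/cvg_ex; exists 0|exact/cvg_lim].
Unshelve. all: by end_near. Qed.

Lemma continuous_flat m : continuous (flat m).
Proof.
move=> s; apply/differentiable_continuous/derivable1_diffP.
exact: (@ex_derive _ _ _ _ _ _ _ (is_derive_flat m s)).
Qed.

Lemma smooth_on_flat n (U : set 'rV[R]_n) f m : open U -> smooth_on U f ->
  smooth_on U (fun x => flat m (f x)).
Proof.
move=> oU sf.
apply: (@smooth_on_comp _ _ _ flat (fun m => [:: (- m%:R, m.+1); (1, m.+2)])) => //.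
move=> k x Ux; rewrite big_cons big_seq1 /= mul1r; exact: is_derive_flat.
Qed.

Definition step_den s : R := flat 0 (s - 1) + flat 0 (2 - s).

Lemma step_den_gt0 s : 0 < step_den s.
Proof.
rewrite /step_den; have [s1|s1] := ltP 1 s.
  by rewrite ltr_pwDl ?flat_ge0// flat_gt0// subr_gt0.
by rewrite ltr_wpDl ?flat_ge0// flat_gt0//; lra.
Qed.

(** A smooth transition from 0 on s <= 1 to 1 on s >= 2. *)
Definition step s : R := flat 0 (s - 1) / step_den s.

(** The derivative of [step] by the quotient rule, [flat 2] being the derivative of [flat 0]. From
    this formula its sign, its continuity and its vanishing outside [1, 2] can be read off. *)
Definition dstep s : R :=
  (flat 2 (s - 1) * flat 0 (2 - s) + flat 0 (s - 1) * flat 2 (2 - s)) / step_den s ^+ 2.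

Lemma step_ge0 s : 0 <= step s.
Proof. by rewrite divr_ge0 ?flat_ge0// ltW// step_den_gt0. Qed.

Lemma step_le1 s : step s <= 1.
Proof. by rewrite ler_pdivrMr ?step_den_gt0// mul1r lerDl flat_ge0. Qed.

Lemma step_eq0 s : s <= 1 -> step s = 0.
Proof. by move=> s1; rewrite /step flat_eq0 ?mul0r// subr_le0. Qed.

Lemma step_eq1 s : 2 <= s -> step s = 1.
Proof.
move=> s2; rewrite /step /step_den (@flat_eq0 _ (2 - s)) ?subr_le0// addr0 divff//.
by rewrite gt_eqF// flat_gt0//; lra.
Qed.

Lemma dstep_ge0 s : 0 <= dstep s.
Proof.
by rewrite divr_ge0 ?sqr_ge0// addr_ge0// mulr_ge0 ?flat_ge0.
Qed.

Lemma dstep_eq0 s : (s <= 1) || (2 <= s) -> dstep s = 0.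
Proof.
rewrite /dstep => /orP[s1|s2].
  by rewrite !(@flat_eq0 _ (s - 1)) ?subr_le0// !mul0r addr0 mul0r.
by rewrite !(@flat_eq0 _ (2 - s)) ?subr_le0// !mulr0 addr0 mul0r.
Qed.

Lemma is_derive_step s : is_derive s 1 step (dstep s).
Proof.
have d1 : is_derive s (1 : R) (fun s => flat 0 (s - 1)) (flat 2 (s - 1)).
  have D := is_derive_flat 0 (s - 1).
  rewrite oppr0 mul0r add0r in D.
  have D' : is_derive s (1 : R) (fun s : R => s - 1) 1.
    by apply: is_derive_eq; rewrite subr0.
  have := @is_derive1_comp _ (flat 0) (fun s => s - 1) s _ _ D D'; rewrite mulr1; exact.
have d2 : is_derive s (1 : R) (fun s => flat 0 (2 - s)) (- flat 2 (2 - s)).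
  have D := is_derive_flat 0 (2 - s).
  rewrite oppr0 mul0r add0r in D.
  have D' : is_derive s (1 : R) (fun s : R => 2 - s) (-1).
    by apply: is_derive_eq; rewrite add0r mul1r.
  have := @is_derive1_comp _ (flat 0) (fun s => 2 - s) s _ _ D D'; rewrite mulrN1; exact.
have d3 := is_deriveD d1 d2.
have d4 := @is_deriveV _ _ s _ 1 (lt0r_neq0 (step_den_gt0 s)) d3.
have d5 := is_deriveM d1 d4.
apply: (@is_derive_eq _ _ _ _ _ _ _ _ d5).
rewrite /GRing.scale /= /dstep -/(step_den s) -exprVn.
have : step_den s != 0 by rewrite lt0r_neq0// step_den_gt0.
rewrite /step_den; move: (flat 0 (s - 1)) (flat 0 (2 - s)) => a b ab0.
by field.
Qed.

Lemma continuous_dstep : continuous dstep.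
Proof.
have c1 m : continuous (fun s => flat m (s - 1)).
  move=> s; apply: (@continuous_comp _ _ _ (fun s => s - 1) (flat m)); last exact: continuous_flat.
  by apply: cvgB; [exact: cvg_id|exact: cvg_cst].
have c2 m : continuous (fun s => flat m (2 - s)).
  move=> s; apply: (@continuous_comp _ _ _ (fun s => 2 - s) (flat m)); last exact: continuous_flat.
  by apply: cvgB; [exact: cvg_cst|exact: cvg_id].
move=> s; apply: cvgM.
  by apply: cvgD; apply: cvgM; [exact: c1|exact: c2|exact: c1|exact: c2].
apply: cvgV; first by rewrite expf_neq0// lt0r_neq0// step_den_gt0.
have c3 : step_den x @[x --> s] --> step_den s by apply: cvgD; [exact: c1|exact: c2].
exact: (cvgM c3 c3).
Qed.

(** A scale-invariant bound: at s = (k+1) v it gives C / v for the derivative in v of the cutoff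
    step((k+1) v), with the same C for every k. *)
Lemma mul_dstep_bounded : exists C, forall s, `|s * dstep s| <= C.
Proof.
have [||c _ cmax] := @EVT_max R (fun s => `|s * dstep s|) 1 2.
- by rewrite ler1n.
- apply: continuous_subspaceT => s; apply: cvg_norm; apply: cvgM; first exact: cvg_id.
  exact: continuous_dstep.
exists (`|c * dstep c|) => s.
have [s12|] := boolP (s \in `[1, 2]); first exact: cmax.
rewrite in_itv/= negb_and -!ltNge => s12.
rewrite dstep_eq0 ?mulr0 ?normr0//.
by apply/orP; case/orP: s12 => /ltW H; [left|right].
Qed.

Lemma smooth_on_step n (U : set 'rV[R]_n) f : open U -> smooth_on U f ->
  smooth_on U (fun x => step (f x)).
Proof.
move=> oU sf; have s1 : smooth_on U (fun x => flat 0 (f x - 1)).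
  exact: (smooth_on_flat 0 oU (smooth_onB oU sf (smooth_on_cst (U:=U) 1))).
have s2 : smooth_on U (fun x => flat 0 (2 - f x)).
  exact: (smooth_on_flat 0 oU (smooth_onB oU (smooth_on_cst (U:=U) 2) sf)).
refine (smooth_onM oU s1 (smooth_onV oU _ (smooth_onD oU s1 s2))).
by move=> x _; exact: step_den_gt0.
Qed.

End Bump.

Section BallBump.
Context {R : realType} {n : nat}.
Implicit Types (p x : 'rV[R]_n) (r : R).

(** The norm on row vectors is the sup norm; the squared Euclidean distance is a polynomial, which
    makes the bumps built from it smooth. *)
Definition sqdist p x : R := \sum_i (x ord0 i - p ord0 i) ^+ 2.

Lemma smooth_on_sqdist p : smooth_on setT (sqdist p).
Proof.
apply: smooth_on_sum => [|i]; first exact: openT.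
have oT := @openT 'rV[R]_n.
have s : smooth_on setT (fun x : 'rV[R]_n => x ord0 i - p ord0 i).
  by apply: (smooth_onB oT); [exact: smooth_on_coord|exact: smooth_on_cst].
exact: (smooth_onM oT s s).
Qed.

Lemma sqdistxx p : sqdist p p = 0.
Proof. by rewrite /sqdist big1// => i _; rewrite subrr expr0n. Qed.

Lemma sqdist_ball p x r : 0 < r -> sqdist p x < r ^+ 2 -> ball p r x.
Proof.
move=> r0 H; split=> // i j; rewrite (ord1 i) /ball/= distrC.
rewrite -(ltr_pXn2r (n := 2)) ?nnegrE ?normr_ge0 ?ltW// real_normK ?num_real//.
apply: le_lt_trans H; rewrite /sqdist (bigD1 j)//= lerDl.
by apply: sumr_ge0 => k _; exact: sqr_ge0.
Qed.

Definition bump p r x : R := flat 0 (r ^+ 2 - sqdist p x).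

Lemma smooth_on_bump p r : smooth_on setT (bump p r).
Proof.
have oT := @openT 'rV[R]_n.
apply: smooth_on_flat => //; apply: (smooth_onB oT); first exact: smooth_on_cst.
exact: smooth_on_sqdist.
Qed.

Lemma bump_ge0 p r x : 0 <= bump p r x.
Proof. exact: flat_ge0. Qed.

Lemma bump_gt0 p r x : sqdist p x < r ^+ 2 -> 0 < bump p r x.
Proof. by move=> H; apply: flat_gt0; rewrite subr_gt0. Qed.

Lemma bump_neq0 p r x : bump p r x != 0 -> sqdist p x < r ^+ 2.
Proof. by apply: contraNT; rewrite -leNgt => H; rewrite /bump flat_eq0// subr_le0. Qed.

End BallBump.

(** * Integration on open subsets of R^n *)

Section BorelSets.
Context {R : realType} {n : nat}.
Implicit Types (U K : set 'rV[R]_n) (f : 'rV[R]_n -> R).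
Local Notation mu := (lebesgue_rV n : {sigma_finite_measure set 'rV[R]_n -> \bar R}).

Definition box (A : 'I_n -> set R) : set 'rV[R]_n := [set x | forall i, A i (x ord0 i)].

Lemma measurable_box (A : 'I_n -> set R) :
  (forall i, measurable (A i : set (measurableTypeR R))) -> measurable (box A).
Proof.
move=> mA.
rewrite (_ : box A = \bigcap_(i in [set: 'I_n])
    ((fun x : 'rV[R]_n => x ord0 i : measurableTypeR R) @^-1` A i)).
  apply: fin_bigcap_measurable => // i _.
  by rewrite -[X in measurable X]setTI; exact: measurable_coord.
by apply/seteqP; split=> x /= xA i; [move=> _|]; exact: xA.
Qed.

Definition rat_box (q : 'rV[rat]_n * nat) : set 'rV[R]_n :=
  box (fun i => ball (ratr (q.1 ord0 i) : R) (q.2.+1%:R^-1)).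

(** The sigma-algebra is generated by the coordinates, so measurability of open sets is a statement
    about countable unions of boxes. Boxes with rational centres and half-widths 1 / (k + 1) are
    enough. *)
Lemma open_rat_box U : open U ->
  U = \bigcup_(q in [set q | rat_box q `<=` U]) rat_box q.
Proof.
move=> oU; apply/seteqP; split=> x; last by case=> q /= qU; exact: qU.
move=> Ux; have /nbhs_ballP[r /= r0 xU] := open_nbhs_nbhs (conj oU Ux).
have [k kr] : exists k : nat, k.+1%:R^-1 < r / 2.
  have r20 : 0 < r / 2 by rewrite divr_gt0.
  exists (Num.truncn (r / 2)^-1).
  rewrite invf_plt ?posrE ?ltr0n//.
  exact: truncnS_gt.
have Q i : exists q : rat, ball (ratr q : R) k.+1%:R^-1 (x ord0 i).
  have k0 : (0 : R) < k.+1%:R^-1 by rewrite invr_gt0 ltr0n.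
  have : x ord0 i - k.+1%:R^-1 < x ord0 i + k.+1%:R^-1.
    by rewrite ltrD2l gt0_cp.
  move=> /rat_in_itvoo[q]; rewrite in_itv/= => /andP[q1 q2]; exists q.
  by rewrite /ball/= ltr_norml ltrBlDl q2 andbT ltrBrDr addrC q1.
have [q qP] := choice Q.
exists (\row_i q i, k) => /=; last by move=> i; rewrite /= mxE; exact: qP.
move=> y yq; apply: xU; split=> // i j; rewrite (ord1 i).
have := yq j; rewrite /= mxE => yj.
have := ball_triangle (ball_sym (qP j)) yj; apply: le_ball.
by rewrite /= [leRHS](splitr r) lerD// ltW.
Qed.

Lemma measurable_open U : open U -> measurable U.
Proof.
move=> oU; rewrite (open_rat_box oU).
rewrite bigcup_mkcond; apply: countable_bigcupT_measurable => [|q]; first exact: countableP.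
case: ifP => _; last exact: measurable0.
apply: measurable_box => i; exact: measurable_realfun.measurable_ball.
Qed.

Lemma measurable_closed K : closed K -> measurable K.
Proof.
move=> cK; rewrite -(setCK K); apply: measurableC; apply: measurable_open.
exact: closed_openC.
Qed.

Lemma measurable_continuous U f : open U ->
  (forall x, U x -> {for x, continuous f}) ->
  measurable_fun U (f : 'rV[R]_n -> measurableTypeR R).
Proof.
move=> oU cf.
apply: (measurability _ (measurable_realfun.RGenOInfty.measurableE R)) => _ [_ [a ->] <-].
apply: measurable_open; rewrite openE => x [/= Ux]; rewrite in_itv/= andbT => xa.
have nU : nbhs x U by exact: open_nbhs_nbhs.
have na : nbhs x [set y | a < f y] by exact: (cvgr_gt (f x) (cf x Ux) _ xa).
by apply: filterS2 nU na => y Uy ya; split=> //=; rewrite in_itv/= andbT.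
Qed.


Lemma measurable_continuousT f : continuous f ->
  measurable_fun setT (f : 'rV[R]_n -> measurableTypeR R).
Proof. by move=> cf; apply: measurable_continuous => [|x _]; [exact: openT|exact: cf]. Qed.

Lemma compact_sub_cube K : compact K -> exists2 M : R, 0 < M &
  forall x, K x -> forall i, `|x ord0 i| <= M.
Proof.
move=> /compact_bounded[M [_ KM]]; exists (`|M| + 1); first by rewrite ltr_wpDl.
move=> x Kx i; apply: le_trans (KM (`|M| + 1) _ x Kx); last first.
  by rewrite (le_lt_trans (ler_norm _))// ltrDl.
rewrite /Num.Def.normr /= mx_normE; exact: (le_bigmax _ (fun j => `|x j.1 j.2|%:nng) (ord0, i)).
Qed.

Lemma lebesgue_rV_compact K : compact K -> (mu K < +oo)%E.
Proof.
move=> cK; have [M M0 KM] := compact_sub_cube cK.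
have mA (i : 'I_n) : measurable (`[- M, M]%classic : set (measurableTypeR R)).
  exact: measurable_itv.
have := lebesgue_rV_box mA.
rewrite big_const_ord => E.
apply: (@le_lt_trans _ _ (mu (box (fun _ => `[- M, M]%classic)))).
  apply: le_measure; rewrite ?inE.
  - apply: measurable_closed; apply: compact_closed => //; exact: norm_hausdorff.
  - exact: measurable_box.
  - by move=> x Kx i; rewrite /= in_itv/= -ler_norml; exact: KM.
rewrite [ltLHS]E lebesgue_measure_itv /=; case: ifP => _.
  elim: {+}n => [|k IH] /=; first exact: ltry.
  rewrite -EFinD lte_mul_pinfty//.
  by rewrite lee_fin; lra.
elim: {+}n => [|k IH] /=; first exact: ltry.
by rewrite mul0e ltry.
Qed.

Lemma integrable_compact U f K (C : R) : open U ->
  measurable_fun U (f : 'rV[R]_n -> measurableTypeR R) -> compact K ->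
  (forall x, U x -> `|f x| <= C * \1_K x) -> mu.-integrable U (EFin \o f).
Proof.
move=> oU mf cK fC; have mU := measurable_open oU.
have mK : measurable K by apply: measurable_closed; apply: compact_closed => //; exact: norm_hausdorff.
apply: (@le_integrable _ _ _ mu U mU _ (EFin \o (fun x => C * \1_K x))).
- exact/measurable_EFinP.
- move=> x Ux /=; rewrite lee_fin (le_trans (fC x Ux))//; exact: ler_norm.
- apply: (integrableS measurableT mU) => //.
  rewrite (_ : EFin \o _ = fun x => (C%:E * (\1_K x)%:E)%E); last by apply/funext => x /=; rewrite EFinM.
  apply: integrableZl => //; apply/integrableP; split; first exact/measurable_EFinP.
  rewrite (eq_integral (fun x => (\1_K x)%:E)); last first.
    by move=> t _; rewrite gee0_abs// lee_fin.
  by rewrite integral_indic// setIT; exact: lebesgue_rV_compact.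
Qed.

Lemma lebesgue_rV_open_gt0 U x : open U -> U x -> (0 < mu U)%E.
Proof.
move=> oU Ux; have /nbhs_ballP[r /= r0 xU] := open_nbhs_nbhs (conj oU Ux).
pose A i : set (measurableTypeR R) := `](x ord0 i - r), (x ord0 i + r)[%classic.
have mA (i : 'I_n) : measurable (A i) by exact: measurable_itv.
have E := lebesgue_rV_box mA.
apply: (@lt_le_trans _ _ (mu (box A))); last first.
  apply: le_measure; rewrite ?inE; [exact: measurable_box|exact: measurable_open|].
  move=> y yA; apply: xU; split=> // i j; rewrite (ord1 i).
  have := yA j; rewrite /A /= in_itv/= => /andP[y1 y2].
  by rewrite /ball/= ltr_norml; apply/andP; split; lra.
rewrite [ltRHS]E.
apply: (big_ind (fun z : \bar R => (0 < z)%E)) => //.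
- exact: mule_gt0.
- move=> i _; rewrite lebesgue_measure_itv /= lte_fin ltrD2l gt0_cp//.
  by rewrite -EFinD lte_fin; lra.
Qed.

End BorelSets.

(** * The divergence theorem for compactly supported functions *)

Section IntegralOfPartial.
Context {R : realType}.

Lemma integral_derive_line (g g' : R -> R) (M : R) :
  (forall t, is_derive t (1 : R) g (g' t)) -> continuous g' ->
  (forall t, M < `|t| -> g t = 0) ->
  (\int[lebesgue_measure]_(t in [set: measurableTypeR R]) (g' t)%:E = 0)%E.
Proof.
move=> dg cg' g0; pose b : R := `|M| + 1; pose a := - b.
have b0 : 0 < b by rewrite ltr_wpDl.
have Mb : M < b by rewrite (le_lt_trans (ler_norm _))// ltrDl.
have ab : a < b by rewrite (@lt_trans _ _ 0)// oppr_lt0.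
have gout t : b <= `|t| -> g t = 0 by move=> bt; apply: g0; exact: lt_le_trans bt.
have g'0 t : b < `|t| -> g' t = 0.
  move=> bt; have [_ <-] := dg t; have -> : 'D_1 g t = 'D_1 (cst (0 : R)) t.
    have ct : {for t, continuous (fun s : R => `|s|)} by exact: norm_continuous.
    have nb : nbhs t [set s | b < `|s|] by exact: (cvgr_gt `|t| ct _ bt).
    by apply: near_eq_derive; apply: filterS nb => s /ltW/gout.
  by rewrite derive_cst.
have cg : continuous g.
  move=> t; apply/differentiable_continuous/derivable1_diffP.
  exact: (@ex_derive _ _ _ _ _ _ _ (dg t)).
have := @continuous_FTC2 R g' g a b ab.
have ga : g a = 0 by apply: gout; rewrite /a normrN ger0_norm ?lexx ?ltW.
have gb : g b = 0 by apply: gout; rewrite ger0_norm ?lexx ?ltW.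
rewrite ga gb sube0 => FTC.
rewrite -[RHS]FTC; first last.
- by move=> t _; rewrite derive1E; have [_ ->] := dg t.
- split; [|by apply: cvg_at_right_filter; exact: cg|by apply: cvg_at_left_filter; exact: cg].
  by move=> t _; have [] := dg t.
- by apply: continuous_subspaceT => t; exact: cg'.
rewrite [RHS]integral_mkcond; apply: eq_integral => t _.
rewrite /patch; case: ifPn => // /negP; rewrite inE/= in_itv/= => /negP.
by rewrite -ler_norml -ltNge => bt; rewrite g'0.
Qed.

Definition cube n (M : R) : set 'rV[R]_n := [set x | forall i, `|x ord0 i| <= M].

Lemma compact_cube n (M : R) : compact (@cube n M).
Proof.
apply: bounded_closed_compact.
  exists `|M|; split; first exact: num_real.
  move=> N MN x xM; rewrite /Num.Def.normr /= mx_normrE.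
  apply: bigmax_le => [|[i j] _]; first by rewrite (le_trans _ (ltW MN)).
  rewrite /= (ord1 i); apply: le_trans (xM j) _.
  by rewrite (le_trans (ler_norm _))// ltW.
rewrite (_ : cube M = \bigcap_(i in [set: 'I_n]) [set x | `|x ord0 i| <= M]).
  apply: closed_bigI => i _.
  apply: (@closed_comp _ _ (fun x : 'rV[R]_n => `|x ord0 i|) [set y | y <= M]).
    by move=> x _; apply: continuous_comp; [exact: coord_continuous|exact: norm_continuous].
  exact: closed_le.
by apply/seteqP; split => x H i; [move=> _; exact: H|exact: H].
Qed.

Lemma open_setC_cube n (M : R) : open (~` @cube n M).
Proof. by apply: closed_openC; apply: compact_closed; [exact: norm_hausdorff|exact: compact_cube]. Qed.

Lemma partial_zero n (f : 'rV[R]_n -> R) (V : set 'rV[R]_n) i x :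
  open V -> V x -> (forall y, V y -> f y = 0) -> partial i f x = 0.
Proof.
move=> oV Vx f0; rewrite (@partial_near _ _ i f (fun=> 0)) ?partial_cst//.
exact: open_near_eq f0.
Qed.

Lemma rV_cons_line n (t : R) (y : 'rV[R]_n) :
  rV_cons (t : measurableTypeR R, y) = t *: delta_mx ord0 ord0 + rV_cons (0 : measurableTypeR R, y).
Proof.
apply/rowP => i; rewrite [RHS]mxE [X in X + _]mxE [X in _ * X + _]mxE.
case: (unliftP ord0 i) => [j|] ->.
  by rewrite !rV_consS /= mulr0 add0r.
by rewrite !rV_cons0 eqxx /= mulr1 addr0.
Qed.

Lemma rV_cons_shift n (t s : R) (y : 'rV[R]_n) j :
  rV_cons (t : measurableTypeR R, s *: delta_mx ord0 j + y) =
  s *: delta_mx ord0 (lift ord0 j) + rV_cons (t : measurableTypeR R, y).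
Proof.
apply/rowP => i; rewrite [RHS]mxE.
rewrite [X in _ = X + _](_ : _ = s * (i == lift ord0 j)%:R); last by rewrite !mxE.
case: (unliftP ord0 i) => [k|] ->.
  by rewrite !rV_consS /= !mxE (inj_eq lift_inj).
by rewrite !rV_cons0 /= mulr0 add0r.
Qed.

Lemma continuous_rV_cons n (t : R) :
  continuous (fun y : 'rV[R]_n => rV_cons (t : measurableTypeR R, y)).
Proof.
move=> y A /nbhs_ballP[r /= r0 yA]; apply/nbhs_ballP; exists r => // z yz.
apply: yA; split=> // i j; rewrite (ord1 i); case: (unliftP ord0 j) => [k|] ->.
  by rewrite !rV_consS; exact: (yz.2 ord0 k).
by rewrite !rV_cons0; exact: ballxx.
Qed.

Lemma C1_on_slice n (f : 'rV[R]_n.+1 -> R) (t : R) : C1_on setT f ->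
  C1_on setT (fun y : 'rV[R]_n => f (rV_cons (t : measurableTypeR R, y))) /\
  forall j y, partial j (fun y : 'rV[R]_n => f (rV_cons (t : measurableTypeR R, y))) y =
    partial (lift ord0 j) f (rV_cons (t : measurableTypeR R, y)).
Proof.
move=> cf.
have D j (y : 'rV[R]_n) : is_derive y (delta_mx ord0 j)
    (fun y : 'rV[R]_n => f (rV_cons (t : measurableTypeR R, y)))
    (partial (lift ord0 j) f (rV_cons (t : measurableTypeR R, y))).
  have E : (fun h : R => f (rV_cons (t : measurableTypeR R, h *: delta_mx ord0 j + y))) =
           (fun h : R => f (h *: delta_mx ord0 (lift ord0 j) + rV_cons (t : measurableTypeR R, y))).
    by apply/funext => h; rewrite rV_cons_shift.
  have df : derivable f (rV_cons (t : measurableTypeR R, y)) (delta_mx ord0 (lift ord0 j)).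
    exact: (@C1_on_derivable _ _ setT).
  apply: DeriveDef.
    by apply/derivable_line; rewrite E; exact/derivable_line.
  by rewrite /partial derive_line E -derive_line.
split; last by move=> j y; have [_ <-] := D j y.
apply: (C1_onP _ _ (fun j y _ => D j y)) => [|y _|j y _]; first exact: openT.
  apply: continuous_comp; first exact: continuous_rV_cons.
  exact: (@C1_on_continuous _ _ setT).
apply: (@continuous_comp _ _ _ _ (partial (lift ord0 j) f)); first exact: continuous_rV_cons.
exact: (@C1_on_partial _ _ setT).
Qed.

(** Fubini for the product of the line and [lebesgue_rV n]. If [i] is the first coordinate,
    integrate along the line first: the integrand is the derivative of a function of bounded
    support. Otherwise fix the first coordinate and apply the induction hypothesis to the slice. *)
Lemma integral_partial_eq0 n (f : 'rV[R]_n -> R) (M : R) i : C1_on setT f ->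
  (forall x, ~ cube M x -> f x = 0) ->
  (\int[lebesgue_rV n]_(x in [set: 'rV[R]_n]) (partial i f x)%:E = 0)%E.
Proof.
elim: n f i => [f [[]//]|n IH f i cf f0].
have cpf : continuous (partial i f) by move=> x; exact: (@C1_on_partial _ _ setT).
have pf0 x : ~ cube M x -> partial i f x = 0.
  by move=> xM; apply: (@partial_zero _ f (~` cube M)) => //; exact: open_setC_cube.
have mpf := measurable_continuousT cpf.
have ipf : (lebesgue_rV n.+1).-integrable setT (EFin \o partial i f).
  have [C C0 pfC] : exists2 C, 0 <= C & forall x, cube M x -> `|partial i f x| <= C.
    have : bounded_set (partial i f @` cube M).
      apply: compact_bounded; apply: continuous_compact; last exact: compact_cube.
      exact: continuous_subspaceT.
    move=> [N [_ HN]]; exists (`|N| + 1); first by rewrite addr_ge0.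
    move=> x Mx; apply: HN; last by exists x.
    by rewrite (le_lt_trans (ler_norm _))// ltrDl.
  apply: (@integrable_compact _ _ setT _ (cube M) C) => //.
  + exact: openT.
  + exact: compact_cube.
  + move=> x _; rewrite indicE; case: (boolP (x \in cube M)); rewrite ?inE => xM.
      by rewrite mulr1; exact: pfC.
    by move/negP: xM; rewrite inE => xM; rewrite pf0// normr0 mulr0.
have mpf' : measurable_fun setT (EFin \o partial i f) by exact/measurable_EFinP.
have ipfc : (lebesgue_measure \x lebesgue_rV n)%E.-integrable setT
    ((EFin \o partial i f) \o @rV_cons R n).
  apply/integrableP; split.
    by apply: measurableT_comp => //; exact: measurable_rV_cons.
  have /integrableP[_] := ipf; apply: le_lt_trans.
  rewrite [leRHS](@ge0_integral_pushforward _ _ _ _ _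
    (@rV_cons R n) (@measurable_rV_cons R n) (lebesgue_measure \x lebesgue_rV n)%E setT)//.
  exact: measurableT_comp.
have -> : (\int[lebesgue_rV n.+1]_(x in [set: 'rV[R]_n.+1]) (partial i f x)%:E =
   \int[lebesgue_measure \x lebesgue_rV n]_x (((EFin \o partial i f) \o @rV_cons R n) x))%E.
  exact: (@integral_pushforward _ _ _ _ _
    (@rV_cons R n) (@measurable_rV_cons R n) (lebesgue_measure \x lebesgue_rV n)%E setT).
case: (unliftP ord0 i) => [j|] iE.
  rewrite -integral12_prod_meas1//; apply: integral0_eq => t _.
  have [cs ps] := C1_on_slice t cf.
  rewrite -[RHS](IH (fun y => f (rV_cons (t : measurableTypeR R, y))) j cs).
    by apply: eq_integral => y _; rewrite /= ps iE.
  move=> y yM; apply: f0 => H; apply: yM => k.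
  by have := H (lift ord0 k); rewrite rV_consS.
rewrite -integral21_prod_meas1//; apply: integral0_eq => y _.
pose g (t : R) := f (rV_cons (t : measurableTypeR R, y)).
pose g' (t : R) := partial i f (rV_cons (t : measurableTypeR R, y)).
rewrite -[RHS](@integral_derive_line g g' M).
- by apply: eq_integral => t _.
- move=> t; have := @is_derive_C1_line _ _ setT f (rV_cons (0 : measurableTypeR R, y)) ord0 t cf I.
  rewrite /g /g' iE; under eq_fun do rewrite -rV_cons_line.
  by rewrite -rV_cons_line.
- move=> t; apply: (@continuous_comp _ _ _ 
    (fun t : R => rV_cons (t : measurableTypeR R, y)) (partial i f)); last exact: cpf.
  move=> A /nbhs_ballP[r /= r0 tA]; apply/nbhs_ballP; exists r => // s ts.
  apply: tA; split=> // k j; rewrite (ord1 k); case: (unliftP ord0 j) => [l|] ->.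
    by rewrite !rV_consS; exact: ballxx.
  by rewrite !rV_cons0.
- move=> t tM; apply: f0 => /(_ ord0); rewrite rV_cons0 /= => tM'.
  by move: tM; rewrite ltNge tM'.
Qed.

Lemma divergence_theorem0 n (f : 'rV[R]_n -> R) (K : set 'rV[R]_n) i :
  C1_on setT f -> compact K -> (forall x, ~ K x -> f x = 0) ->
  (\int[lebesgue_rV n]_(x in [set: 'rV[R]_n]) (partial i f x)%:E = 0)%E.
Proof.
move=> cf cK f0; have [M _ KM] := compact_sub_cube cK.
apply: (@integral_partial_eq0 _ _ M) => // x xM; apply: f0 => /KM; exact: xM.
Qed.

End IntegralOfPartial.

Section IntegrationOnOpen.
Context {R : realType} {n : nat}.
Implicit Types (U K : set 'rV[R]_n) (f g : 'rV[R]_n -> R).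
Local Notation mu := (lebesgue_rV n : {sigma_finite_measure set 'rV[R]_n -> \bar R}).
Local Notation Int U f := (\int[mu]_(x in U) f x)%R.

Definition cont_on U f := forall x, U x -> {for x, continuous f}.

Definition intg U f := mu.-integrable U (EFin \o f).

Lemma cont_onD U f g : cont_on U f -> cont_on U g -> cont_on U (fun x => f x + g x).
Proof. by move=> cf cg x Ux; apply: continuous_atD; [exact: cf|exact: cg]. Qed.

Lemma cont_onM U f g : cont_on U f -> cont_on U g -> cont_on U (fun x => f x * g x).
Proof. by move=> cf cg x Ux; apply: continuous_atM; [exact: cf|exact: cg]. Qed.

Lemma cont_on_cst U (c : R) : cont_on U (fun=> c).
Proof. by move=> x _; exact: cst_continuous. Qed.

Lemma cont_onN U f : cont_on U f -> cont_on U (fun x => - f x).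
Proof. by move=> cf x Ux; exact: (continuousN (cf x Ux)). Qed.

Lemma cont_onB U f g : cont_on U f -> cont_on U g -> cont_on U (fun x => f x - g x).
Proof. by move=> cf cg; exact: (cont_onD cf (cont_onN cg)). Qed.

Lemma cont_on_sum (I : Type) (r : seq I) U (F : I -> 'rV[R]_n -> R) :
  (forall i, cont_on U (F i)) -> cont_on U (fun x => \sum_(i <- r) F i x).
Proof. by move=> cF x Ux; apply: continuous_at_sum => i; exact: cF. Qed.

Lemma C1_on_cont U f : C1_on U f -> cont_on U f.
Proof. by move=> cf x Ux; exact: C1_on_continuous Ux. Qed.

Lemma C1_on_cont_partial U f i : C1_on U f -> cont_on U (partial i f).
Proof. by move=> cf x Ux; exact: C1_on_partial Ux. Qed.

Lemma cont_on_eq U f g : open U -> (forall x, U x -> f x = g x) ->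
  cont_on U f -> cont_on U g.
Proof.
by move=> oU fg cf x Ux; apply: near_eq_continuous (cf x Ux); exact: open_near_eq fg.
Qed.

Lemma intg_cont_le U f g : open U -> cont_on U f -> intg U g ->
  (forall x, U x -> `|f x| <= g x) -> intg U f.
Proof.
move=> oU cf ig fg; apply: (@le_integrable _ _ _ mu U (measurable_open oU) _ (EFin \o g)) => //.
  by apply/measurable_EFinP; exact: measurable_continuous.
by move=> x Ux /=; rewrite lee_fin (le_trans (fg x Ux))// ler_norm.
Qed.

Lemma intgD U f g : open U -> intg U f -> intg U g -> intg U (fun x => f x + g x).
Proof.
move=> oU fi gi; rewrite /intg (_ : EFin \o _ = ((EFin \o f) \+ (EFin \o g))%E)//.
by apply: integrableD => //; exact: measurable_open.
Qed.

Lemma intgZ U f (c : R) : open U -> intg U f -> intg U (fun x => c * f x).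
Proof.
move=> oU fi; rewrite /intg (_ : EFin \o _ = (fun x => c%:E * (EFin \o f) x)%E)//.
exact: (integrableZl (measurable_open oU) _ fi).
Qed.

Lemma intgN U f : open U -> intg U f -> intg U (fun x => - f x).
Proof.
move=> oU fi; have := intgZ (-1) oU fi; rewrite (_ : (fun _ => _) = (fun x => - f x))//.
by apply/funext => x; rewrite mulN1r.
Qed.

Lemma intgB U f g : open U -> intg U f -> intg U g -> intg U (fun x => f x - g x).
Proof. by move=> oU fi gi; exact: (intgD oU fi (intgN oU gi)). Qed.

Lemma intg_eq U f g : open U -> (forall x, U x -> f x = g x) -> intg U f -> intg U g.
Proof.
move=> oU fg fi; apply: (eq_integrable (measurable_open oU) (EFin \o f)) fi => x.
by rewrite inE => Ux; rewrite /= fg.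
Qed.

Lemma Int_eq U f g : (forall x, U x -> f x = g x) -> Int U f = Int U g.
Proof. by move=> fg; apply: eq_Rintegral => x; rewrite inE; exact: fg. Qed.

Lemma IntD U f g : open U -> intg U f -> intg U g ->
  Int U (fun x => f x + g x) = Int U f + Int U g.
Proof. by move=> oU fi gi; exact: (RintegralD (measurable_open oU) fi gi). Qed.

Lemma IntB U f g : open U -> intg U f -> intg U g ->
  Int U (fun x => f x - g x) = Int U f - Int U g.
Proof. by move=> oU fi gi; exact: (RintegralB (measurable_open oU) fi gi). Qed.

Lemma IntZ U f (c : R) : open U -> intg U f -> Int U (fun x => c * f x) = c * Int U f.
Proof. by move=> oU fi; exact: (RintegralZl _ (measurable_open oU) fi). Qed.

Lemma Int_EFin U f : open U -> intg U f -> (\int[mu]_(x in U) (f x)%:E)%E = (Int U f)%:E.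
Proof.
move=> oU fi; rewrite /Rintegral fineK//.
exact: (integrable_fin_num (measurable_open oU) fi).
Qed.

Lemma Int_ge0 U f : (forall x, U x -> 0 <= f x) -> 0 <= Int U f.
Proof. exact: Rintegral_ge0. Qed.

Lemma Int_le U f g : open U -> intg U f -> intg U g ->
  (forall x, U x -> f x <= g x) -> Int U f <= Int U g.
Proof. by move=> oU fi gi fg; exact: (le_Rintegral (measurable_open oU) fi gi fg). Qed.

Lemma intg_sum (I : Type) (r : seq I) U (F : I -> 'rV[R]_n -> R) : open U ->
  (forall i, intg U (F i)) ->
  intg U (fun x => \sum_(i <- r) F i x) /\
  Int U (fun x => \sum_(i <- r) F i x) = \sum_(i <- r) Int U (F i).
Proof.
move=> oU iF; elim: r => [|i r [IH1 IH2]].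
  have E x : U x -> 0 * 0 = \sum_(j <- [::]) F j x by rewrite big_nil mulr0.
  have i0 : intg U (fun=> 0 * 0).
    rewrite /intg (_ : EFin \o _ = cst 0%E); first exact: integrable0.
    by apply/funext => x /=; rewrite mulr0.
  split; first exact: (intg_eq oU E i0).
  rewrite big_nil -(Int_eq E) mulr0 /Rintegral.
  by rewrite integral0.
have E x : U x -> F i x + \sum_(j <- r) F j x = \sum_(j <- i :: r) F j x.
  by rewrite big_cons.
split; first exact: (intg_eq oU E (intgD oU (iF i) IH1)).
by rewrite big_cons -IH2 -(Int_eq E) (IntD oU (iF i) IH1).
Qed.

Lemma bounded_on_compact f K : compact K -> {within K, continuous f} ->
  exists2 B : R, 0 <= B & forall x, K x -> `|f x| <= B.
Proof.
move=> cK cf; have /compact_bounded[N [_ HN]] := continuous_compact cf cK.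
exists (`|N| + 1); first by rewrite addr_ge0.
move=> x Kx; apply: HN; last by exists x.
by rewrite (le_lt_trans (ler_norm _))// ltrDl.
Qed.

Lemma cont_on_within U K f : K `<=` U -> cont_on U f -> {within K, continuous f}.
Proof.
move=> KU cf; apply: continuous_in_subspaceT => x; rewrite inE => /KU; exact: cf.
Qed.

Lemma compactC K : compact K -> open (~` K).
Proof. by move=> cK; apply: closed_openC; apply: compact_closed => //; exact: norm_hausdorff. Qed.

(** Nothing is known of [f] outside [U], hence the indicator. The open sets [U] and the complement
    of [K] cover the space, and the product is 0 on the second. *)
Lemma C1_on_extend U K f : open U -> compact K -> K `<=` U -> C1_on U f ->
  (forall x, U x -> ~ K x -> f x = 0) ->
  C1_on setT (fun x => f x * \1_U x).
Proof.
move=> oU cK KU cf f0; apply: C1_on_local => x _; have [Ux|nUx] := pselect (U x).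
  by exists U => //; apply: (C1_on_eq oU _ cf) => y Uy; rewrite indicE mem_set// mulr1.
exists (~` K); first by move=> /KU.
apply: (C1_on_eq (compactC cK) _ (@C1_on_cst _ _ _ 0)) => y nKy.
rewrite indicE; case: (boolP (y \in U)); last by rewrite mulr0.
by rewrite inE => Uy; rewrite f0// mul0r.
Qed.

Lemma intg_cont_compact U f K : open U -> cont_on U f -> compact K -> K `<=` U ->
  (forall x, U x -> ~ K x -> f x = 0) -> intg U f.
Proof.
move=> oU cf cK KU f0.
have [B B0 fB] := bounded_on_compact cK (cont_on_within KU cf).
apply: (@integrable_compact _ _ U f K B) => //; first exact: measurable_continuous.
move=> x Ux; rewrite indicE; case: (boolP (x \in K)); rewrite ?inE => xK.
  by rewrite mulr1; exact: fB.
by move/negP: xK; rewrite inE => xK; rewrite f0// normr0 mulr0.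
Qed.

Lemma Int_partial0 U K f j : open U -> compact K -> K `<=` U -> C1_on U f ->
  (forall x, U x -> ~ K x -> f x = 0) ->
  intg U (partial j f) /\ Int U (partial j f) = 0.
Proof.
move=> oU cK KU cf f0.
have p0 x : U x -> ~ K x -> partial j f x = 0.
  move=> Ux Kx; apply: (@partial_zero _ _ f (U `&` ~` K)) => //.
    by apply: openI => //; exact: compactC.
  by move=> y [Uy Ky]; exact: f0.
split; first by refine (intg_cont_compact oU _ cK KU p0); exact: C1_on_cont_partial.
pose F x := f x * \1_U x.
have cF : C1_on setT F by exact (C1_on_extend oU cK KU cf f0).
rewrite /Rintegral -[RHS]/(fine 0) -(@divergence_theorem0 _ _ F K j cF cK); last first.
  move=> x nKx; rewrite /F indicE; case: (boolP (x \in U)); last by rewrite mulr0.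
  by rewrite inE => Ux; rewrite f0// mul0r.
rewrite integral_mkcond; congr fine; apply: eq_integral => x _.
rewrite /patch; case: ifPn; rewrite ?inE => xU.
  congr EFin; apply: partial_near; apply: (open_near_eq oU) => // y Uy.
  by rewrite /F indicE mem_set// mulr1.
move/negP : xU; rewrite inE => xU.
rewrite (@partial_zero _ _ F (~` K))//; first exact: compactC.
  by move=> /KU.
move=> y nKy; rewrite /F indicE; case: (boolP (y \in U)); last by rewrite mulr0.
by rewrite inE => Uy; rewrite f0// mul0r.
Qed.

Lemma Int_div0 U K (Y : 'I_n -> 'rV[R]_n -> R) : open U -> compact K -> K `<=` U ->
  (forall j, C1_on U (Y j)) -> (forall j x, U x -> ~ K x -> Y j x = 0) ->
  intg U (fun x => \sum_j partial j (Y j) x) /\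
  Int U (fun x => \sum_j partial j (Y j) x) = 0.
Proof.
move=> oU cK KU cY Y0.
have H j := Int_partial0 j oU cK KU (cY j) (Y0 j).
have [I1 I2] := intg_sum (index_enum _) oU (fun j => (H j).1).
by split=> //; rewrite I2 big1// => j _; have [] := H j.
Qed.

Lemma Int_dominated U (F : nat -> 'rV[R]_n -> R) f g : open U ->
  (forall k, cont_on U (F k)) -> intg U g ->
  (forall x, U x -> F k x @[k --> \oo] --> f x) ->
  (forall k x, U x -> `|F k x| <= g x) ->
  intg U f /\ Int U (F k) @[k --> \oo] --> Int U f.
Proof.
move=> oU cF ig Ff Fg; have mU := measurable_open oU.
have mF k : measurable_fun U (EFin \o F k).
  by apply/measurable_EFinP; exact (measurable_continuous oU (cF k)).
have mf : measurable_fun U (EFin \o f).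
  apply: (emeasurable_fun_cvg (fun k => EFin \o F k)) => // x Ux.
  by apply: cvg_EFin; [exact: nearW|exact: Ff].
have FfE x : U x -> (F k x)%:E @[k --> \oo] --> (f x)%:E.
  by move=> Ux; apply: cvg_EFin; [exact: nearW|exact: Ff].
have FgE x k : U x -> (`|(F k x)%:E| <= (g x)%:E)%E.
  by move=> Ux; rewrite /= lee_fin; exact: Fg.
have [fi _ Ic] := @dominated_convergence _ _ _ mu U mU (fun k => EFin \o F k)
  (EFin \o f) (EFin \o g) mF mf (aeW _ FfE) ig (aeW _ FgE).
split=> //; apply: fine_cvg; rewrite -/(Int U f) -Int_EFin//.
Qed.

End IntegrationOnOpen.

(** * The fundamental lemma of the calculus of variations *)

Section FundamentalLemma.
Context {R : realType} {n : nat}.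
Implicit Types (U K Omega : set 'rV[R]_n) (f g h : 'rV[R]_n -> R) (p x : 'rV[R]_n).
Local Notation mu := (lebesgue_rV n : {sigma_finite_measure set 'rV[R]_n -> \bar R}).
Local Notation Int U f := (\int[mu]_(x in U) f x)%R.

Definition ccube p (r : R) : set 'rV[R]_n := [set x | forall i, `|x ord0 i - p ord0 i| <= r].

Lemma compact_ccube p r : compact (ccube p r).
Proof.
apply: (@subclosed_compact _ _ (cube (`|p| + `|r|))); last 1 first.
- move=> x xr i; rewrite -[x ord0 i](subrK (p ord0 i)).
  rewrite (le_trans (ler_normD _ _))// addrC lerD//; last first.
    by rewrite (le_trans (xr i))// ler_norm.
  rewrite /Num.Def.normr /= mx_normrE.
  exact: (le_bigmax _ (fun j : 'I_1 * 'I_n => `|p j.1 j.2|) (ord0, i)).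
- rewrite (_ : ccube p r = \bigcap_(i in [set: 'I_n]) [set x | `|x ord0 i - p ord0 i| <= r]).
    apply: closed_bigI => i _.
    apply: (@closed_comp _ _
      (fun x : 'rV[R]_n => `|x ord0 i - p ord0 i|) [set y | y <= r]); last exact: closed_le.
    move=> x _; apply: (@continuous_comp _ _ _
      (fun x : 'rV[R]_n => x ord0 i - p ord0 i) (fun y : R => `|y|)); last exact: norm_continuous.
    apply: (@continuous_atD _ _ (fun x : 'rV[R]_n => x ord0 i) (fun=> - p ord0 i)); last exact: cst_continuous.
    exact: coord_continuous.
  by apply/seteqP; split => x H i; [move=> _; exact: H|exact: H].
- exact: compact_cube.
Qed.

Arguments compact_ccube p r : clear implicits.

Lemma closed_ccube p r : closed (ccube p r).
Proof. by apply: compact_closed; [exact: norm_hausdorff|exact: compact_ccube]. Qed.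

Lemma nbhs_ccube U p : nbhs p U -> exists2 r : R, 0 < r & ccube p r `<=` U.
Proof.
move=> /nbhs_ballP[r /= r0 pU]; exists (r / 2); first by rewrite divr_gt0.
move=> x xr; apply: pU; split=> // i j; rewrite (ord1 i) /ball/= distrC.
by rewrite (le_lt_trans (xr j))// gtr_pMr// invf_lt1// ltr1n.
Qed.

Lemma sqdist_ccube p r x : 0 < r -> sqdist p x < r ^+ 2 -> ccube p r x.
Proof.
move=> r0 /(sqdist_ball r0)[_ H] i.
by have := H ord0 i; rewrite /ball/= distrC => /ltW.
Qed.

Lemma bump_ccube p r x : 0 < r -> bump p r x != 0 -> ccube p r x.
Proof. by move=> r0 /bump_neq0; exact: sqdist_ccube. Qed.

Lemma open_sqdist p r : open [set x | sqdist p x < r ^+ 2].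
Proof.
rewrite openE => x /= xr.
have cs : {for x, continuous (sqdist p)} := C1_on_continuous (smooth_on_C1 (smooth_on_sqdist p)) I.
exact: (cvgr_lt (sqdist p x) cs _ xr).
Qed.

Lemma compactly_supported (V : nmodType) Omega K (F : 'rV[R]_n -> V) : compact K ->
  K `<=` Omega -> (forall x, F x != 0 -> K x) -> compactly_supported_in Omega F.
Proof.
move=> cK KO FK; have cl : closed K by apply: compact_closed => //; exact: norm_hausdorff.
have sub : closure [set x | F x != 0] `<=` K.
  by rewrite closureE; apply: smallest_sub.
split; last exact: subset_trans KO.
by apply: subclosed_compact cK sub; exact: closed_closure.
Qed.

(** If [h p > 0], then [h] is positive on a small cube around [p], and a bump supported there gives
    a nonnegative integrand with integral 0. It would vanish almost everywhere, although it is
    positive on an open Euclidean ball, which has positive measure. *)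
Lemma fundamental_lemma U h : open U -> cont_on U h ->
  (forall p r, 0 < r -> ccube p r `<=` U -> Int U (fun x => bump p r x * h x) = 0) ->
  forall p, U p -> h p = 0.
Proof.
move=> oU ch Ih p Up.
wlog hp : h ch Ih / 0 < h p.
  move=> W; have [h0|h0|//] := ltgtP (h p) 0; last exact: W.
  suff : - h p = 0 by move/eqP; rewrite oppr_eq0 => /eqP.
  apply: (W (fun x => - h x)); [exact: cont_onN| |by rewrite oppr_gt0].
  move=> q r r0 qU; have cb : cont_on U (fun x => bump q r x * h x).
    refine (cont_onM _ ch) => x _; exact: (C1_on_continuous (smooth_on_C1 (smooth_on_bump q r)) I).
  have ib : intg U (fun x => bump q r x * h x).
    refine (intg_cont_compact oU cb (compact_ccube q r) qU _) => x _ nx.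
    by have [->|/(bump_ccube r0)//] := eqVneq (bump q r x) 0; rewrite mul0r.
  rewrite -[RHS](mulr0 (-1)) -(Ih q r r0 qU) -(IntZ (-1) oU ib).
  by apply: Int_eq => x _; rewrite mulN1r mulrN.
have n1 : nbhs p [set x | 0 < h x] by exact: (cvgr_gt (h p) (ch p Up) _ hp).
have [r r0 rU] := nbhs_ccube (filterI (open_nbhs_nbhs (conj oU Up)) n1).
have {}Ih := Ih p r r0 (fun x xr => (rU x xr).1).
pose k x := bump p r x * h x.
have ck : cont_on U k.
  refine (cont_onM _ ch) => x _; exact: (C1_on_continuous (smooth_on_C1 (smooth_on_bump p r)) I).
have k0 x : 0 <= k x.
  rewrite /k; have [->|bn0] := eqVneq (bump p r x) 0; first by rewrite mul0r.
  by rewrite mulr_ge0 ?bump_ge0// ltW//; have [] := rU x (bump_ccube r0 bn0).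
have ik : intg U k.
  refine (intg_cont_compact oU ck (compact_ccube p r) (fun x xr => (rU x xr).1) _) => x _ nx.
  by rewrite /k; have [->|/(bump_ccube r0)//] := eqVneq (bump p r x) 0; rewrite mul0r.
have : (\int[mu]_(x in U) `|(k x)%:E| = 0)%E.
  rewrite (eq_integral (fun x => (k x)%:E)); last by move=> x _; rewrite gee0_abs// lee_fin.
  by rewrite Int_EFin// Ih.
have mk : measurable_fun U (EFin \o k).
  by apply/measurable_EFinP; exact (measurable_continuous oU ck).
move/(ae_eq_integral_abs mu (measurable_open oU) mk) => [N [mN N0 NP]].
pose B := [set x | sqdist p x < r ^+ 2].
have BN : B `<=` N.
  move=> x xB; apply: NP => /= H; have [Ux hx] := rU x (sqdist_ccube r0 xB).
  have := H Ux => /eqP; rewrite eqe mulf_eq0 => /orP[/eqP E|/eqP E].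
    by have := bump_gt0 xB; rewrite E ltxx.
  by move: hx; rewrite /= E ltxx.
have Bp : B p by rewrite /B /= sqdistxx exprn_gt0.
have oB : open B by exact: open_sqdist.
have := lebesgue_rV_open_gt0 oB Bp.
by rewrite -N0 ltNge le_measure ?inE//; exact (measurable_open oB).
Qed.

End FundamentalLemma.

Arguments compact_ccube {R n} p r.

Section SmoothPartials.
Context {R : realType} {n : nat}.
Implicit Types (U : set 'rV[R]_n) (f g : 'rV[R]_n -> R) (x : 'rV[R]_n).

Lemma C1_partialD U i f g x : C1_on U f -> C1_on U g -> U x ->
  partial i (fun y => f y + g y) x = partial i f x + partial i g x.
Proof.
move=> cf cg Ux; exact: (partialD (C1_on_derivable i cf Ux) (C1_on_derivable i cg Ux)).
Qed.

Lemma C1_partialB U i f g x : C1_on U f -> C1_on U g -> U x ->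
  partial i (fun y => f y - g y) x = partial i f x - partial i g x.
Proof.
move=> cf cg Ux; exact: (partialB (C1_on_derivable i cf Ux) (C1_on_derivable i cg Ux)).
Qed.

Lemma C1_partialM U i f g x : C1_on U f -> C1_on U g -> U x ->
  partial i (fun y => f y * g y) x = partial i f x * g x + f x * partial i g x.
Proof.
move=> cf cg Ux; exact: (partialM (C1_on_derivable i cf Ux) (C1_on_derivable i cg Ux)).
Qed.

Lemma C1_partialZ U i f (c : R) x : C1_on U f -> U x ->
  partial i (fun y => c * f y) x = c * partial i f x.
Proof.
move=> cf Ux; rewrite (C1_partialM i (@C1_on_cst _ _ U c) cf Ux) partial_cst.
by rewrite mul0r add0r.
Qed.

Lemma C1_on_sum (I : Type) (r : seq I) U (F : I -> 'rV[R]_n -> R) : open U ->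
  (forall k, C1_on U (F k)) -> C1_on U (fun y => \sum_(k <- r) F k y).
Proof.
move=> oU cF; elim: r => [|k r IH].
  by apply: (C1_on_eq oU _ (@C1_on_cst _ _ U 0)) => x _; rewrite big_nil.
apply: (C1_on_eq oU _ (C1_onD oU (cF k) IH)) => x _.
by rewrite big_cons.
Qed.

Lemma C1_partial_sum (I : Type) (r : seq I) U i (F : I -> 'rV[R]_n -> R) x : open U ->
  (forall k, C1_on U (F k)) -> U x ->
  partial i (fun y => \sum_(k <- r) F k y) x = \sum_(k <- r) partial i (F k) x.
Proof.
move=> oU cF Ux; elim: r => [|k r IH].
  rewrite big_nil -[RHS](partial_cst i 0 x); congr (partial i _ x).
  by apply/funext => y; rewrite big_nil.
rewrite big_cons -IH -(C1_partialD i (cF k) (C1_on_sum _ oU cF) Ux).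
by congr (partial i _ x); apply/funext => y; rewrite big_cons.
Qed.

Lemma C1_partial_powR U i f (a : R) x : open U -> C1_on U f ->
  (forall y, U y -> 0 < f y) -> U x ->
  partial i (fun y => f y `^ a) x = a * f x `^ (a - 1) * partial i f x.
Proof.
move=> oU cf f0 Ux.
have [||_ ->//] := @C1_on_comp _ _ U (fun y => y `^ a) (fun y => a * y `^ (a - 1)) f oU cf.
- by move=> y Uy; exact: is_derive1_powR (f0 y Uy).
- move=> y Uy; apply: continuous_atM; first exact: cst_continuous.
  apply/differentiable_continuous/derivable1_diffP.
  exact: (@ex_derive _ _ _ _ _ _ _ (is_derive1_powR (a - 1) (f0 y Uy))).
Qed.

Lemma smooth_partialC U f x i j : open U -> smooth_on U f -> U x ->
  partial j (partial i f) x = partial i (partial j f) x.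
Proof.
move=> oU sf Ux; apply: (partialC oU Ux (smooth_on_C1 sf));
  exact: (smooth_on_C1 (smooth_on_partial _ sf)).
Qed.

End SmoothPartials.

Lemma sum_delta (R : pzRingType) n (F : 'I_n -> R) i : \sum_j F j * (i == j)%:R = F i.
Proof.
rewrite (bigD1 i)//= eqxx mulr1 big1 ?addr0// => j /negPf.
by rewrite eq_sym => ->; rewrite mulr0.
Qed.

Lemma powR_pred (R : realType) (a x : R) : 0 < x -> x `^ a = x * x `^ (a - 1).
Proof.
move=> x0; rewrite -{2}[x](powRr1 (ltW x0)) -powRD; last by rewrite (gt_eqF x0) implybT.
by rewrite addrC subrK.
Qed.

(** * First and second variation on the positivity set *)

Section FirstVariation.
Context {R : realType} {n : nat}.
Variables (Omega U : set 'rV[R]_n) (v : 'rV[R]_n -> R) (alpha : R).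
Hypothesis oU : open U.
Hypothesis UO : U `<=` Omega.
Hypothesis v_gt0 : forall x, U x -> 0 < v x.
Hypothesis sv : smooth_on U v.
Local Notation mu := (lebesgue_rV n : {sigma_finite_measure set 'rV[R]_n -> \bar R}).
Local Notation Int U f := (\int[mu]_(x in U) f x)%R.

Local Notation g i := (partial i v).
Local Notation H i j := (partial j (partial i v)).
Definition gsq x := \sum_i g i x ^+ 2.
Definition lap x := \sum_i H i i x.
Local Notation f := (fun x => v x `^ alpha).

Lemma smooth_g i : smooth_on U (g i). Proof. exact: smooth_on_partial. Qed.

Lemma smooth_H i j : smooth_on U (H i j). Proof. exact/smooth_on_partial/smooth_g. Qed.

Lemma smooth_gsq : smooth_on U gsq.
Proof. exact (smooth_on_sum _ oU (fun i => smooth_onM oU (smooth_g i) (smooth_g i))). Qed.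

Lemma smooth_lap : smooth_on U lap.
Proof. exact (smooth_on_sum _ oU (fun i => smooth_H i i)). Qed.

Lemma smooth_pow a : smooth_on U (fun x => v x `^ a).
Proof. exact (smooth_on_powR a oU v_gt0 sv). Qed.

Lemma partial_pow a i x : U x ->
  partial i (fun y => v y `^ a) x = a * v x `^ (a - 1) * g i x.
Proof. exact: (C1_partial_powR i a oU (smooth_on_C1 sv) v_gt0). Qed.

Lemma HC i j x : U x -> H i j x = H j i x.
Proof. exact: smooth_partialC. Qed.

Lemma partial_gsq j x : U x -> partial j gsq x = 2 * \sum_i g i x * H i j x.
Proof.
move=> Ux; rewrite /gsq (C1_partial_sum _ j oU (F := fun i y => g i y ^+ 2)) => [|i|//].
  rewrite mulr_sumr; apply: eq_bigr => i _.
  rewrite (C1_partialM j (smooth_on_C1 (smooth_g i)) (smooth_on_C1 (smooth_g i)) Ux).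
  by ring.
exact: (smooth_on_C1 (smooth_onM oU (smooth_g i) (smooth_g i))).
Qed.

(** The stress tensor of the functional: the first variation pairs it with the Jacobian of the test
    field, so criticality means that its divergence vanishes. *)
Definition stress i j x := f x * (gsq x + 1) * (i == j)%:R - 2 * (f x * (g i x * g j x)).

Lemma smooth_A : smooth_on U (fun x => f x * (gsq x + 1)).
Proof.
exact: (smooth_onM oU (smooth_pow alpha) (smooth_onD oU smooth_gsq (smooth_on_cst (U:=U) 1))).
Qed.

Lemma smooth_fgg i j : smooth_on U (fun x => f x * (g i x * g j x)).
Proof.
exact: (smooth_onM oU (smooth_pow alpha) (smooth_onM oU (smooth_g i) (smooth_g j))).
Qed.

Lemma smooth_stress i j : smooth_on U (stress i j).
Proof.
apply: (smooth_onB oU); first exact: (smooth_onM oU smooth_A (smooth_on_cst (U:=U) _)).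
exact: (smooth_onM oU (smooth_on_cst (U:=U) 2) (smooth_fgg i j)).
Qed.

Lemma partial_A j x : U x -> partial j (fun x => f x * (gsq x + 1)) x =
  alpha * v x `^ (alpha - 1) * g j x * (gsq x + 1) + 2 * (f x * \sum_i g i x * H i j x).
Proof.
move=> Ux.
rewrite (C1_partialM j (smooth_on_C1 (smooth_pow alpha))
    (smooth_on_C1 (smooth_onD oU smooth_gsq (smooth_on_cst (U:=U) 1))) Ux).
rewrite partial_pow// (C1_partialD j (smooth_on_C1 smooth_gsq) (@C1_on_cst _ _ U 1) Ux).
by rewrite partial_cst partial_gsq//; ring.
Qed.

Lemma div_stress i x : U x ->
  \sum_j partial j (stress i j) x =
  g i x * (v x `^ (alpha - 1)) * (alpha * (1 - gsq x) - 2 * (v x * lap x)).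
Proof.
move=> Ux; have v0 := v_gt0 Ux.
have E j : partial j (stress i j) x =
    partial j (fun x => f x * (gsq x + 1)) x * (i == j)%:R -
    2 * (alpha * v x `^ (alpha - 1) * g j x * (g i x * g j x) +
     f x * (H i j x * g j x + g i x * H j j x)).
  rewrite (C1_partialB j (smooth_on_C1 (smooth_onM oU smooth_A (smooth_on_cst (U:=U) (i == j)%:R)))
     (smooth_on_C1 (smooth_onM oU (smooth_on_cst (U:=U) 2) (smooth_fgg i j))) Ux).
  rewrite (C1_partialM j (smooth_on_C1 smooth_A) (@C1_on_cst _ _ U (i == j)%:R) Ux) partial_cst mulr0 addr0.
  rewrite (C1_partialZ j 2 (smooth_on_C1 (smooth_fgg i j)) Ux).
  rewrite (C1_partialM j (smooth_on_C1 (smooth_pow alpha))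
    (smooth_on_C1 (smooth_onM oU (smooth_g i) (smooth_g j))) Ux).
  rewrite (C1_partialM j (smooth_on_C1 (smooth_g i)) (smooth_on_C1 (smooth_g j)) Ux).
  by rewrite partial_pow.
rewrite (eq_bigr _ (fun j _ => E j)) sumrB -mulr_sumr big_split/=.
rewrite sum_delta (partial_A i Ux).
have -> : \sum_j alpha * v x `^ (alpha - 1) * g j x * (g i x * g j x) =
   alpha * v x `^ (alpha - 1) * g i x * gsq x.
  rewrite /gsq mulr_sumr; apply: eq_bigr => j _.
  by move: (g j x) (g i x) (v x `^ _) => a b c; ring.
have -> : \sum_j f x * (H i j x * g j x + g i x * H j j x) =
   f x * (\sum_j g j x * H j i x + g i x * lap x).
  rewrite -mulr_sumr big_split /= /lap mulr_sumr; congr (_ * (_ + _)).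
  by apply: eq_bigr => j _; rewrite HC// mulrC.
rewrite (powR_pred alpha v0); ring.
Qed.

Definition first_density (Phi : 'rV[R]_n -> 'rV[R]_n) x :=
  \sum_i \sum_j stress i j x * partial j (fun y => Phi y ord0 i) x.

Hypothesis critical : forall Phi, test_field Omega Phi -> Int U (first_density Phi) = 0.
Hypothesis gsq_gt0 : forall x, U x -> 0 < gsq x.

Lemma test_field_bump i p r : 0 < r -> ccube p r `<=` Omega ->
  test_field Omega (fun x => bump p r x *: (delta_mx ord0 i : 'rV[R]_n)).
Proof.
move=> r0 pO; split.
  move=> j; apply: (@smooth_on_eq _ _ setT (fun x => bump p r x * (i == j)%:R)).
  - exact: openT.
  - by move=> x _; rewrite !mxE eqxx /= eq_sym.
  - exact: (smooth_onM openT (smooth_on_bump p r) (smooth_on_cst (U:=setT) _)).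
apply: (compactly_supported (compact_ccube p r)) => // x H.
apply: bump_ccube => //; apply: contra_neq H => ->; exact: scale0r.
Qed.

Lemma pde x : U x -> v x * lap x = alpha / 2 * (1 - gsq x).
Proof.
move=> Ux.
suff E i : \sum_j partial j (stress i j) x = 0.
  have [i gi] : exists i, g i x != 0.
    apply: contrapT => /forallNP g0; have := gsq_gt0 Ux.
    rewrite /gsq big1 ?ltxx// => i _; have /negP := g0 i; rewrite negbK => /eqP ->.
    by rewrite expr0n.
  have /eqP := E i; rewrite div_stress// !mulf_eq0 (negbTE gi) /=.
  by rewrite gt_eqF ?powR_gt0 ?v_gt0//= => /eqP; lra.
apply: (fundamental_lemma oU (h := fun x => \sum_j partial j (stress i j) x)) Ux.
  by apply: cont_on_sum => j; exact: (C1_on_cont_partial (smooth_on_C1 (smooth_stress i j))).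
move=> p r r0 pU.
have cb : C1_on U (bump p r) by exact (C1_on_sub (@subsetT _ U) (smooth_on_C1 (smooth_on_bump p r))).
have b0 y : ~ ccube p r y -> bump p r y = 0.
  by have [//|/(bump_ccube r0)] := eqVneq (bump p r y) 0.
have [_ I1] := Int_div0 oU (compact_ccube p r) pU
  (fun j => C1_onM oU cb (smooth_on_C1 (smooth_stress i j)))
  (fun j y _ ny => etrans (congr1 (fun t => t * stress i j y) (b0 y ny)) (mul0r _)).
have cbs : cont_on U (fun y => bump p r y * \sum_j partial j (stress i j) y).
  apply: cont_onM; first exact: C1_on_cont.
  by apply: cont_on_sum => j; exact: (C1_on_cont_partial (smooth_on_C1 (smooth_stress i j))).
have ibs : intg U (fun y => bump p r y * \sum_j partial j (stress i j) y).
  refine (intg_cont_compact oU cbs (compact_ccube p r) pU _) => y _ ny.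
  by rewrite b0// mul0r.
pose Phi x := bump p r x *: (delta_mx ord0 i : 'rV[R]_n).
have P1 j y : partial j (fun z => Phi z ord0 i) y = partial j (bump p r) y.
  by congr (partial j _ y); apply/funext => z; rewrite /Phi !mxE !eqxx mulr1.
have P2 k j y : k != i -> partial j (fun z => Phi z ord0 k) y = 0.
  move=> ki; rewrite -[RHS](partial_cst j 0 y); congr (partial j _ y).
  by apply/funext => z; rewrite /Phi !mxE (negbTE ki) andbF mulr0.
have P3 j y : U y -> partial j (fun z => bump p r z * stress i j z) y =
    partial j (bump p r) y * stress i j y + bump p r y * partial j (stress i j) y.
  exact: (C1_partialM j cb (smooth_on_C1 (smooth_stress i j))).
have E y : U y -> first_density Phi y = \sum_j partial j (bump p r) y * stress i j y.
  move=> Uy; rewrite /first_density (bigD1 i) //= [X in _ + X]big1.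
    by rewrite addr0; apply: eq_bigr => j _; rewrite mulrC P1.
  by move=> k ki; apply: big1 => j _; rewrite P2// mulr0.
have := critical (test_field_bump i r0 (subset_trans pU UO)).
rewrite -/Phi (Int_eq E) => I2.
have E2 y : U y -> (\sum_j partial j (fun z => bump p r z * stress i j z) y) -
   bump p r y * (\sum_j partial j (stress i j) y) = \sum_j partial j (bump p r) y * stress i j y.
  move=> Uy; rewrite (eq_bigr _ (fun j _ => P3 j y Uy)) big_split /= mulr_sumr addrK.
  exact.
have [i1 _] := Int_div0 oU (compact_ccube p r) pU
  (fun j => C1_onM oU cb (smooth_on_C1 (smooth_stress i j)))
  (fun j y _ ny => etrans (congr1 (fun t => t * stress i j y) (b0 y ny)) (mul0r _)).
by move: I2; rewrite -(Int_eq E2) (IntB oU i1 ibs) I1 sub0r => /eqP; rewrite oppr_eq0 => /eqP.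
Qed.

End FirstVariation.

Section FiniteSums.
Context {R : comPzRingType} {n : nat}.
Implicit Types (a b c : 'I_n -> R) (M : 'I_n -> 'I_n -> R).

Lemma dot_mulmx_sym a b M : (forall i j, M i j = M j i) ->
  \sum_i a i * (\sum_j M i j * b j) = \sum_i (\sum_j M i j * a j) * b i.
Proof.
move=> MC; under eq_bigr do rewrite mulr_sumr.
rewrite exchange_big /=; apply: eq_bigr => j _; rewrite mulr_suml.
by apply: eq_bigr => i _; rewrite MC; ring.
Qed.

Lemma contract3 a b c (T : 'I_n -> 'I_n -> 'I_n -> R) :
  (forall i j l, T i j l = T l j i) ->
  \sum_i a i * (\sum_j (\sum_l b l * T i j l) * c j) =
  \sum_i b i * (\sum_j (\sum_l a l * T i j l) * c j).
Proof.
move=> TC.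
have E (a' b' : 'I_n -> R) : \sum_i a' i * (\sum_j (\sum_l b' l * T i j l) * c j) =
    \sum_i \sum_l \sum_j a' i * b' l * T i j l * c j.
  apply: eq_bigr => i _; rewrite mulr_sumr exchange_big /=; apply: eq_bigr => j _.
  by rewrite mulr_suml mulr_sumr; apply: eq_bigr => l _; ring.
rewrite !E exchange_big /=; apply: eq_bigr => l _; apply: eq_bigr => i _.
by apply: eq_bigr => j _; rewrite TC; ring.
Qed.

Lemma contract2 b c (T : 'I_n -> 'I_n -> R) : (forall j l, T j l = T l j) ->
  \sum_j (\sum_l b l * T j l) * c j = \sum_j (\sum_l c l * T j l) * b j.
Proof.
move=> TC; under eq_bigr do rewrite mulr_suml.
rewrite exchange_big /=; apply: eq_bigr => l _; rewrite mulr_suml.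
by apply: eq_bigr => j _; rewrite TC; ring.
Qed.

End FiniteSums.

Section DirectionalDerivative.
Context {R : realType} {n : nat}.
Variables (U : set 'rV[R]_n) (x : 'rV[R]_n).
Hypotheses (oU : open U) (Ux : U x).
Implicit Types (Z : 'I_n -> R) (a b : 'rV[R]_n -> R).

(** The direction is a fixed vector, in practice the value at [x] of a field; [dd x Z] is thus a
    derivation, and the variation of the field itself never enters. *)
Definition dd Z a := \sum_l Z l * partial l a x.

Lemma ddD Z a b : C1_on U a -> C1_on U b -> dd Z (fun y => a y + b y) = dd Z a + dd Z b.
Proof.
move=> ca cb; rewrite /dd -big_split /=; apply: eq_bigr => l _.
by rewrite (C1_partialD l ca cb Ux) mulrDr.
Qed.

Lemma ddB Z a b : C1_on U a -> C1_on U b -> dd Z (fun y => a y - b y) = dd Z a - dd Z b.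
Proof.
move=> ca cb; rewrite /dd -sumrB; apply: eq_bigr => l _.
by rewrite (C1_partialB l ca cb Ux) mulrBr.
Qed.

Lemma ddM Z a b : C1_on U a -> C1_on U b ->
  dd Z (fun y => a y * b y) = dd Z a * b x + a x * dd Z b.
Proof.
move=> ca cb; rewrite /dd mulr_suml mulr_sumr -big_split /=; apply: eq_bigr => l _.
rewrite (C1_partialM l ca cb Ux).
by move: (partial l a x) (partial l b x) => s t; ring.
Qed.

Lemma ddZ Z a (c : R) : C1_on U a -> dd Z (fun y => c * a y) = c * dd Z a.
Proof.
move=> ca; rewrite /dd mulr_sumr; apply: eq_bigr => l _.
by rewrite (C1_partialZ l c ca Ux) mulrCA.
Qed.

Lemma dd_dot Z (a b : 'I_n -> 'rV[R]_n -> R) :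
  (forall i, C1_on U (a i)) -> (forall i, C1_on U (b i)) ->
  dd Z (fun y => \sum_i a i y * b i y) =
  \sum_i dd Z (a i) * b i x + \sum_i a i x * dd Z (b i).
Proof.
move=> ca cb; rewrite -big_split /=.
rewrite -(eq_bigr _ (fun i _ => ddM Z (ca i) (cb i))) /dd exchange_big /=.
apply: eq_bigr => l _; rewrite -mulr_sumr; congr (_ * _).
exact (C1_partial_sum _ l oU (fun i => C1_onM oU (ca i) (cb i)) Ux).
Qed.

Definition dv (Z : 'I_n -> 'rV[R]_n -> R) := \sum_l partial l (Z l) x.

Lemma dvM a (Z : 'I_n -> 'rV[R]_n -> R) : C1_on U a -> (forall i, C1_on U (Z i)) ->
  dv (fun l y => a y * Z l y) = dd (fun l => Z l x) a + a x * dv Z.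
Proof.
move=> ca cZ; rewrite /dv /dd mulr_sumr -big_split /=; apply: eq_bigr => l _.
by rewrite (C1_partialM l ca (cZ l) Ux) [X in X + _]mulrC.
Qed.

Lemma dvD (Z1 Z2 : 'I_n -> 'rV[R]_n -> R) :
  (forall i, C1_on U (Z1 i)) -> (forall i, C1_on U (Z2 i)) ->
  dv (fun l y => Z1 l y + Z2 l y) = dv Z1 + dv Z2.
Proof.
move=> c1 c2; rewrite /dv -big_split /=; apply: eq_bigr => l _.
exact (C1_partialD l (c1 l) (c2 l) Ux).
Qed.

End DirectionalDerivative.

(** * The second variation as a quadratic form plus a divergence *)

Section SecondVariationIdentity.
Context {R : realType} {n : nat}.
Variables (U : set 'rV[R]_n) (v : 'rV[R]_n -> R) (alpha : R) (F : 'I_n -> 'rV[R]_n -> R).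
Hypothesis oU : open U.
Hypothesis v_gt0 : forall x, U x -> 0 < v x.
Hypothesis sv : smooth_on U v.
Hypothesis sF : forall i, smooth_on U (F i).
Hypothesis pde_v : forall x, U x -> v x * lap v x = alpha / 2 * (1 - gsq v x).

Local Notation g i := (partial i v).
Local Notation H i j := (partial j (partial i v)).
Local Notation D i j := (partial j (F i)).
Local Notation f := (fun x => v x `^ alpha).
Local Notation f1 := (fun x => v x `^ (alpha - 1)).
Local Notation G2 := (gsq v).

(** With D the Jacobian of [F], H the Hessian of [v] and g its gradient, [dF], [HF], [Dg], [Hg] are
    matrix-vector products; [kk], [cc], [mm] are the products of g with [Dg], [dF], [HF]; [qq] is F
    . HF, [w2] is |D^T g|^2 and [zz] is g . D^2 g. The normal component [gF] becomes the argument of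
    the quadratic form. *)
Definition divF x := \sum_i D i i x.
Definition trD2 x := \sum_i \sum_j D i j x * D j i x.
Definition gF x := \sum_i g i x * F i x.
Definition dF i x := \sum_j D i j x * F j x.
Definition HF i x := \sum_j H i j x * F j x.
Definition Dg i x := \sum_j D i j x * g j x.
Definition Hg i x := \sum_j H i j x * g j x.
Definition kk x := \sum_i g i x * Dg i x.
Definition cc x := \sum_i g i x * dF i x.
Definition mm x := \sum_i g i x * HF i x.
Definition qq x := \sum_i F i x * HF i x.
Definition w2 x := \sum_j (\sum_i D i j x * g i x) ^+ 2.
Definition zz x := \sum_i g i x * (\sum_j D i j x * Dg j x).

Definition second_density x :=
  f x * ((G2 x + 1) * ((divF x ^+ 2 - trD2 x) / 2) + w2 x + 2 * zz x - 2 * (kk x * divF x)).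

Definition Q_density (phi : 'rV[R]_n -> R) x :=
  f x * (\sum_j partial j phi x ^+ 2) -
  alpha / 2 * (f x * ((1 - G2 x) / v x ^+ 2) * phi x ^+ 2).

(* Yfield is the field produced by integrating the second variation by parts down to
   Q_density gF. *)
Definition EE x := alpha * (f1 x * (gF x * (G2 x + 1))) + 2 * (f x * mm x).
Definition AA x := f x * (G2 x + 1).
(** (div F)^2 - tr (D^2) is the divergence of (div F) F - D F. The [AA] terms of [a1] and [a2] move
    this divergence onto [AA], whose derivative along [F] is [EE]; the term - EE / 2 is a second
    integration by parts. The [kk] and [cc] terms come from the mixed terms of the second variation.
    In [a3], [qq] removes the third derivatives of [v], and the [gF] square yields the potential by
    way of the equation. *)
Definition a1 x := 2^-1 * (AA x * divF x) - 2 * (f x * kk x) - 2^-1 * EE x.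
Definition a2 x := - 2^-1 * AA x.
Definition a3 x := 2 * (f x * cc x) + alpha * (f1 x * (gF x * gF x)) + f x * qq x.
Definition Yfield j x := a1 x * F j x + a2 x * dF j x + a3 x * g j x.

Let sg i : smooth_on U (g i) := smooth_g sv i.
Let sH i j : smooth_on U (H i j) := smooth_H sv i j.
Let sD i j : smooth_on U (D i j). Proof. exact: (smooth_on_partial j (sF i)). Qed.
Let sf a : smooth_on U (fun x => v x `^ a) := smooth_pow oU v_gt0 sv a.
Let sdot (a b : 'I_n -> 'rV[R]_n -> R) : (forall i, smooth_on U (a i)) ->
  (forall i, smooth_on U (b i)) -> smooth_on U (fun y => \sum_i a i y * b i y).
Proof. by move=> sa sb; exact (smooth_on_sum _ oU (fun i => smooth_onM oU (sa i) (sb i))). Qed.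
Let sdF i : smooth_on U (dF i). Proof. exact: (sdot (sD i) sF). Qed.
Let sHF i : smooth_on U (HF i). Proof. exact: (sdot (sH i) sF). Qed.
Let sDg i : smooth_on U (Dg i). Proof. exact: (sdot (sD i) sg). Qed.
Let sgF : smooth_on U gF. Proof. exact: (sdot sg sF). Qed.
Let skk : smooth_on U kk. Proof. exact: (sdot sg sDg). Qed.
Let scc : smooth_on U cc. Proof. exact: (sdot sg sdF). Qed.
Let smm : smooth_on U mm. Proof. exact: (sdot sg sHF). Qed.
Let sqq : smooth_on U qq. Proof. exact: (sdot sF sHF). Qed.
Let sdivF : smooth_on U divF. Proof. exact (smooth_on_sum _ oU (fun i => sD i i)). Qed.
Let sG2 : smooth_on U G2 := smooth_gsq oU sv.
Let sG21 : smooth_on U (fun x => G2 x + 1).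
Proof. exact: (smooth_onD oU sG2 (smooth_on_cst (U:=U) 1)). Qed.
Let scst (c : R) : smooth_on U (fun=> c). Proof. exact: smooth_on_cst. Qed.
Let sAA : smooth_on U AA. Proof. exact: (smooth_onM oU (sf alpha) sG21). Qed.
Let sE1 : smooth_on U (fun x => f1 x * (gF x * (G2 x + 1))).
Proof. exact: (smooth_onM oU (sf _) (smooth_onM oU sgF sG21)). Qed.
Let sfm : smooth_on U (fun x => f x * mm x). Proof. exact: (smooth_onM oU (sf _) smm). Qed.
Let sEE : smooth_on U EE.
Proof.
exact: (smooth_onD oU (smooth_onM oU (scst alpha) sE1) (smooth_onM oU (scst 2) sfm)).
Qed.
Let sAp : smooth_on U (fun x => AA x * divF x). Proof. exact: (smooth_onM oU sAA sdivF). Qed.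
Let sfk : smooth_on U (fun x => f x * kk x). Proof. exact: (smooth_onM oU (sf _) skk). Qed.
Let sa1 : smooth_on U a1.
Proof.
apply: (smooth_onB oU); last exact: (smooth_onM oU (scst _) sEE).
exact: (smooth_onB oU (smooth_onM oU (scst _) sAp) (smooth_onM oU (scst _) sfk)).
Qed.
Let sa2 : smooth_on U a2. Proof. exact: (smooth_onM oU (scst _) sAA). Qed.
Let sfc : smooth_on U (fun x => f x * cc x). Proof. exact: (smooth_onM oU (sf _) scc). Qed.
Let sfq : smooth_on U (fun x => f x * qq x). Proof. exact: (smooth_onM oU (sf _) sqq). Qed.
Let sff : smooth_on U (fun x => f1 x * (gF x * gF x)).
Proof. exact: (smooth_onM oU (sf _) (smooth_onM oU sgF sgF)). Qed.
Let sa3 : smooth_on U a3.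
Proof.
apply: (smooth_onD oU); last exact: sfq.
exact: (smooth_onD oU (smooth_onM oU (scst _) sfc) (smooth_onM oU (scst _) sff)).
Qed.

Lemma smooth_gF : smooth_on U gF. Proof. exact: sgF. Qed.

Lemma smooth_Yfield j : smooth_on U (Yfield j).
Proof.
apply: (smooth_onD oU); last exact: (smooth_onM oU sa3 (sg j)).
exact: (smooth_onD oU (smooth_onM oU sa1 (sF j)) (smooth_onM oU sa2 (sdF j))).
Qed.

Section AtPoint.
Variable x : 'rV[R]_n.
Hypothesis Ux : U x.
Local Notation Fx := (fun i => F i x).
Local Notation gx := (fun i => g i x).
Let C1 (a : 'rV[R]_n -> R) (sa : smooth_on U a) : C1_on U a := smooth_on_C1 sa.

Let HCy i j y : U y -> H i j y = H j i y.
Proof. by move=> Uy; exact: (smooth_partialC i j oU sv Uy). Qed.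
Let HCx i j : H i j x = H j i x. Proof. exact: HCy. Qed.

Let ddFg i : dd x Fx (g i) = HF i x.
Proof. by rewrite /dd; apply: eq_bigr => l _; rewrite mulrC. Qed.
Let ddFF i : dd x Fx (F i) = dF i x.
Proof. by rewrite /dd; apply: eq_bigr => l _; rewrite mulrC. Qed.
Let ddgg i : dd x gx (g i) = Hg i x.
Proof. by rewrite /dd; apply: eq_bigr => l _; rewrite mulrC. Qed.
Let ddgF i : dd x gx (F i) = Dg i x.
Proof. by rewrite /dd; apply: eq_bigr => l _; rewrite mulrC. Qed.

Definition rr := \sum_i HF i x * Dg i x.
Definition ss := \sum_i g i x * (\sum_j D i j x * HF j x).
Definition hh := \sum_i HF i x * HF i x.
Definition bb := \sum_i Hg i x * dF i x.
(** [sigma] holds the second derivatives of [F] other than those of [divF], [tau] the third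
    derivatives of [v]. Neither may survive: each enters the divergence of [Yfield] twice, with
    opposite signs, once through [a1] and once through [a3]. *)
Definition sigma := \sum_i g i x * (\sum_j dd x Fx (D i j) * g j x).
Definition tau := \sum_i g i x * (\sum_j dd x Fx (H i j) * F j x).

Lemma ddF_gF : dd x Fx gF = qq x + cc x.
Proof.
rewrite /gF (dd_dot oU Ux _ (fun i => C1 (sg i)) (fun i => C1 (sF i))); congr (_ + _).
  by apply: eq_bigr => i _; rewrite ddFg mulrC.
by apply: eq_bigr => i _; rewrite ddFF.
Qed.

Lemma ddg_gF : dd x gx gF = mm x + kk x.
Proof.
rewrite /gF (dd_dot oU Ux _ (fun i => C1 (sg i)) (fun i => C1 (sF i))); congr (_ + _).
  rewrite /mm (dot_mulmx_sym (fun i => g i x) (fun i => F i x) HCx).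
  by apply: eq_bigr => i _; rewrite ddgg.
by apply: eq_bigr => i _; rewrite ddgF.
Qed.

Lemma ddF_kk : dd x Fx kk = rr + (sigma + ss).
Proof.
rewrite /kk (dd_dot oU Ux _ (fun i => C1 (sg i)) (fun i => C1 (sDg i))); congr (_ + _).
  by apply: eq_bigr => i _; rewrite ddFg.
rewrite /sigma /ss -big_split /=; apply: eq_bigr => i _; rewrite -mulrDr; congr (_ * _).
rewrite /Dg (dd_dot oU Ux _ (fun j => C1 (sD i j)) (fun i => C1 (sg i))); congr (_ + _).
by apply: eq_bigr => j _; rewrite ddFg.
Qed.

Lemma ddg_cc : dd x gx cc = bb + (sigma + zz x).
Proof.
rewrite /cc (dd_dot oU Ux _ (fun i => C1 (sg i)) (fun i => C1 (sdF i))); congr (_ + _).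
  by apply: eq_bigr => i _; rewrite ddgg.
rewrite /sigma /zz -big_split /=; apply: eq_bigr => i _; rewrite -mulrDr; congr (_ * _).
rewrite /dF (dd_dot oU Ux _ (fun j => C1 (sD i j)) (fun i => C1 (sF i))); congr (_ + _).
  have TC j l : partial l (D i j) x = partial j (D i l) x.
    exact: (smooth_partialC _ _ oU (sF i) Ux).
  by rewrite /dd; exact: (contract2 gx Fx TC).
by apply: eq_bigr => j _; rewrite ddgF.
Qed.

Lemma ddF_mm : dd x Fx mm = hh + (tau + bb).
Proof.
rewrite /mm (dd_dot oU Ux _ (fun i => C1 (sg i)) (fun i => C1 (sHF i))); congr (_ + _).
  by apply: eq_bigr => i _; rewrite ddFg.
rewrite /tau /bb /Hg.
rewrite -(dot_mulmx_sym (fun i => g i x) (fun i => dF i x) HCx).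
rewrite -big_split /=; apply: eq_bigr => i _; rewrite -mulrDr; congr (_ * _).
rewrite /HF (dd_dot oU Ux _ (fun j => C1 (sH i j)) (fun i => C1 (sF i))); congr (_ + _).
by apply: eq_bigr => j _; rewrite ddFF.
Qed.

Let H3 i j l : partial l (H i j) x = partial i (H l j) x.
Proof.
have E1 : partial l (H i j) x = partial l (H j i) x.
  by apply: partial_near; apply: (open_near_eq oU Ux) => z Uz; exact: HCy.
have E2 : partial i (H j l) x = partial i (H l j) x.
  by apply: partial_near; apply: (open_near_eq oU Ux) => z Uz; exact: HCy.
apply: etrans E1 _; apply: etrans E2.
exact: (smooth_partialC _ _ oU (sg j) Ux).
Qed.

(** By symmetry of the third derivatives, F . (D_g H) F equals g . (D_F H) F. Hence the derivative
    of [qq] along grad v contains the same [tau] as the derivative of [mm] along [F]. *)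
Lemma ddg_qq : dd x gx qq = 2 * rr + tau.
Proof.
rewrite /qq (dd_dot oU Ux _ (fun i => C1 (sF i)) (fun i => C1 (sHF i))).
have -> : \sum_i dd x gx (F i) * HF i x = rr.
  by apply: eq_bigr => i _; rewrite ddgF mulrC.
have -> : \sum_i F i x * dd x gx (HF i) = tau + rr; last by ring.
rewrite /tau /rr /HF.
rewrite -(dot_mulmx_sym (fun i => F i x) (fun i => Dg i x) HCx).
rewrite (contract3 gx Fx Fx H3).
rewrite -big_split /=; apply: eq_bigr => i _; rewrite -mulrDr; congr (_ * _).
rewrite (dd_dot oU Ux _ (fun j => C1 (sH i j)) (fun i => C1 (sF i))); congr (_ + _).
by apply: eq_bigr => j _; rewrite ddgF.
Qed.

Lemma dd_pow Z a : dd x Z (fun y => v y `^ a) = a * v x `^ (a - 1) * \sum_l g l x * Z l.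
Proof.
rewrite /dd mulr_sumr; apply: eq_bigr => l _; rewrite (partial_pow oU v_gt0 sv a l Ux).
by move: (g l x) (v x `^ _) => s t; ring.
Qed.

Lemma dd_G21 Z : dd x Z (fun y => G2 y + 1) = 2 * \sum_i Hg i x * Z i.
Proof.
rewrite (ddD Ux Z (C1 sG2) (@C1_on_cst _ _ U 1)) [X in _ + X]/dd [X in _ + X]big1 ?addr0; last first.
  by move=> l _; rewrite partial_cst mulr0.
rewrite /dd mulr_sumr; apply: eq_bigr => l _; rewrite (partial_gsq oU sv l Ux) mulrCA.
congr (_ * _); rewrite mulrC; congr (_ * _); apply: eq_bigr => j _.
by rewrite HCx mulrC.
Qed.

Lemma dvdF : dv x dF = dd x Fx divF + trD2 x.
Proof.
rewrite /dv /dd /trD2.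
have -> : \sum_l F l x * partial l divF x = \sum_i \sum_j partial j (D i i) x * F j x.
  rewrite exchange_big /=; apply: eq_bigr => l _.
  rewrite /divF (C1_partial_sum _ l oU (fun i => C1 (sD i i)) Ux) mulr_sumr.
  by apply: eq_bigr => i _; rewrite mulrC.
rewrite -big_split /=; apply: eq_bigr => i _; rewrite -big_split /=.
rewrite /dF (C1_partial_sum _ i oU (fun j => C1_onM oU (C1 (sD i j)) (C1 (sF j))) Ux).
apply: eq_bigr => j _; rewrite (C1_partialM i (C1 (sD i j)) (C1 (sF j)) Ux).
by rewrite (smooth_partialC j i oU (sF i) Ux).
Qed.

Lemma grad_gF_sq : \sum_j partial j gF x ^+ 2 = hh + 2 * ss + w2 x.
Proof.
have E j : partial j gF x = HF j x + \sum_i D i j x * g i x.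
  rewrite /gF (C1_partial_sum _ j oU (fun i => C1_onM oU (C1 (sg i)) (C1 (sF i))) Ux).
  rewrite -big_split /=; apply: eq_bigr => i _.
  by rewrite (C1_partialM j (C1 (sg i)) (C1 (sF i)) Ux) HCx [_ * D i j x]mulrC.
rewrite (eq_bigr _ (fun j _ => congr1 (fun t => t ^+ 2) (E j))).
have -> : ss = \sum_j HF j x * \sum_i D i j x * g i x.
  rewrite /ss; under eq_bigr do rewrite mulr_sumr.
  rewrite exchange_big /=; apply: eq_bigr => j _; rewrite mulr_sumr; apply: eq_bigr => i _.
  by move: (D i j x) (g i x) (HF j x) => s t w; ring.
rewrite /hh /w2 mulr_sumr -!big_split /=; apply: eq_bigr => j _.
by move: (HF j x) (\sum_i _) => s t; ring.
Qed.

Lemma dd_AA Z : dd x Z AA = alpha * f1 x * (\sum_l g l x * Z l) * (G2 x + 1) +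
   f x * (2 * \sum_i Hg i x * Z i).
Proof. by rewrite (ddM Ux Z (C1 (sf alpha)) (C1 sG21)) dd_pow dd_G21. Qed.

Lemma Hg_dot_F : \sum_i Hg i x * F i x = mm x.
Proof. by rewrite /mm /HF (dot_mulmx_sym (fun i => g i x) (fun i => F i x) HCx). Qed.

Lemma dd_EE : dd x Fx EE =
  alpha * ((alpha - 1) * v x `^ (alpha - 1 - 1) * gF x * (gF x * (G2 x + 1)) +
    f1 x * ((qq x + cc x) * (G2 x + 1) + gF x * (2 * mm x))) +
  2 * (alpha * f1 x * gF x * mm x + f x * (hh + (tau + bb))).
Proof.
rewrite (ddD Ux Fx (C1 (smooth_onM oU (scst alpha) sE1)) (C1 (smooth_onM oU (scst 2) sfm))).
rewrite (ddZ Ux Fx alpha (C1 sE1)) (ddZ Ux Fx 2 (C1 sfm)).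
rewrite (ddM Ux Fx (C1 (sf _)) (C1 (smooth_onM oU sgF sG21))) (ddM Ux Fx (C1 sgF) (C1 sG21)).
by rewrite (ddM Ux Fx (C1 (sf _)) (C1 smm)) !dd_pow dd_G21 ddF_gF ddF_mm Hg_dot_F.
Qed.

Lemma dd_a1 : dd x Fx a1 =
  2^-1 * ((alpha * f1 x * gF x * (G2 x + 1) + f x * (2 * mm x)) * divF x +
     AA x * dd x Fx divF) -
  2 * (alpha * f1 x * gF x * kk x + f x * (rr + (sigma + ss))) - 2^-1 * dd x Fx EE.
Proof.
rewrite (ddB Ux Fx (C1 (smooth_onB oU (smooth_onM oU (scst _) sAp) (smooth_onM oU (scst _) sfk)))
  (C1 (smooth_onM oU (scst _) sEE))).
rewrite (ddB Ux Fx (C1 (smooth_onM oU (scst _) sAp)) (C1 (smooth_onM oU (scst _) sfk))).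
rewrite (ddZ Ux Fx _ (C1 sAp)) (ddZ Ux Fx _ (C1 sfk)) (ddZ Ux Fx _ (C1 sEE)).
rewrite (ddM Ux Fx (C1 sAA) (C1 sdivF)) (ddM Ux Fx (C1 (sf _)) (C1 skk)).
by rewrite dd_AA dd_pow ddF_kk Hg_dot_F.
Qed.

Lemma dd_a2 : dd x (fun i => dF i x) a2 =
  - 2^-1 * (alpha * f1 x * cc x * (G2 x + 1) + f x * (2 * bb)).
Proof. by rewrite (ddZ Ux _ _ (C1 sAA)) dd_AA. Qed.

Lemma dd_a3 : dd x gx a3 =
  2 * (alpha * f1 x * G2 x * cc x + f x * (bb + (sigma + zz x))) +
  alpha * ((alpha - 1) * v x `^ (alpha - 1 - 1) * G2 x * (gF x * gF x) +
     f1 x * ((mm x + kk x) * gF x + gF x * (mm x + kk x))) +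
  (alpha * f1 x * G2 x * qq x + f x * (2 * rr + tau)).
Proof.
have EG : \sum_l g l x * g l x = G2 x by [].
rewrite (ddD Ux gx 
  (C1 (smooth_onD oU (smooth_onM oU (scst _) sfc) (smooth_onM oU (scst _) sff))) (C1 sfq)).
rewrite (ddD Ux gx (C1 (smooth_onM oU (scst _) sfc)) (C1 (smooth_onM oU (scst _) sff))).
rewrite (ddZ Ux gx _ (C1 sfc)) (ddZ Ux gx _ (C1 sff)).
rewrite (ddM Ux gx (C1 (sf _)) (C1 scc)) (ddM Ux gx (C1 (sf _)) (C1 sqq)).
rewrite (ddM Ux gx (C1 (sf _)) (C1 (smooth_onM oU sgF sgF))) (ddM Ux gx (C1 sgF) (C1 sgF)).
by rewrite !dd_pow ddg_gF ddg_cc ddg_qq EG.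
Qed.

Lemma dv_Yfield : dv x Yfield =
  dd x Fx a1 + a1 x * divF x +
  (dd x (fun i => dF i x) a2 + a2 x * (dd x Fx divF + trD2 x)) +
  (dd x gx a3 + a3 x * lap v x).
Proof.
have c1 i : C1_on U (fun y => a1 y * F i y) := C1_onM oU (C1 sa1) (C1 (sF i)).
have c2 i : C1_on U (fun y => a2 y * dF i y) := C1_onM oU (C1 sa2) (C1 (sdF i)).
have c3 i : C1_on U (fun y => a3 y * g i y) := C1_onM oU (C1 sa3) (C1 (sg i)).
rewrite (dvD Ux (fun i => C1_onD oU (c1 i) (c2 i)) c3) (dvD Ux c1 c2).
rewrite (dvM Ux (C1 sa1) (fun i => C1 (sF i))) (dvM Ux (C1 sa2) (fun i => C1 (sdF i))).
by rewrite (dvM Ux (C1 sa3) (fun i => C1 (sg i))) dvdF.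
Qed.

(** Once every derivative of [Yfield] is expanded, the remaining scalars can be treated as
    independent. What is left is an identity of rational functions, provided that Delta v is
    eliminated by the equation and all powers of v are expressed by v^(alpha-2). *)
Lemma second_variation_identity :
  second_density x = Q_density gF x + dv x Yfield.
Proof.
rewrite dv_Yfield dd_a1 dd_a2 dd_a3 dd_EE /Q_density grad_gF_sq /second_density.
rewrite /a1 /a2 /a3 /AA /EE.
have v0 := v_gt0 Ux; have vn0 : v x != 0 by rewrite gt_eqF.
have lapE : lap v x = alpha / 2 * (1 - G2 x) / v x by rewrite -pde_v// mulrAC divff// mul1r.
rewrite lapE (powR_pred alpha v0) (powR_pred (alpha - 1) v0).
move: (gF x) (G2 x) (divF x) (trD2 x) (mm x) (kk x) (cc x) (qq x) (zz x) (w2 x) rr ss hh bb sigma tau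
  (v x `^ (alpha - 1 - 1)) (dd x Fx divF) (v x) vn0
  => gF_ G2_ p t m k c q z w r s h b sg_ ta P dp v_ vn0.
by field.
Qed.

(** The terms of order v^(alpha-1) in [a1] and [a3] add up to (alpha/2) v^(alpha-1) (|grad v|^2 - 1)
    gF^2, which is - v^alpha (Delta v) gF^2 by the equation. The flux is thus v^alpha times a factor
    that is bounded near the free boundary. *)
Lemma flux_identity : \sum_j g j x * Yfield j x = f x *
  (2^-1 * (G2 x + 1) * (divF x * gF x - cc x) - 2 * kk x * gF x + 2 * cc x * G2 x
   - mm x * gF x - lap v x * gF x ^+ 2 + qq x * G2 x).
Proof.
have -> : \sum_j g j x * Yfield j x = a1 x * gF x + a2 x * cc x + a3 x * G2 x.
  rewrite /gF /cc /G2 !mulr_sumr -!big_split /=; apply: eq_bigr => j _; rewrite /Yfield.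
  by move: (a1 x) (a2 x) (a3 x) (g j x) (F j x) (dF j x) => s1 s2 s3 s4 s5 s6; ring.
have v0 := v_gt0 Ux; have vn0 : v x != 0 by rewrite gt_eqF.
have lapE : lap v x = alpha / 2 * (1 - G2 x) / v x by rewrite -pde_v// mulrAC divff// mul1r.
rewrite /a1 /a2 /a3 /AA /EE lapE (powR_pred alpha v0).
move: (gF x) (G2 x) (divF x) (mm x) (kk x) (cc x) (qq x)
  (v x `^ (alpha - 1)) (v x) vn0 => gF_ G2_ p m k c q P v_ vn0.
by field.
Qed.

End AtPoint.

End SecondVariationIdentity.

Lemma continuous_at_dist (R : realType) (T : topologicalType) (f : T -> R) (x : T) :
  (forall e, 0 < e -> nbhs x [set y | `|f x - f y| < e]) -> {for x, continuous f}.
Proof. by move=> H; apply/cvgrPdist_lt => e e0; exact: H. Qed.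

(** * Behaviour at the free boundary *)

Section FreeBoundary.
Context {R : realType} {n : nat}.
Variables (Omega : set 'rV[R]_n) (v : 'rV[R]_n -> R) (alpha : R).
Local Notation U := (positivity_set Omega v).
Local Notation g i := (partial i v).
Hypothesis oO : open Omega.
Hypothesis v_ge0 : forall x, Omega x -> 0 <= v x.
Hypothesis v_smooth : smooth_up_to_boundary U Omega v.
Hypothesis alpha_gt0 : 0 < alpha.
Hypothesis gsq_gt0 : forall x, U x -> 0 < gsq v x.
Hypothesis pde_v : forall x, U x -> v x * lap v x = alpha / 2 * (1 - gsq v x).

Let oU : open U. Proof. by case: v_smooth. Qed.
Let sv : smooth_on U v. Proof. by case: v_smooth. Qed.
Let W := closure U `&` Omega.
Let UW : U `<=` W.
Proof. by move=> x Ux; split; [exact: subset_closure|case: Ux]. Qed.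

Lemma v_eq0 x : Omega x -> ~ U x -> v x = 0.
Proof.
move=> Ox nU; apply/eqP; rewrite eq_le v_ge0// andbT leNgt; apply/negP => v0.
exact: nU.
Qed.

Lemma partial_extension s : exists G : 'rV[R]_n -> R,
  {within W, continuous G} /\ forall x, U x -> G x = iter_partial s v x.
Proof. by case: v_smooth => _ _ _ /(_ s). Qed.

Lemma bounded_partials s K : compact K -> K `<=` Omega ->
  exists2 B : R, 0 <= B & forall x, U x -> K x -> `|iter_partial s v x| <= B.
Proof.
move=> cK KO; have [G [cG GE]] := partial_extension s.
have cWK : compact (K `&` closure U).
  by apply: compact_closedI => //; exact: closed_closure.
have sub : K `&` closure U `<=` W by move=> x [/KO Ox cx].
have [B B0 HB] := bounded_on_compact cWK (continuous_subspaceW sub cG).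
exists B => // x Ux Kx; rewrite -GE//; apply: HB; split=> //; exact: subset_closure.
Qed.

(** Smoothness covers the positivity set, and off its closure [v] is locally 0. On the free boundary
    [v] is 0, so nearby points outside the set cause no error, and continuity within the closure
    handles the others. *)
Lemma v_continuous : cont_on Omega v.
Proof.
move=> x Ox; have [Ux|nUx] := pselect (U x); first exact: (C1_on_continuous (smooth_on_C1 sv) Ux).
have vx := v_eq0 Ox nUx.
have nO : nbhs x Omega by exact: open_nbhs_nbhs.
have [cx|ncx] := pselect (closure U x); last first.
  have oC : open (~` closure U) by exact/closed_openC/closed_closure.
  apply: (@near_eq_continuous _ _ (fun=> 0)); last exact: cst_continuous.
  have nC : nbhs x (~` closure U) by exact: open_nbhs_nbhs.
  apply: filterS2 nO nC => y Oy ncy /=; rewrite v_eq0// => Uy.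
  by apply: ncy; exact: subset_closure.
have cv : {within W, continuous v} by case: v_smooth.
have /subspace_continuousP/(_ x (conj cx Ox)) cvx := cv.
apply: continuous_at_dist => e e0; have /cvgrPdist_lt/(_ e e0) := cvx.
rewrite /= near_withinE => cvH.
have {}cvH : nbhs x [set y | W y -> `|v x - v y| < e] by exact: cvH.
apply: filterS2 cvH nO => y Hy Oy /=.
have [Uy|nUy] := pselect (U y); first exact/Hy/UW.
by rewrite (@v_eq0 y)// vx subrr normr0.
Qed.

Lemma extension_eq0 (E : 'rV[R]_n -> R) : {within W, continuous E} ->
  (forall x, U x -> E x = 0) -> forall x, W x -> E x = 0.
Proof.
move=> cE E0 x Wx; apply: contrapT => /eqP Ex.
have /subspace_continuousP/(_ x Wx) cEx := cE.
have Ex0 : 0 < `|E x| by rewrite normr_gt0.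
have /cvgrPdist_lt/(_ _ Ex0) := cEx; rewrite near_withinE => H0.
have H : nbhs x [set y | W y -> `|E x - E y| < `|E x|] by exact: H0.
have [cx _] := Wx; have [y [Uy Hy]] := cx _ H.
by have := Hy (UW Uy); rewrite /= (E0 y Uy) subr0 ltxx.
Qed.

(** At a zero of [v] the value of [partial i v] is 0, as at any minimum; it is not the limit of the
    gradient from inside, so the limits need functions [G] of their own. Where v = 0 the extended
    equation leaves 1 - |G|^2 = 0, because the extension of Delta v is finite there. *)
Lemma gradient_extension : exists G : 'I_n -> 'rV[R]_n -> R,
  [/\ forall i, {within W, continuous (G i)},
      forall i x, U x -> G i x = g i x,
      {within W, continuous (fun x => \sum_i G i x ^+ 2)},
      forall x, W x -> ~ U x -> \sum_i G i x ^+ 2 = 1 &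
      forall x, W x -> 0 < \sum_i G i x ^+ 2].
Proof.
have /choice[G GP] := fun i => partial_extension [:: i].
have /choice[L LP] := fun i => partial_extension [:: i; i].
have cG i : {within W, continuous (G i)} by have [] := GP i.
have cL i : {within W, continuous (L i)} by have [] := LP i.
have cv : {within W, continuous v} by case: v_smooth.
have GE i x : U x -> G i x = g i x by have [_] := GP i; exact.
have cS : {within W, continuous (fun x => \sum_i G i x ^+ 2)}.
  move=> x; apply: (@continuous_at_sum _ (subspace W)) => i.
  by apply: (@continuous_atM _ (subspace W)); exact: cG.
have GG y : U y -> \sum_i G i y ^+ 2 = gsq v y.
  by move=> Uy; apply: eq_bigr => i _; rewrite (GE i y Uy).
have S1 x : W x -> ~ U x -> \sum_i G i x ^+ 2 = 1.
  move=> Wx nUx.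
  pose E y := v y * (\sum_i L i y) + (alpha / 2 * (\sum_i G i y ^+ 2) + - (alpha / 2)).
  have cE : {within W, continuous E}.
    move=> y; apply: (@continuous_atD _ (subspace W)).
      apply: (@continuous_atM _ (subspace W)); first exact: cv.
      apply: (@continuous_at_sum _ (subspace W)) => i; exact: cL.
    apply: (@continuous_atD _ (subspace W)); last exact: cst_continuous.
    by apply: (@continuous_atM _ (subspace W)); [exact: cst_continuous|exact: cS].
  have E0 y : U y -> E y = 0.
    move=> Uy; rewrite /E (GG y Uy) (_ : \sum_i L i y = lap v y).
      by rewrite pde_v//; ring.
    by apply: eq_bigr => i _; have [_] := LP i; exact.
  have := extension_eq0 cE E0 Wx.
  rewrite /E v_eq0 ?mul0r ?add0r; [|by case: Wx|exact: nUx].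
  move=> /eqP; rewrite -mulrN1 -mulrDr mulf_eq0 gt_eqF ?divr_gt0//= subr_eq0.
  by move/eqP.
exists G; split=> // x Wx; have [Ux|nUx] := pselect (U x); last by rewrite S1.
by rewrite GG//; exact: gsq_gt0.
Qed.

(* The infimum is attained on the closure of U, where the continuous extension of
   |grad v|^2 is positive: it equals 1 on the free boundary, by pde_v. *)
Lemma gsq_lower_bound K : compact K -> K `<=` Omega ->
  exists2 c : R, 0 < c & forall x, U x -> K x -> c <= gsq v x.
Proof.
move=> cK KO; have [G [_ GE cS _ S0]] := gradient_extension.
have cWK : compact (K `&` closure U).
  by apply: compact_closedI => //; exact: closed_closure.
have sub : K `&` closure U `<=` W by move=> x [/KO Ox cx].
have [[y0 Ky0]|K0] := pselect ((K `&` closure U) !=set0); last first.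
  exists 1 => // x Ux Kx; exfalso; apply: K0; exists x; split=> //; exact: subset_closure.
have [y Ky ymin] := EVT_min_rV (ex_intro _ y0 Ky0) cWK (continuous_subspaceW sub cS).
exists (\sum_i G i y ^+ 2); first by apply: S0; apply: sub; rewrite inE in Ky.
move=> x Ux Kx; have : x \in K `&` closure U by rewrite inE; split=> //; exact: subset_closure.
move/ymin => /le_trans; apply; rewrite le_eqVlt; apply/orP; left; apply/eqP.
by apply: eq_bigr => i _; rewrite GE.
Qed.

End FreeBoundary.

(** The derivative is controlled only where [h] is positive, so positivity must be propagated along
    with the bound. At a first zero [r] the mean value theorem on [0, r] would give h r >= h 0 + c r
    > 0. *)
Lemma growth_while_positive (R : realType) (h dh : R -> R) (t c : R) : 0 < c ->
  (forall s, 0 <= s <= t -> {for s, continuous h}) ->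
  (forall s, 0 <= s <= t -> 0 <= h s) -> 0 < h 0 ->
  (forall s, 0 <= s <= t -> 0 < h s -> is_derive s 1 h (dh s) /\ c <= dh s) ->
  forall s, 0 <= s <= t -> h 0 + c * s <= h s.
Proof.
move=> c0 ch h_ge0 h0 dhP.
have grow s : 0 <= s <= t -> (forall r, 0 <= r < s -> 0 < h r) -> h 0 + c * s <= h s.
  move=> /andP[s0 st] hpos; move: s0; rewrite le_eqVlt => /orP[/eqP <-|s0].
    by rewrite mulr0 addr0.
  have [r| |r] := @MVT R h dh 0 s s0.
  - rewrite in_itv/= => /andP[r0 rs]; apply: (dhP r _ _).1.
      by rewrite (ltW r0)/= (le_trans (ltW rs)).
    by apply: hpos; rewrite (ltW r0).
  - apply: continuous_in_subspaceT => r; rewrite inE/= in_itv/= => /andP[r0 rs].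
    by apply: ch; rewrite r0 (le_trans rs).
  - rewrite in_itv/= subr0 => /andP[r0 rs] E.
    rewrite -lerBrDl E ler_wpM2r ?(ltW s0)//; apply: (dhP r _ _).2.
      by rewrite (ltW r0)/= (le_trans (ltW rs)).
    by apply: hpos; rewrite (ltW r0).
suff pos s : 0 <= s <= t -> 0 < h s.
  move=> s st; apply: grow => // r /andP[r0 rs]; apply: pos; rewrite r0 /=.
  by move/andP: st => [_ st]; rewrite (le_trans (ltW rs)).
move=> st; rewrite lt_neqAle h_ge0// andbT eq_sym; apply/eqP => hs0.
pose S := [set r | 0 <= r <= t /\ h r = 0].
have cS : compact S.
  apply: (@subclosed_compact _ _ `[0, t]); [|exact: segment_compact|].
    move=> r Sr; have rt : 0 <= r <= t.
      have : closure `[0, t]%classic r by apply: closure_subset Sr => y [yt _]; rewrite /= in_itv.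
      by rewrite -(closure_id _).1 ?/= ?in_itv//; exact: itv_closed.
    split=> //; apply: contrapT => /eqP hr.
    have hr0 : 0 < h r by rewrite lt_neqAle eq_sym hr h_ge0.
    have N : nbhs r [set y | 0 < h y] by exact: (cvgr_gt (h r) (ch r rt) _ hr0).
    by have [y [[_ hy] /=]] := Sr _ N; rewrite hy ltxx.
  by move=> r [rt _]; rewrite /= in_itv.
(* The zero set of [h] in [0, t] is compact; its least element [r] is the first zero. *)
have [r] := @compact_EVT_min _ _ id S (ex_intro _ s (conj st hs0)) cS
  (continuous_subspaceT (fun x => cvg_id)).
rewrite inE => -[rt hr] rmin.
have := grow r rt; rewrite hr => H.
suff : h 0 + c * r <= 0.
  apply/negP; rewrite -ltNge ltr_pwDl// mulr_ge0 ?(ltW c0)//.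
  by case/andP: rt.
apply: H => y /andP[y0 yr]; have yt : 0 <= y <= t.
  by rewrite y0 (le_trans (ltW yr))//; case/andP: rt.
rewrite lt_neqAle h_ge0// andbT eq_sym; apply/eqP => hy.
have : y \in S by rewrite inE.
by move/rmin; rewrite /= leNgt yr.
Qed.

(** * Translations into the positivity set *)

Section PushInside.
Context {R : realType} {n : nat}.
Variables (Omega : set 'rV[R]_n) (v : 'rV[R]_n -> R) (alpha : R).
Local Notation U := (positivity_set Omega v).
Local Notation g i := (partial i v).
Hypothesis oO : open Omega.
Hypothesis v_ge0 : forall x, Omega x -> 0 <= v x.
Hypothesis v_smooth : smooth_up_to_boundary U Omega v.
Hypothesis alpha_gt0 : 0 < alpha.
Hypothesis gsq_gt0 : forall x, U x -> 0 < gsq v x.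
Hypothesis pde_v : forall x, U x -> v x * lap v x = alpha / 2 * (1 - gsq v x).

Let oU : open U. Proof. by case: v_smooth. Qed.
Let sv : smooth_on U v. Proof. by case: v_smooth. Qed.

(* The choice e = 0 serves the points p off the free boundary. *)
Definition pushes_inside p (r : R) (e : 'rV[R]_n) (c t0 : R) K :=
  [/\ 0 < r, 0 < c, 0 < t0 & compact K] /\ K `<=` Omega /\
  (forall x t, sqdist p x < r ^+ 2 -> 0 <= t < t0 -> K (x + t *: e)) /\
  (forall x t, U x -> sqdist p x < r ^+ 2 -> 0 < t < t0 ->
     U (x + t *: e) /\ c * t <= v (x + t *: e)).

Lemma pushes_inside_static p (r c : R) : 0 < r -> 0 < c -> ccube p r `<=` Omega ->
  (forall x, U x -> ccube p r x -> c <= v x) -> pushes_inside p r 0 c 1 (ccube p r).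
Proof.
move=> r0 c0 rO rc; split; first by split=> //; exact: compact_ccube.
split=> //; split=> [x t xr _|x t Ux xr /andP[t0 t1]]; rewrite scaler0 addr0.
  exact: sqdist_ccube.
split=> //; apply: le_trans (rc x Ux (sqdist_ccube r0 xr)).
by rewrite ger_pMr// ltW.
Qed.

Lemma push_inside p : Omega p -> exists r e c t0 K, pushes_inside p r e c t0 K.
Proof.
move=> Op; have nO : nbhs p Omega by exact: open_nbhs_nbhs.
have [Up|nUp] := pselect (U p).
  have v0 : v p / 2 < v p by have [_ v0] := Up; rewrite gtr_pMr// invf_lt1// ltr1n.
  have nv : nbhs p [set y | v p / 2 < v y].
    by exact: (cvgr_gt (v p) (v_continuous oO v_ge0 v_smooth Op) _ v0).
  have [r r0 rU] := nbhs_ccube (filterI nO nv).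
  exists r, 0, (v p / 2), 1, (ccube p r); apply: pushes_inside_static => //.
  - by rewrite divr_gt0//; have [] := Up.
  - by move=> x /rU[].
  - by move=> x _ /rU[_ /ltW].
have [cp|ncp] := pselect (closure U p); last first.
  have oC : open (~` closure U) by exact/closed_openC/closed_closure.
  have nC : nbhs p (~` closure U) by exact: open_nbhs_nbhs.
  have [r r0 rU] := nbhs_ccube (filterI nO nC).
  exists r, 0, 1, 1, (ccube p r); apply: pushes_inside_static => //.
  - by move=> x /rU[].
  - by move=> x Ux /rU[_ ncx]; exfalso; apply: ncx; exact: subset_closure.
have [G [cG GE _ _ G0]] := gradient_extension v_ge0 v_smooth alpha_gt0 gsq_gt0 pde_v.
have [i Gi] : exists i, G i p != 0.
  apply: contrapT => /forallNP g0; have := G0 p (conj cp Op).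
  rewrite big1 ?ltxx// => i _; have /negP := g0 i; rewrite negbK => /eqP ->.
  by rewrite expr0n.
(* The rate is half of the slope at [p]: the other half absorbs the oscillation of [G i] near
   [p]. *)
pose sg := Num.sg (G i p); pose c := `|G i p| / 2.
have c0 : 0 < c by rewrite divr_gt0// normr_gt0.
have sgE : sg * G i p = `|G i p| by rewrite /sg -normrEsg.
have sg1 : `|sg| = 1 by rewrite normr_sg Gi.
have /subspace_continuousP/(_ p (conj cp Op)) cGp := cG i.
have /cvgrPdist_lt/(_ _ c0) := cGp; rewrite near_withinE => nG.
have {}nG : nbhs p [set y | (closure U `&` Omega) y -> `|G i p - G i y| < c] by exact: nG.
have [r r0 rU] := nbhs_ccube (filterI nO nG).
pose e : 'rV[R]_n := sg *: delta_mx ord0 i.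
have r20 : 0 < r / 2 by rewrite divr_gt0.
(* Starting within r / 2 of [p] and moving by at most r / 2, a point stays in the cube of radius [r]
   on which the slope is controlled. *)
have inK x t : sqdist p x < (r / 2) ^+ 2 -> 0 <= t <= r / 2 -> ccube p r (x + t *: e).
  move=> /(sqdist_ccube r20) xr /andP[t0 tr] j.
  rewrite !mxE addrAC (le_trans (ler_normD _ _))// (splitr r) lerD//.
  rewrite !normrM sg1 mul1r (ger0_norm t0); apply: le_trans tr.
  by rewrite eqxx /=; case: (j == i); rewrite ?normr1 ?normr0 ?mulr1 ?mulr0.
have dsg y : U y -> ccube p r y -> c <= sg * g i y.
  move=> Uy /rU[_ /= H]; rewrite -GE//.
  have {}H : `|G i p - G i y| < c by apply: H; split; [exact: subset_closure|case: Uy].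
  have : sg * (G i p - G i y) < c.
    by rewrite (le_lt_trans (ler_norm _))// normrM sg1 mul1r.
  by rewrite mulrBr sgE /c; lra.
exists (r / 2), e, c, (r / 2), (ccube p r); split.
  by split=> //; exact: compact_ccube.
split; first by move=> x /rU[].
split; first by move=> x t xr /andP[t0 tr]; apply: inK => //; rewrite t0 ltW.
move=> x t Ux xr /andP[t0 tr].
have Ost s : 0 <= s <= t -> Omega (x + s *: e) /\ ccube p r (x + s *: e).
  move=> /andP[s0 st]; have xs : ccube p r (x + s *: e).
    by apply: inK => //; rewrite s0 (le_trans st)// ltW.
  by have [] := rU _ xs.
pose h s := v (x + s *: e).
have h00 : h 0 = v x by rewrite /h scale0r addr0.
have H := @growth_while_positive R h (fun s => sg * g i (x + s *: e)) t c c0.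
have : h 0 + c * t <= h t.
  apply: H; last by rewrite (ltW t0) lexx.
  - move=> s /Ost[Os _]; apply: (@continuous_comp _ _ _ (fun s : R => x + s *: e) v).
      by apply: cvgD; [exact: cvg_cst|apply: cvgZr_tmp; exact: cvg_id].
    exact: (v_continuous oO v_ge0 v_smooth Os).
  - by move=> s /Ost[Os _]; exact: v_ge0.
  - by rewrite h00; case: Ux.
  - move=> s /Ost[Os Ks] hs; have Us : U (x + s *: e) by [].
    split; last exact: dsg.
    have E s' : x + s' *: e = (sg * s') *: delta_mx ord0 i + x.
      by rewrite /e scalerA mulrC addrC.
    have D : is_derive (sg * s) 1 (fun s' => v (s' *: delta_mx ord0 i + x)) (g i (x + s *: e)).
      rewrite E; apply: (is_derive_C1_line (smooth_on_C1 sv)); rewrite -E; exact: Us.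
    have D' : is_derive s (1 : R) (fun s' : R => sg * s') sg.
      by apply: is_derive_eq; rewrite /GRing.scale/= mulr1.
    have := @is_derive1_comp _ (fun s' => v (s' *: delta_mx ord0 i + x)) (fun s' => sg * s') s _ _ D D'.
    rewrite mulrC (_ : _ \o _ = h)//.
    by apply/funext => s'; rewrite /h E.
rewrite h00 => vt; have vx : 0 < v x by case: Ux.
have ct : c * t <= v (x + t *: e) by apply: le_trans vt; rewrite lerDr ltW.
split=> //; split; first by have [] := Ost t; rewrite ?(ltW t0) ?lexx.
by apply: lt_le_trans ct; rewrite mulr_gt0.
Qed.

End PushInside.

Section Cutoffs.
Context {R : realType} {n : nat}.
Implicit Types (K Omega : set 'rV[R]_n).

Lemma bump_cover K (rho : 'rV[R]_n -> R) : compact K -> (forall p, K p -> 0 < rho p) ->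
  exists s : seq 'rV[R]_n, (forall p, p \in s -> K p) /\
    forall x, K x -> exists2 p, p \in s & sqdist p x < rho p ^+ 2.
Proof.
rewrite compact_cover => cK r0.
have [|x Kx|D' D'K KD'] := cK 'rV[R]_n K (fun p => [set x | sqdist p x < rho p ^+ 2]).
- by move=> p _; exact: open_sqdist.
- by exists x => //=; rewrite sqdistxx exprn_gt0// r0.
exists (finmap.enum_fset D'); split=> [p pD'|x /KD'[p /= pD' px]]; last by exists p.
by have := D'K p pD'; rewrite inE.
Qed.

(** Only a lower bound on [K] is asked for, not a plateau, so a finite sum of bumps divided by its
    minimum over [K] will do. *)
Lemma cutoff_exists K Omega : compact K -> K `<=` Omega -> open Omega ->
  exists psi K', [/\ smooth_on setT psi, forall x, 0 <= psi x, forall x, K x -> 1 <= psi x,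
    compact K' & K' `<=` Omega /\ forall x, ~ K' x -> psi x = 0].
Proof.
move=> cK KO oO.
have /choice[rho rhoP] p : exists r : R, K p -> 0 < r /\ ccube p r `<=` Omega.
  have [Kp|nKp] := pselect (K p); last by exists 0.
  have [r r0 rO] := nbhs_ccube (open_nbhs_nbhs (conj oO (KO p Kp))).
  by exists r.
have [s [sK Ks]] := bump_cover cK (fun p Kp => (rhoP p Kp).1).
pose P x := \sum_(p <- s) bump p (rho p) x.
have sP : smooth_on setT P.
  exact (smooth_on_sum s openT (fun p => smooth_on_bump p (rho p))).
have P0 x : 0 <= P x by apply: sumr_ge0 => p _; exact: bump_ge0.
have PK x : K x -> 0 < P x.
  move=> /Ks[p ps px]; rewrite /P (big_rem p)//= ltr_pwDl ?bump_gt0//.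
  by apply: sumr_ge0 => q _; exact: bump_ge0.
pose K' := \big[setU/set0]_(p <- s | p \in s) ccube p (rho p).
have cK' : compact K' by apply: bigsetU_compact => p _; exact: compact_ccube.
have K'E : K' = \bigcup_(p in [set` s]) ccube p (rho p).
  by rewrite bigcup_seq /K' big_seq_cond [RHS]big_seq_cond; apply: eq_bigl => p; rewrite andbT andbb.
have K'O : K' `<=` Omega.
  by rewrite K'E => x [p /= ps]; exact: (rhoP p (sK p ps)).2.
have P0' x : ~ K' x -> P x = 0.
  rewrite K'E => nx; rewrite /P big_seq; apply: big1 => p ps.
  apply/eqP/negPn/negP => /bump_ccube H; apply: nx; exists p => //.
  exact: (H (rhoP p (sK p ps)).1).
have [[x0 Kx0]|K0] := pselect (K !=set0); last first.
  exists (fun=> 0), set0; split=> //; [exact: smooth_on_cst| |exact: compact0|by split].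
  by move=> x Kx; exfalso; apply: K0; exists x.
have cP : {within K, continuous P}.
  by apply: continuous_subspaceT => x; exact: (C1_on_continuous (smooth_on_C1 sP) I).
have [y Ky ymin] := EVT_min_rV (ex_intro _ x0 Kx0) cK cP.
have Py : 0 < P y by apply: PK; rewrite inE in Ky.
exists (fun x => (P y)^-1 * P x), K'; split=> //.
- exact (smooth_onM openT (smooth_on_cst (U:=setT) _) sP).
- by move=> x; rewrite mulr_ge0// invr_ge0 ltW.
- move=> x Kx; rewrite ler_pdivlMl// mulr1; apply: ymin.
  by rewrite inE.
- by split=> // x /P0' ->; rewrite mulr0.
Qed.

End Cutoffs.

(** * Integration by parts up to the free boundary *)

Section VanishingFlux.
Context {R : realType} {n : nat}.
Variables (Omega : set 'rV[R]_n) (v : 'rV[R]_n -> R).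
Local Notation U := (positivity_set Omega v).
Local Notation g i := (partial i v).
Local Notation mu := (lebesgue_rV n : {sigma_finite_measure set 'rV[R]_n -> \bar R}).
Local Notation Int U f := (\int[mu]_(x in U) f x)%R.
Hypothesis oU : open U.
Hypothesis sv : smooth_on U v.
Hypothesis cv : cont_on Omega v.

Definition etak (k : nat) x := step (k.+1%:R * v x).
Definition detak (k : nat) x := k.+1%:R * dstep (k.+1%:R * v x).

Let v_gt0 x : U x -> 0 < v x. Proof. by case. Qed.

Lemma C1_etak k : C1_on U (etak k) /\
  forall j x, U x -> partial j (etak k) x = detak k x * g j x.
Proof.
apply: (@C1_on_comp _ _ U (fun s => step (k.+1%:R * s))
  (fun s => k.+1%:R * dstep (k.+1%:R * s)) v oU (smooth_on_C1 sv)).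
- move=> x _; have D' : is_derive (v x) (1 : R) (fun s : R => k.+1%:R * s) (k.+1%:R).
    by apply: is_derive_eq; rewrite /GRing.scale/= mulr1.
  have := @is_derive1_comp _ step (fun s => k.+1%:R * s) (v x) _ _ (is_derive_step _) D'.
  by rewrite mulrC.
- move=> x _; apply: continuous_atM; first exact: cst_continuous.
  apply: continuous_at_comp; last exact: continuous_dstep.
  by apply: (@continuous_atM _ _ (fun=> k.+1%:R) id); [exact: cst_continuous|exact: cvg_id].
Qed.

(** For [d > 0] this set lies in the positivity set, away from the free boundary. A field cut off
    below level [d] is supported in it, and the divergence theorem applies. *)
Lemma compact_level K (d : R) : compact K -> K `<=` Omega ->
  compact [set x | K x /\ d <= v x].
Proof.
move=> cK KO; apply: (@subclosed_compact _ _ K) => //; last by move=> x [].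
move=> x cx; have Kx : K x.
  have cl : closed K by apply: compact_closed => //; exact: norm_hausdorff.
  by apply: cl; apply: closure_subset cx => y [].
split=> //; rewrite leNgt; apply/negP => vd.
have N : nbhs x [set y | v y < d] by exact: (cvgr_lt (v x) (cv (KO x Kx)) _ vd).
by have [y [[_ yd] /=]] := cx _ N; rewrite ltNge yd.
Qed.

Lemma etak_eq0 k x : v x < k.+1%:R^-1 -> etak k x = 0 /\ detak k x = 0.
Proof.
move=> vk; have H : k.+1%:R * v x <= 1.
  by rewrite mulrC -ler_pdivlMr ?ltr0n// div1r ltW.
by rewrite /etak /detak step_eq0// dstep_eq0 ?H// mulr0.
Qed.

Variables (K : set 'rV[R]_n) (Z : 'I_n -> 'rV[R]_n -> R).
Hypothesis cK : compact K.
Hypothesis KO : K `<=` Omega.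
Hypothesis cZ : forall j, C1_on U (Z j).
Hypothesis Z0 : forall j x, U x -> ~ K x -> Z j x = 0.

Definition divZ x := \sum_j partial j (Z j) x.
Definition fluxZ x := \sum_j g j x * Z j x.

Let level k := [set x | K x /\ k.+1%:R^-1 <= v x].

Let level_U k : level k `<=` U.
Proof.
move=> x [Kx vx]; split; first exact: KO.
by apply: lt_le_trans vx; rewrite invr_gt0 ltr0n.
Qed.

Let not_level k x : ~ level k x -> U x -> (~ K x) \/ (etak k x = 0 /\ detak k x = 0).
Proof.
move=> nl Ux; have [Kx|nKx] := pselect (K x); last by left.
right; apply: etak_eq0; rewrite ltNge; apply/negP => vx; exact: nl.
Qed.

Let divZ0 x : U x -> ~ K x -> divZ x = 0.
Proof.
move=> Ux nKx; apply: big1 => j _; apply: (@partial_zero _ _ _ (U `&` ~` K)) => //.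
  by apply: openI => //; exact: compactC.
by move=> y [Uy Ky]; exact: Z0.
Qed.

Let fluxZ0 x : U x -> ~ K x -> fluxZ x = 0.
Proof. by move=> Ux nKx; apply: big1 => j _; rewrite Z0// mulr0. Qed.

Lemma cont_divZ : cont_on U divZ.
Proof. by move=> x Ux; apply: continuous_at_sum => j; exact: (C1_on_partial j (cZ j) Ux). Qed.

Lemma cont_fluxZ : cont_on U fluxZ.
Proof.
move=> x Ux; apply: continuous_at_sum => j; apply: continuous_atM.
  exact: (C1_on_partial j (smooth_on_C1 sv) Ux).
exact: (C1_on_continuous (cZ j) Ux).
Qed.

Lemma cont_detak k : cont_on U (detak k).
Proof.
move=> x Ux; apply: continuous_atM; first exact: cst_continuous.
apply: continuous_at_comp; last exact: continuous_dstep.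
apply: continuous_atM; first exact: cst_continuous.
exact: (C1_on_continuous (smooth_on_C1 sv) Ux).
Qed.

Lemma cut_divergence k :
  [/\ intg U (fun x => etak k x * divZ x), intg U (fun x => detak k x * fluxZ x) &
   Int U (fun x => etak k x * divZ x) = - Int U (fun x => detak k x * fluxZ x)].
Proof.
have [ce pe] := C1_etak k.
have cl : compact (level k) by exact: compact_level.
have i1 : intg U (fun x => etak k x * divZ x).
  refine (intg_cont_compact oU (cont_onM (C1_on_cont ce) cont_divZ) cl (@level_U k) _).
  by move=> x Ux /not_level/(_ Ux)[/(divZ0 Ux)->|[-> _]]; rewrite ?mulr0 ?mul0r.
have i2 : intg U (fun x => detak k x * fluxZ x).
  refine (intg_cont_compact oU (cont_onM (@cont_detak k) cont_fluxZ) cl (@level_U k) _).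
  by move=> x Ux /not_level/(_ Ux)[/(fluxZ0 Ux)->|[_ ->]]; rewrite ?mulr0 ?mul0r.
split=> //; apply/eqP; rewrite -addr_eq0 -(IntD oU i1 i2).
have cY j : C1_on U (fun x => etak k x * Z j x) := C1_onM oU ce (cZ j).
have Y0 j x : U x -> ~ level k x -> etak k x * Z j x = 0.
  by move=> Ux /not_level/(_ Ux)[/(Z0 j Ux)->|[-> _]]; rewrite ?mulr0 ?mul0r.
have [_ <-] := Int_div0 oU cl (@level_U k) cY Y0.
apply/eqP; apply: Int_eq => x Ux.
have E j : partial j (fun y => etak k y * Z j y) x =
    etak k x * partial j (Z j) x + detak k x * (g j x * Z j x).
  by rewrite (C1_partialM j ce (cZ j) Ux) pe// addrC mulrA.
by rewrite (eq_bigr _ (fun j _ => E j)) big_split /= -!mulr_sumr.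
Qed.

Lemma level_cvg x : U x -> \forall k \near \oo, 2 <= k.+1%:R * v x.
Proof.
move=> Ux; exists (Num.truncn (2 / v x)) => // k /= tk.
rewrite -ler_pdivrMr ?v_gt0//; apply: (le_trans (ltW (truncnS_gt _))).
by rewrite ler_nat ltnS.
Qed.

Lemma etak_cvg x : U x -> etak k x @[k --> \oo] --> (1 : R).
Proof.
move=> /level_cvg H; apply: cvg_near_cst; apply: filterS H => k kv.
by rewrite /etak step_eq1.
Qed.

Lemma detak_cvg x : U x -> \forall k \near \oo, detak k x = 0.
Proof.
move=> /level_cvg; apply: filterS => k kv.
by rewrite /detak dstep_eq0 ?mulr0// kv orbT.
Qed.

Lemma etak_ge0 k x : 0 <= etak k x. Proof. exact: step_ge0. Qed.
Lemma etak_le1 k x : etak k x <= 1. Proof. exact: step_le1. Qed.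

Lemma detak_ge0 k x : 0 <= detak k x.
Proof. by rewrite mulr_ge0 ?dstep_ge0// ler0n. Qed.

(* The cutoffs step((k+1) v) have gradients of size 1/v, so their contribution
   vanishes as soon as |fluxZ| / v is integrable. *)
Lemma Int_divZ_eq0 (W : 'rV[R]_n -> R) : intg U divZ -> intg U W ->
  (forall x, U x -> `|fluxZ x| <= v x * W x) -> Int U divZ = 0.
Proof.
move=> iZ iW fW; have [C HC] := @mul_dstep_bounded R.
have W0 x : U x -> 0 <= W x.
  by move=> Ux; rewrite -(pmulr_rge0 _ (v_gt0 Ux)); exact: le_trans (fW x Ux).
have inZ : intg U (fun x => `|divZ x|).
  exact: (integrable_norm iZ).
have c1 k : cont_on U (fun x => etak k x * divZ x).
  by move=> x Ux; apply: continuous_atM; [exact: (C1_on_continuous (C1_etak k).1 Ux)|exact: cont_divZ].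
have c2 k : cont_on U (fun x => detak k x * fluxZ x).
  by move=> x Ux; apply: continuous_atM; [exact: cont_detak|exact: cont_fluxZ].
have L1 : Int U (fun x => etak k x * divZ x) @[k --> \oo] --> Int U divZ.
  apply: (Int_dominated oU c1 inZ _ _).2 => [x Ux|k x Ux].
    by rewrite -[X in _ --> X]mul1r; apply: cvgMl; exact: etak_cvg.
  by rewrite normrM (ger0_norm (etak_ge0 k x)) ler_piMl// etak_le1.
have L2 : Int U (fun x => detak k x * fluxZ x) @[k --> \oo] --> Int U (fun=> 0).
  apply: (Int_dominated oU c2 (intgZ C oU iW) _ _).2 => [x Ux|k x Ux].
    apply: cvg_near_cst; apply: filterS (detak_cvg Ux) => k ->.
    by rewrite mul0r.
  rewrite normrM (le_trans (ler_wpM2l (normr_ge0 _) (fW x Ux)))//.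
  rewrite mulrA ler_wpM2r ?W0//; apply: le_trans (HC (k.+1%:R * v x)).
  by rewrite -[X in _ * X](ger0_norm (ltW (v_gt0 Ux))) -normrM /detak mulrAC.
rewrite (Int_eq (g := fun x => 0 * divZ x)) in L2; last by move=> x _; rewrite mul0r.
rewrite (IntZ 0 oU iZ) mul0r in L2.
have L3 : Int U (fun x => etak k x * divZ x) @[k --> \oo] --> (- 0 : R).
  have -> : (fun k => Int U (fun x => etak k x * divZ x)) =
      (fun k => - Int U (fun x => detak k x * fluxZ x)).
    by apply/funext => k; have [] := cut_divergence k.
  exact: cvgN.
by rewrite -(cvg_lim _ L1)// (cvg_lim _ L3)// oppr0.
Qed.

End VanishingFlux.

Section Bounded.
Context {R : realType} {n : nat}.
Implicit Types (A U K : set 'rV[R]_n) (a b : 'rV[R]_n -> R).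

Definition bdd A a := exists2 B : R, 0 <= B & forall x, A x -> `|a x| <= B.

Lemma bddD A a b : bdd A a -> bdd A b -> bdd A (fun x => a x + b x).
Proof.
move=> [B B0 HB] [C C0 HC]; exists (B + C); first exact: addr_ge0.
by move=> x Ax; rewrite (le_trans (ler_normD _ _))// lerD ?HB ?HC.
Qed.

Lemma bddM A a b : bdd A a -> bdd A b -> bdd A (fun x => a x * b x).
Proof.
move=> [B B0 HB] [C C0 HC]; exists (B * C); first exact: mulr_ge0.
by move=> x Ax; rewrite normrM ler_pM ?HB ?HC.
Qed.

Lemma bdd_cst A (c : R) : bdd A (fun=> c).
Proof. by exists `|c|. Qed.

Lemma bddN A a : bdd A a -> bdd A (fun x => - a x).
Proof. by move=> [B B0 HB]; exists B => // x Ax; rewrite normrN HB. Qed.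

Lemma bddB A a b : bdd A a -> bdd A b -> bdd A (fun x => a x - b x).
Proof. by move=> ba bb; exact: bddD ba (bddN bb). Qed.

Lemma bdd_sum A (I : Type) (r : seq I) (F : I -> 'rV[R]_n -> R) :
  (forall i, bdd A (F i)) -> bdd A (fun x => \sum_(i <- r) F i x).
Proof.
move=> bF; elim: r => [|i r [B B0 HB]].
  by exists 0 => // x _; rewrite big_nil normr0.
have [C C0 HC] := bF i; exists (C + B); first exact: addr_ge0.
by move=> x Ax; rewrite big_cons (le_trans (ler_normD _ _))// lerD ?HB ?HC.
Qed.

Lemma bdd_eq A a b : (forall x, A x -> a x = b x) -> bdd A a -> bdd A b.
Proof. by move=> ab [B B0 HB]; exists B => // x Ax; rewrite -ab// HB. Qed.

Lemma bdd_sub A A' a : A' `<=` A -> bdd A a -> bdd A' a.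
Proof. by move=> AA [B B0 HB]; exists B => // x /AA; exact: HB. Qed.

Lemma bdd_compact K a : compact K -> cont_on setT a -> bdd K a.
Proof.
move=> cK ca; have [B B0 HB] := bounded_on_compact cK (cont_on_within (@subsetT _ K) ca).
by exists B.
Qed.

Lemma bdd_inv A a (c : R) : 0 < c -> (forall x, A x -> c <= a x) -> bdd A (fun x => (a x)^-1).
Proof.
move=> c0 ca; exists c^-1; first by rewrite invr_ge0 ltW.
move=> x /ca cx; have a0 := lt_le_trans c0 cx.
rewrite ger0_norm; last by rewrite invr_ge0 ltW.
by rewrite lef_pV2.
Qed.

Lemma bdd_powR A a (p : R) : 0 <= p -> (forall x, A x -> 0 <= a x) -> bdd A a ->
  bdd A (fun x => a x `^ p).
Proof.
move=> p0 a0 [B B0 HB]; exists (B `^ p); first exact: powR_ge0.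
move=> x Ax; rewrite ger0_norm ?powR_ge0// ge0_ler_powR ?nnegrE ?a0//.
by rewrite (le_trans (ler_norm _))// HB.
Qed.

Lemma intg_bdd U K a : open U -> cont_on U a -> compact K -> bdd (U `&` K) a ->
  (forall x, U x -> ~ K x -> a x = 0) -> intg U a.
Proof.
move=> oU ca cK [B B0 HB] a0.
apply: (@integrable_compact _ _ U a K B) => //; first exact (measurable_continuous oU ca).
move=> x Ux; rewrite indicE; case: (boolP (x \in K)); rewrite ?inE => xK.
  by rewrite mulr1; exact: HB.
by move/negP: xK; rewrite inE => xK; rewrite a0// normr0 mulr0.
Qed.

End Bounded.

Section FatouBound.
Context {R : realType} {n : nat}.
Local Notation mu := (lebesgue_rV n : {sigma_finite_measure set 'rV[R]_n -> \bar R}).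
Local Notation Int U f := (\int[mu]_(x in U) f x)%R.

Lemma intg_fatou (U : set 'rV[R]_n) (F : nat -> 'rV[R]_n -> R) f (C : R) : open U ->
  (forall k, intg U (F k)) -> cont_on U f -> (forall k x, U x -> 0 <= F k x) ->
  (forall x, U x -> F k x @[k --> \oo] --> f x) ->
  (forall k, Int U (F k) <= C) -> intg U f.
Proof.
move=> oU iF cf F0 Ff FC; have mU := measurable_open oU.
have f0 x : U x -> 0 <= f x.
  move=> Ux; rewrite -(cvg_lim _ (Ff x Ux))//; apply: limr_ge.
    by apply/cvg_ex; exists (f x); exact: Ff.
  by apply: nearW => k; exact: F0.
have mf : measurable_fun U (EFin \o f).
  by apply/measurable_EFinP; exact (measurable_continuous oU cf).
apply/integrableP; split=> //.
have mF k : measurable_fun U (fun x => (F k x)%:E) by have /integrableP[] := iF k.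
have FE x : U x -> (F k x)%:E @[k --> \oo] --> (f x)%:E.
  by move=> Ux; apply: cvg_EFin; [exact: nearW|exact: Ff].
have H := @fatou _ _ _ mu U mU (fun k x => (F k x)%:E) mF.
rewrite (eq_integral (fun x => limn_einf ((fun k => (F k x)%:E)))); last first.
  move=> x; rewrite inE => Ux; rewrite is_cvg_limn_einfE; last by apply/cvg_ex; eexists; exact: FE.
  by rewrite gee0_abs ?lee_fin ?f0//; apply/esym/cvg_lim => //; exact: FE.
apply: le_lt_trans (H _) _; first by move=> k x Ux; rewrite lee_fin F0.
apply: (@le_lt_trans _ _ C%:E); last exact: ltry.
rewrite limn_einf_lim; apply: lime_le; first exact: is_cvg_einfs.
apply: nearW => k; apply: (@le_trans _ _ (\int[mu]_(x in U) (F k x)%:E)%E).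
  by apply: ereal_inf_lbound; exists k => //=.
by rewrite Int_EFin// lee_fin.
Qed.

End FatouBound.

(** * Integrability of v^(alpha-1) near compact sets *)

Section SingularIntegrability.
Context {R : realType} {n : nat}.
Variables (Omega : set 'rV[R]_n) (v : 'rV[R]_n -> R) (alpha : R).
Local Notation U := (positivity_set Omega v).
Local Notation g i := (partial i v).
Local Notation mu := (lebesgue_rV n : {sigma_finite_measure set 'rV[R]_n -> \bar R}).
Local Notation Int U f := (\int[mu]_(x in U) f x)%R.
Hypothesis oO : open Omega.
Hypothesis v_ge0 : forall x, Omega x -> 0 <= v x.
Hypothesis v_smooth : smooth_up_to_boundary U Omega v.
Hypothesis alpha_gt0 : 0 < alpha.
Hypothesis gsq_gt0 : forall x, U x -> 0 < gsq v x.
Hypothesis pde_v : forall x, U x -> v x * lap v x = alpha / 2 * (1 - gsq v x).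

Let oU : open U. Proof. by case: v_smooth. Qed.
Let sv : smooth_on U v. Proof. by case: v_smooth. Qed.
Let v_gt0 x : U x -> 0 < v x. Proof. by case. Qed.
Let cv : cont_on Omega v := v_continuous oO v_ge0 v_smooth.

Lemma bdd_partials s K : compact K -> K `<=` Omega -> bdd (U `&` K) (iter_partial s v).
Proof.
move=> cK KO; have [B B0 HB] := bounded_partials v_smooth s cK KO.
by exists B => // x [Ux Kx]; exact: HB.
Qed.

Lemma bdd_v K : compact K -> K `<=` Omega -> bdd (U `&` K) v.
Proof. exact: (bdd_partials [::]). Qed.

Lemma bdd_g i K : compact K -> K `<=` Omega -> bdd (U `&` K) (g i).
Proof. exact: (bdd_partials [:: i]). Qed.

Lemma bdd_H i j K : compact K -> K `<=` Omega -> bdd (U `&` K) (partial j (g i)).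
Proof. exact: (bdd_partials [:: j; i]). Qed.

Lemma bdd_pow K : compact K -> K `<=` Omega -> bdd (U `&` K) (fun x => v x `^ alpha).
Proof.
move=> cK KO; apply: bdd_powR; [exact: ltW| |exact: bdd_v].
by move=> x [/v_gt0/ltW].
Qed.

(* The divergence of v^alpha psi grad v contains alpha v^(alpha-1) |grad v|^2 psi; cut off
   by step((k+1) v), its integral is at most 0 because the cutoff increases along grad v. *)
Lemma intg_singular K : compact K -> K `<=` Omega -> exists W, [/\ intg U W,
  forall x, U x -> 0 <= W x & forall x, U x -> K x -> v x `^ (alpha - 1) <= W x].
Proof.
move=> cK KO.
have [psi [K' [spsi psi0 psi1 cK' [K'O psiK']]]] := cutoff_exists cK KO oO.
have [c c0 Hc] := gsq_lower_bound v_ge0 v_smooth alpha_gt0 gsq_gt0 pde_v cK' K'O.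
have sp : smooth_on U psi by exact: (smooth_on_sub (@subsetT _ U) spsi).
have sg i : smooth_on U (g i) := smooth_g sv i.
have spg i : smooth_on U (fun x => psi x * g i x) := smooth_onM oU sp (sg i).
have sf a : smooth_on U (fun x => v x `^ a) := smooth_pow oU v_gt0 sv a.
pose Z j x := v x `^ alpha * (psi x * g j x).
have cZ j : C1_on U (Z j) := smooth_on_C1 (smooth_onM oU (sf alpha) (spg j)).
have Z0 j x : U x -> ~ K' x -> Z j x = 0 by move=> _ /psiK' E; rewrite /Z E mul0r mulr0.
pose S x := alpha * (v x `^ (alpha - 1) * (gsq v x * psi x)).
pose T x := v x `^ alpha * \sum_j partial j (fun y => psi y * g j y) x.
have sS : smooth_on U S.
  exact: (smooth_onM oU (smooth_on_cst (U:=U) alpha)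
    (smooth_onM oU (sf _) (smooth_onM oU (smooth_gsq oU sv) sp))).
have sT : smooth_on U T.
  exact: (smooth_onM oU (sf _) (smooth_on_sum _ oU (fun j => smooth_on_partial j (spg j)))).
have ZE x : U x -> divZ Z x = S x + T x.
  move=> Ux; rewrite /divZ /Z.
  have E j : partial j (fun y => v y `^ alpha * (psi y * g j y)) x =
     alpha * v x `^ (alpha - 1) * psi x * g j x ^+ 2 +
     v x `^ alpha * partial j (fun y => psi y * g j y) x.
    rewrite (C1_partialM j (smooth_on_C1 (sf alpha)) (smooth_on_C1 (spg j)) Ux).
    rewrite (partial_pow oU v_gt0 sv alpha j Ux); congr (_ + _).
    by move: (g j x) (v x `^ _) => s t; ring.
  rewrite (eq_bigr _ (fun j _ => E j)) big_split /= -!mulr_sumr; congr (_ + _).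
  by rewrite /S -/(gsq v x); ring.
have fluxE x : U x -> fluxZ v Z x = v x `^ alpha * psi x * gsq v x.
  move=> Ux; rewrite /fluxZ /gsq mulr_sumr; apply: eq_bigr => j _; rewrite /Z.
  by move: (g j x) => s; ring.
have T0 x : U x -> ~ K' x -> T x = 0.
  move=> Ux nK; rewrite /T big1 ?mulr0// => j _.
  apply: (@partial_zero _ _ _ (~` K')) => //; first exact: compactC.
  by move=> y /psiK' ->; rewrite mul0r.
have bT : bdd (U `&` K') T.
  apply: bddM; first exact: bdd_pow.
  apply: bdd_sum => j.
  apply: (@bdd_eq _ _ _ (fun x => partial j psi x * g j x + psi x * partial j (g j) x)).
    by move=> x [Ux _]; rewrite (C1_partialM j (smooth_on_C1 sp) (smooth_on_C1 (sg j)) Ux).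
  apply: bddD; apply: bddM; [|exact: bdd_g| |exact: bdd_H].
    apply: bdd_sub (bdd_compact cK' _); first by move=> x [].
    exact: (C1_on_cont_partial (smooth_on_C1 spsi)).
  apply: bdd_sub (bdd_compact cK' _); first by move=> x [].
  exact: (C1_on_cont (smooth_on_C1 spsi)).
have iT : intg U T := intg_bdd oU (C1_on_cont (smooth_on_C1 sT)) cK' bT T0.
have inT : intg U (fun x => `|T x|) by exact: (integrable_norm iT).
have ceta k : cont_on U (etak v k) := C1_on_cont (C1_etak oU sv k).1.
have ietaT k : intg U (fun x => etak v k x * T x).
  apply: (intg_cont_le oU _ inT) => [|x Ux].
    exact (cont_onM (ceta k) (C1_on_cont (smooth_on_C1 sT))).
  by rewrite normrM (ger0_norm (etak_ge0 v k x)) ler_piMl// etak_le1.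
have ietaS k : intg U (fun x => etak v k x * S x).
  have [i1 _ _] := cut_divergence oU sv cv cK' K'O cZ Z0 k.
  apply: (intg_eq oU _ (intgB oU i1 (ietaT k))) => x Ux.
  by rewrite ZE//; ring.
have S0 x : U x -> 0 <= S x.
  move=> Ux; rewrite /S mulr_ge0 ?(ltW alpha_gt0)// mulr_ge0 ?powR_ge0//.
  by rewrite mulr_ge0 ?psi0// ltW// gsq_gt0.
have iS : intg U S.
  apply: (@intg_fatou _ _ U (fun k x => etak v k x * S x) S (Int U (fun x => `|T x|))) => //.
  - exact: (C1_on_cont (smooth_on_C1 sS)).
  - by move=> k x Ux; rewrite mulr_ge0 ?etak_ge0// S0.
  - by move=> x Ux; rewrite -[X in _ --> X]mul1r; apply: cvgMl; exact: (etak_cvg Ux).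
  - move=> k; have [i1 i2 E] := cut_divergence oU sv cv cK' K'O cZ Z0 k.
    have -> : Int U (fun x => etak v k x * S x) =
       Int U (fun x => etak v k x * divZ Z x) - Int U (fun x => etak v k x * T x).
      by rewrite -(IntB oU i1 (ietaT k)); apply: Int_eq => x Ux; rewrite ZE//; ring.
    have : 0 <= Int U (fun x => detak v k x * fluxZ v Z x).
      apply: Int_ge0 => x Ux; rewrite fluxE// mulr_ge0 ?detak_ge0//.
      by rewrite !mulr_ge0 ?powR_ge0// ltW// gsq_gt0.
    have : - Int U (fun x => etak v k x * T x) <= Int U (fun x => `|T x|).
      rewrite -mulN1r -(IntZ (-1) oU (ietaT k)).
      apply: (Int_le oU (intgZ (-1) oU (ietaT k)) inT) => x Ux.
      rewrite mulN1r (le_trans (ler_norm _))// normrN normrM (ger0_norm (etak_ge0 v k x)).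
      by rewrite ler_piMl// etak_le1.
    by rewrite E => H1 H2; rewrite addrC (le_trans _ H1)// gerDl oppr_le0.
(* On [K] both [psi >= 1] and |grad v|^2 >= c hold, so [S] is at least alpha c v^(alpha-1) there. *)
exists (fun x => (alpha * c)^-1 * S x); split.
- exact: intgZ.
- by move=> x Ux; rewrite mulr_ge0 ?S0// invr_ge0 ltW// mulr_gt0.
- move=> x Ux Kx; rewrite ler_pdivlMl ?mulr_gt0// /S.
  rewrite -mulrA ler_pM2l// [leRHS]mulrC ler_wpM2r ?powR_ge0//.
  have K'x : K' x.
    by apply: contrapT => /psiK' E; have := psi1 x Kx; rewrite E ler10.
  by rewrite -[c]mulr1 ler_pM ?(ltW c0)// ?Hc// psi1.
Qed.

End SingularIntegrability.

Lemma cvg_seq_sum (R : realType) (I : Type) (r : seq I) (F : I -> nat -> R) (l : I -> R) :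
  (forall i, F i k @[k --> \oo] --> l i) ->
  \sum_(i <- r) F i k @[k --> \oo] --> \sum_(i <- r) l i.
Proof.
move=> cF; elim: r => [|i r IH].
  by under eq_cvg do rewrite big_nil; rewrite big_nil; exact: cvg_cst.
by under eq_cvg do rewrite big_cons; rewrite big_cons; exact: cvgD.
Qed.

(** * The quadratic form and its continuity under dominated convergence *)

Section QuadraticForm.
Context {R : realType} {n : nat}.
Variables (Omega : set 'rV[R]_n) (v : 'rV[R]_n -> R) (alpha : R).
Local Notation U := (positivity_set Omega v).
Local Notation mu := (lebesgue_rV n : {sigma_finite_measure set 'rV[R]_n -> \bar R}).
Local Notation Int U f := (\int[mu]_(x in U) f x)%R.
Hypothesis oO : open Omega.
Hypothesis v_ge0 : forall x, Omega x -> 0 <= v x.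
Hypothesis v_smooth : smooth_up_to_boundary U Omega v.
Hypothesis alpha_gt0 : 0 < alpha.
Hypothesis gsq_gt0 : forall x, U x -> 0 < gsq v x.
Hypothesis pde_v : forall x, U x -> v x * lap v x = alpha / 2 * (1 - gsq v x).

Let oU : open U. Proof. by case: v_smooth. Qed.
Let sv : smooth_on U v. Proof. by case: v_smooth. Qed.
Let v_gt0 x : U x -> 0 < v x. Proof. by case. Qed.
Let sf a : smooth_on U (fun x => v x `^ a) := smooth_pow oU v_gt0 sv a.

Definition Q_grad (phi : 'rV[R]_n -> R) x := v x `^ alpha * (\sum_j partial j phi x ^+ 2).
Definition Q_pot (phi : 'rV[R]_n -> R) x :=
  v x `^ alpha * ((1 - gsq v x) / v x ^+ 2) * phi x ^+ 2.

(** The apparent singularity v^(alpha-2) of the potential is only v^(alpha-1): the equation makes 1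
    - |grad v|^2 proportional to v Delta v. Integrability and continuity of the potential are proved
    in this form. *)
Lemma Q_pot_lap phi x : U x ->
  Q_pot phi x = 2 / alpha * (v x `^ (alpha - 1) * (lap v x * phi x ^+ 2)).
Proof.
move=> Ux; have v0 := v_gt0 Ux; have vn0 : v x != 0 by rewrite gt_eqF.
have an0 : alpha != 0 by rewrite gt_eqF.
have -> : lap v x = alpha / 2 * (1 - gsq v x) / v x by rewrite -pde_v// mulrAC divff// mul1r.
rewrite /Q_pot (powR_pred alpha v0).
set P := v x `^ _; move: P (gsq v x) (phi x) => P a b.
by field; rewrite an0 vn0.
Qed.

Lemma bdd_lap K : compact K -> K `<=` Omega -> bdd (U `&` K) (lap v).
Proof.
by move=> cK KO; apply: bdd_sum => i; exact (bdd_H v_smooth i i cK KO).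
Qed.

Definition controlled K B (phi : 'rV[R]_n -> R) :=
  [/\ C1_on U phi, forall x, U x -> ~ K x -> phi x = 0,
   forall x, U x -> `|phi x| <= B & forall j x, U x -> `|partial j phi x| <= B].

Lemma controlled_partial0 K B phi j x : compact K -> controlled K B phi ->
  U x -> ~ K x -> partial j phi x = 0.
Proof.
move=> cK [_ phi0 _ _] Ux nK; apply: (@partial_zero _ _ _ (U `&` ~` K)) => //.
  by apply: openI => //; exact: compactC.
by move=> y [Uy Ky]; exact: phi0.
Qed.

(** The majorants depend on [K] and [B] alone, so that one pair serves a whole sequence in
    [Q_limit]. For the gradient term v^alpha = v v^(alpha-1) leaves a bounded factor v to spare. *)
Lemma Q_majorant K B : compact K -> K `<=` Omega -> 0 <= B ->
  exists W1 W2, [/\ intg U W1, intg U W2 & forall phi, controlled K B phi ->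
    forall x, U x -> `|Q_grad phi x| <= W1 x /\ `|Q_pot phi x| <= W2 x].
Proof.
move=> cK KO B0.
have [W [iW W0 HW]] := intg_singular oO v_ge0 v_smooth alpha_gt0 gsq_gt0 pde_v cK KO.
have [C C0 HC] := bdd_v v_smooth cK KO.
have [L L0 HL] := bdd_lap cK KO.
exists (fun x => C * (n%:R * B ^+ 2) * W x), (fun x => 2 / alpha * (L * B ^+ 2) * W x).
split; [exact: intgZ|exact: intgZ|] => phi cphi x Ux.
have [_ phi0 phiB dphiB] := cphi.
have [Kx|nKx] := pselect (K x); last first.
  rewrite /Q_pot phi0// expr0n mulr0 normr0 /Q_grad big1 ?mulr0 ?normr0.
    split; first by rewrite mulr_ge0 ?W0// mulr_ge0// mulr_ge0 ?exprn_ge0// ler0n.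
    rewrite mulr_ge0 ?W0// mulr_ge0 ?divr_ge0 ?(ltW alpha_gt0)//.
    by rewrite mulr_ge0 ?exprn_ge0.
  by move=> j _; rewrite (controlled_partial0 j cK cphi Ux nKx) expr0n.
have sqB t : `|t| <= B -> t ^+ 2 <= B ^+ 2.
  by move=> tB; rewrite -real_normK ?num_real// ler_pXn2r// nnegrE.
have v0 := v_gt0 Ux.
have wW := HW x Ux Kx; have w0 : 0 <= v x `^ (alpha - 1) := powR_ge0 _ _.
split.
  have s0 : 0 <= \sum_j partial j phi x ^+ 2 by apply: sumr_ge0 => j _; exact: sqr_ge0.
  have sB : \sum_j partial j phi x ^+ 2 <= n%:R * B ^+ 2.
    apply: (@le_trans _ _ (\sum_(j < n) B ^+ 2)); last by rewrite sumr_const card_ord mulr_natl.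
    by apply: ler_sum => j _; apply: sqB; exact: dphiB.
  rewrite /Q_grad ger0_norm; last by rewrite mulr_ge0// powR_ge0.
  rewrite (powR_pred alpha v0) mulrAC ler_pM//; first by rewrite mulr_ge0// ltW.
  by rewrite ler_pM// ?(ltW v0)// (le_trans (ler_norm _))// HC.
have a20 : 0 <= 2 / alpha by rewrite divr_ge0// ltW.
rewrite (Q_pot_lap phi Ux) normrM (ger0_norm a20) -[leRHS]mulrA ler_wpM2l//.
rewrite normrM (ger0_norm w0) [leRHS]mulrC ler_pM// normrM ler_pM//.
  by apply: HL; split.
by rewrite ger0_norm ?sqr_ge0// sqB// phiB.
Qed.

Lemma cont_Q_grad phi : C1_on U phi -> cont_on U (Q_grad phi).
Proof.
move=> cphi x Ux; apply: continuous_atM; first exact: (C1_on_continuous (smooth_on_C1 (sf alpha)) Ux).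
apply: continuous_at_sum => j.
by apply: continuous_atM; exact: (C1_on_partial j cphi Ux).
Qed.

Lemma cont_Q_pot phi : C1_on U phi -> cont_on U (Q_pot phi).
Proof.
move=> cphi; apply: (@cont_on_eq _ _ _
  (fun x => 2 / alpha * (v x `^ (alpha - 1) * (lap v x * phi x ^+ 2)))) => //.
  by move=> x Ux; rewrite Q_pot_lap.
have cp := C1_on_cont cphi.
refine (cont_onM (@cont_on_cst _ _ U (2 / alpha)) (cont_onM _ (cont_onM _ (cont_onM cp cp)))).
  exact: (C1_on_cont (smooth_on_C1 (sf _))).
exact: (C1_on_cont (smooth_on_C1 (smooth_lap oU sv))).
Qed.

Lemma intg_Q K B phi : compact K -> K `<=` Omega -> 0 <= B -> controlled K B phi ->
  intg U (Q_grad phi) /\ intg U (Q_pot phi).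
Proof.
move=> cK KO B0 cphi; have [W1 [W2 [i1 i2 H]]] := Q_majorant cK KO B0.
have [c1 _ _ _] := cphi.
split; [apply: (intg_cont_le oU (cont_Q_grad c1) i1)|apply: (intg_cont_le oU (cont_Q_pot c1) i2)].
  by move=> x Ux; have [] := H phi cphi x Ux.
by move=> x Ux; have [] := H phi cphi x Ux.
Qed.

Lemma Q_limit K B (phi_ : nat -> 'rV[R]_n -> R) phi : compact K -> K `<=` Omega -> 0 <= B ->
  (forall k, controlled K B (phi_ k)) ->
  (forall x, U x -> phi_ k x @[k --> \oo] --> phi x) ->
  (forall j x, U x -> partial j (phi_ k) x @[k --> \oo] --> partial j phi x) ->
  (forall k, alpha / 2 * Int U (Q_pot (phi_ k)) <= Int U (Q_grad (phi_ k))) ->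
  alpha / 2 * Int U (Q_pot phi) <= Int U (Q_grad phi).
Proof.
move=> cK KO B0 cphi cv0 cv1 Hk; have [W1 [W2 [i1 i2 H]]] := Q_majorant cK KO B0.
have C1k k : C1_on U (phi_ k) by have [] := cphi k.
have [_ L1] : intg U (Q_grad phi) /\ Int U (Q_grad (phi_ k)) @[k --> \oo] --> Int U (Q_grad phi).
  apply: (Int_dominated oU (fun k => cont_Q_grad (C1k k)) i1) => [x Ux|k x Ux].
    apply: cvgMr; apply: cvg_seq_sum => j.
    by apply: cvgM; exact: (cv1 j x Ux).
  by have [] := H _ (cphi k) x Ux.
have [i3 L2] : intg U (Q_pot phi) /\ Int U (Q_pot (phi_ k)) @[k --> \oo] --> Int U (Q_pot phi).
  apply: (Int_dominated oU (fun k => cont_Q_pot (C1k k)) i2) => [x Ux|k x Ux].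
    by apply: cvgMr; apply: cvgM; exact: (cv0 x Ux).
  by have [] := H _ (cphi k) x Ux.
have L3 : alpha / 2 * Int U (Q_pot (phi_ k)) @[k --> \oo] --> alpha / 2 * Int U (Q_pot phi).
  exact: cvgMr.
rewrite -(cvg_lim _ L1)// -(cvg_lim _ L3)//; apply: ler_lim.
- by apply/cvg_ex; eexists; exact: L3.
- by apply/cvg_ex; eexists; exact: L1.
by apply: nearW => k; exact: Hk.
Qed.

End QuadraticForm.

(** * The integrated second variation of a test field *)

Section StabilityForTestFields.
Context {R : realType} {n : nat}.
Variables (Omega : set 'rV[R]_n) (v : 'rV[R]_n -> R) (alpha : R).
Local Notation U := (positivity_set Omega v).
Local Notation g i := (partial i v).
Local Notation mu := (lebesgue_rV n : {sigma_finite_measure set 'rV[R]_n -> \bar R}).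
Local Notation Int U f := (\int[mu]_(x in U) f x)%R.
Hypothesis oO : open Omega.
Hypothesis v_ge0 : forall x, Omega x -> 0 <= v x.
Hypothesis v_smooth : smooth_up_to_boundary U Omega v.
Hypothesis alpha_gt0 : 0 < alpha.
Hypothesis gsq_gt0 : forall x, U x -> 0 < gsq v x.
Hypothesis pde_v : forall x, U x -> v x * lap v x = alpha / 2 * (1 - gsq v x).

Let oU : open U. Proof. by case: v_smooth. Qed.
Let sv : smooth_on U v. Proof. by case: v_smooth. Qed.
Let v_gt0 x : U x -> 0 < v x. Proof. by case. Qed.
Let cv : cont_on Omega v := v_continuous oO v_ge0 v_smooth.

Lemma controlled_exists K phi : C1_on U phi -> (forall x, U x -> ~ K x -> phi x = 0) ->
  compact K -> bdd (U `&` K) phi -> (forall j, bdd (U `&` K) (partial j phi)) ->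
  exists2 B, 0 <= B & controlled Omega v K B phi.
Proof.
move=> cphi phi0 cK [B0 B00 HB0] bd.
have /choice[B HB] j : exists B, 0 <= B /\ forall x, (U `&` K) x -> `|partial j phi x| <= B.
  by have [B ? ?] := bd j; exists B.
have S0 : 0 <= \sum_j B j by apply: sumr_ge0 => j _; have [] := HB j.
exists (B0 + \sum_j B j); first exact: addr_ge0.
have p0 j x : U x -> ~ K x -> partial j phi x = 0.
  move=> Ux nK; apply: (@partial_zero _ _ _ (U `&` ~` K)) => //.
    by apply: openI => //; exact: compactC.
  by move=> y [Uy Ky]; exact: phi0.
split=> // [x Ux|j x Ux]; have [Kx|nK] := pselect (K x).
- by rewrite (le_trans (HB0 x (conj Ux Kx)))// lerDl.
- by rewrite phi0// normr0 addr_ge0.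
- have [_ /(_ x (conj Ux Kx)) H] := HB j; apply: (le_trans H).
  rewrite (bigD1 j)//= addrCA lerDl addr_ge0//.
  by apply: sumr_ge0 => k _; have [] := HB k.
- by rewrite p0// normr0 addr_ge0.
Qed.

Variables (F : 'I_n -> 'rV[R]_n -> R) (K : set 'rV[R]_n).
Hypothesis sF : forall i, smooth_on setT (F i).
Hypothesis cK : compact K.
Hypothesis KO : K `<=` Omega.
Hypothesis F0 : forall i x, ~ K x -> F i x = 0.

Let sFU i : smooth_on U (F i). Proof. exact: (smooth_on_sub (@subsetT _ U) (sF i)). Qed.

Let D0 i j x : ~ K x -> partial j (F i) x = 0.
Proof.
move=> nK; apply: (@partial_zero _ _ _ (~` K)) => //; first exact: compactC.
by move=> y; exact: F0.
Qed.

Let A := U `&` K.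
Let AK : A `<=` K. Proof. by move=> x []. Qed.
Let bF i : bdd A (F i).
Proof. exact: (bdd_sub AK (bdd_compact cK (C1_on_cont (smooth_on_C1 (sF i))))). Qed.
Let bD i j : bdd A (partial j (F i)).
Proof. exact: (bdd_sub AK (bdd_compact cK (C1_on_cont_partial (smooth_on_C1 (sF i))))). Qed.
Let bg i : bdd A (g i). Proof. exact: (bdd_g v_smooth i cK KO). Qed.
Let bH i j : bdd A (partial j (g i)). Proof. exact: (bdd_H v_smooth i j cK KO). Qed.
Let bdot (a b : 'I_n -> 'rV[R]_n -> R) : (forall i, bdd A (a i)) -> (forall i, bdd A (b i)) ->
  bdd A (fun x => \sum_i a i x * b i x).
Proof. by move=> ba bb; apply: bdd_sum => i; exact: bddM. Qed.
Let bgsq : bdd A (gsq v). Proof. exact: (bdot bg bg). Qed.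
Let bgsq1 : bdd A (fun x => gsq v x + 1). Proof. exact: (bddD bgsq (bdd_cst A 1)). Qed.
Let bdivF : bdd A (divF F). Proof. exact: (bdd_sum _ (fun i => bD i i)). Qed.
Let btrD2 : bdd A (trD2 F).
Proof. by apply: bdd_sum => i; apply: bdd_sum => j; exact: bddM. Qed.
Let bDg i : bdd A (Dg v F i). Proof. exact: (bdot (bD i) bg). Qed.
Let bdF i : bdd A (dF F i). Proof. exact: (bdot (bD i) bF). Qed.
Let bHF i : bdd A (HF v F i). Proof. exact: (bdot (bH i) bF). Qed.
Let bkk : bdd A (kk v F). Proof. exact: (bdot bg bDg). Qed.
Let bcc : bdd A (cc v F). Proof. exact: (bdot bg bdF). Qed.
Let bmm : bdd A (mm v F). Proof. exact: (bdot bg bHF). Qed.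
Let bqq : bdd A (qq v F). Proof. exact: (bdot bF bHF). Qed.
Let bgF : bdd A (gF v F). Proof. exact: (bdot bg bF). Qed.
Let bw2 : bdd A (w2 v F).
Proof.
have bW j : bdd A (fun x => \sum_i partial j (F i) x * g i x) by exact: (bdot (fun i => bD i j) bg).
by apply: bdd_sum => j; exact: (bddM (bW j) (bW j)).
Qed.
Let bzz : bdd A (zz v F).
Proof. by apply: (bdot bg) => i; exact: (bdot (bD i) bDg). Qed.
Let bf : bdd A (fun x => v x `^ alpha). Proof. exact: (bdd_pow v_smooth alpha_gt0 cK KO). Qed.

Lemma bdd_second_density : bdd A (second_density v alpha F).
Proof.
apply: (bddM bf); apply: bddB; last exact: (bddM (bdd_cst A 2) (bddM bkk bdivF)).
apply: bddD; last exact: (bddM (bdd_cst A 2) bzz).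
apply: bddD; last exact: bw2.
apply: (bddM bgsq1); apply: bddM; last exact: bdd_cst.
exact: (bddB (bddM bdivF bdivF) btrD2).
Qed.

Lemma second_density_eq0 x : ~ K x -> second_density v alpha F x = 0.
Proof.
move=> nK; rewrite /second_density.
have D0' i j : partial j (F i) x = 0 by exact: D0.
have -> : divF F x = 0 by rewrite /divF big1.
have -> : trD2 F x = 0.
  by rewrite /trD2 big1// => i _; rewrite big1// => j _; rewrite D0' mul0r.
have -> : w2 v F x = 0.
  by rewrite /w2 big1// => j _; rewrite big1 ?expr0n// => i _; rewrite D0' mul0r.
have -> : zz v F x = 0.
  by rewrite /zz big1// => i _; rewrite big1 ?mulr0// => j _; rewrite D0' mul0r.
by rewrite expr0n subrr mul0r !mulr0 !addr0 subrr mulr0.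
Qed.

Lemma Yfield_eq0 j x : U x -> ~ K x -> Yfield v alpha F j x = 0.
Proof.
move=> _ nK; rewrite /Yfield F0// mulr0 add0r.
have dF0 i : dF F i x = 0 by rewrite /dF big1// => k _; rewrite F0// mulr0.
rewrite dF0 mulr0 add0r /a3.
have -> : cc v F x = 0 by rewrite /cc big1// => i _; rewrite dF0 mulr0.
have -> : gF v F x = 0 by rewrite /gF big1// => i _; rewrite F0// mulr0.
have -> : qq v F x = 0 by rewrite /qq big1// => i _; rewrite F0// mul0r.
by rewrite !mulr0 !addr0 mul0r.
Qed.

Lemma controlled_gF : exists2 B, 0 <= B & controlled Omega v K B (gF v F).
Proof.
have sgF := smooth_gF oU sv sFU.
apply: controlled_exists => //; first exact: smooth_on_C1.
  by move=> x _ nK; rewrite /gF big1// => i _; rewrite F0// mulr0.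
move=> j; apply: (@bdd_eq _ _ _
    (fun x => \sum_i (partial j (g i) x * F i x + g i x * partial j (F i) x))).
  move=> x [Ux _]; rewrite /gF; apply/esym.
  rewrite (C1_partial_sum _ j oU 
    (fun i => C1_onM oU (smooth_on_C1 (smooth_g sv i)) (smooth_on_C1 (sFU i))) Ux).
  apply: eq_bigr => i _.
  by rewrite (C1_partialM j (smooth_on_C1 (smooth_g sv i)) (smooth_on_C1 (sFU i)) Ux).
by apply: bdd_sum => i; apply: bddD; exact: bddM.
Qed.

(** Read off the right-hand side of [second_variation_identity], whose terms are already known to be
    continuous. *)
Lemma cont_second_density : cont_on U (second_density v alpha F).
Proof.
have sQ := smooth_gF oU sv sFU.
apply: (@cont_on_eq _ _ _ (fun x =>
  (Q_grad v alpha (gF v F) x - alpha / 2 * Q_pot v alpha (gF v F) x) + divZ (Yfield v alpha F) x)) => //.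
  by move=> x Ux; rewrite (second_variation_identity oU v_gt0 sv sFU pde_v Ux).
have cQ := smooth_on_C1 sQ.
apply: cont_onD.
  apply: cont_onB; first exact: cont_Q_grad.
  by apply: cont_onM; [exact: cont_on_cst|exact: cont_Q_pot].
exact: (cont_divZ (fun j => smooth_on_C1 (smooth_Yfield alpha oU v_gt0 sv sFU j))).
Qed.

(** Integrability of the divergence is not estimated directly: it is the difference of the density,
    bounded with compact support, and the quadratic form, dominated by v^(alpha-1). By
    [flux_identity] the flux is at most v times a multiple of the majorant of v^(alpha-1), which is
    what [Int_divZ_eq0] requires. *)
Lemma second_variation_Q : intg U (second_density v alpha F) /\
  Int U (second_density v alpha F) =
  Int U (Q_grad v alpha (gF v F)) - alpha / 2 * Int U (Q_pot v alpha (gF v F)).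
Proof.
have iS : intg U (second_density v alpha F).
  apply: (intg_bdd oU cont_second_density cK bdd_second_density) => x _.
  exact: second_density_eq0.
have [B B0 cB] := controlled_gF.
have [i1 i2] := intg_Q oO v_ge0 v_smooth alpha_gt0 gsq_gt0 pde_v cK KO B0 cB.
have i3 : intg U (fun x => alpha / 2 * Q_pot v alpha (gF v F) x) by exact: intgZ.
have i4 := intgB oU i1 i3.
have cY j : C1_on U (Yfield v alpha F j) := smooth_on_C1 (smooth_Yfield alpha oU v_gt0 sv sFU j).
have E x : U x -> second_density v alpha F x -
    (Q_grad v alpha (gF v F) x - alpha / 2 * Q_pot v alpha (gF v F) x) = divZ (Yfield v alpha F) x.
  move=> Ux; rewrite (second_variation_identity oU v_gt0 sv sFU pde_v Ux).
  by rewrite addrC addKr.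
have iY : intg U (divZ (Yfield v alpha F)) := intg_eq oU E (intgB oU iS i4).
have [W [iW W0 HW]] := intg_singular oO v_ge0 v_smooth alpha_gt0 gsq_gt0 pde_v cK KO.
have [L L0 HL] : bdd A (fun x =>
     2^-1 * (gsq v x + 1) * (divF F x * gF v F x - cc v F x)
   - 2 * kk v F x * gF v F x + 2 * cc v F x * gsq v x
   - mm v F x * gF v F x - lap v x * gF v F x ^+ 2 + qq v F x * gsq v x).
  apply: bddD; last exact: (bddM bqq bgsq).
  apply: bddB; last exact: (bddM (bdd_lap v_smooth cK KO) (bddM bgF bgF)).
  apply: bddB; last exact: (bddM bmm bgF).
  apply: bddD; last exact: (bddM (bddM (bdd_cst A 2) bcc) bgsq).
  apply: bddB; last exact: (bddM (bddM (bdd_cst A 2) bkk) bgF).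
  exact: (bddM (bddM (bdd_cst A 2^-1) bgsq1) (bddB (bddM bdivF bgF) bcc)).
have fl x : U x -> `|fluxZ v (Yfield v alpha F) x| <= v x * (L * W x).
  move=> Ux; have v0 := v_gt0 Ux.
  have [Kx|nK] := pselect (K x); last first.
    rewrite /fluxZ big1 ?normr0; first by rewrite mulr_ge0 ?(ltW v0)// mulr_ge0 ?W0.
    by move=> j _; rewrite Yfield_eq0// mulr0.
  rewrite /fluxZ (flux_identity F v_gt0 pde_v Ux) (powR_pred alpha v0) -mulrA normrM.
  rewrite (ger0_norm (ltW v0)) ler_pM2l// normrM [leRHS]mulrC ler_pM//.
    by rewrite ger0_norm ?powR_ge0// HW.
  exact: (HL x (conj Ux Kx)).
have I0 := Int_divZ_eq0 oU sv cv cK KO cY Yfield_eq0 iY (intgZ L oU iW) fl.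
split=> //; rewrite -(IntZ (alpha / 2) oU i2) -(IntB oU i1 i3).
apply/eqP; rewrite -subr_eq0 -(IntB oU iS i4) (Int_eq E); exact/eqP.
Qed.

End StabilityForTestFields.

(** Dominated convergence is available along sequences, so the continuity of a convolution is tested
    on them. *)
Lemma continuous_at_seq (R : realType) n (f : 'rV[R]_n -> R) x :
  (forall u : nat -> 'rV[R]_n, (forall k, ball x k.+1%:R^-1 (u k)) ->
    f (u k) @[k --> \oo] --> f x) -> {for x, continuous f}.
Proof.
move=> H; apply: contrapT => ncf.
have [e e0 He] : exists2 e : R, 0 < e & ~ nbhs x [set y | `|f x - f y| < e].
  apply: contrapT => nH; apply: ncf.
  have Q e : 0 < e -> nbhs x [set y | `|f x - f y| < e].
    by move=> e0; apply: contrapT => ne; apply: nH; exists e.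
  exact: continuous_at_dist.
have /choice[u uP] k : exists y, ball x k.+1%:R^-1 y /\ ~ `|f x - f y| < e.
  apply: contrapT => /forallNP nk; apply: He; apply/nbhs_ballP.
  exists k.+1%:R^-1 => /=; first by rewrite invr_gt0 ltr0n.
  by move=> y xy /=; apply: contrapT => ny; apply: (nk y).
have /cvgrPdist_lt/(_ e e0)[N _ /(_ N (leqnn N))/=] := H u (fun k => (uP k).1).
by have [] := uP N.
Qed.

(** * Mollification *)

Section Reflection.
Context {R : realType} {n : nat}.
Implicit Types (f : 'rV[R]_n -> R) (x y : 'rV[R]_n).

Lemma is_derive_reflect f x y i : derivable f (x - y) (delta_mx ord0 i) ->
  is_derive y (delta_mx ord0 i) (fun z => f (x - z)) (- partial i f (x - y)).
Proof.
move=> df; have D := @is_derive_line _ _ f (x - y) (delta_mx ord0 i) 0.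
rewrite scale0r add0r in D; have {}D := D df.
have D0 : is_derive (0 : R) (1 : R) (fun t : R => - t) (-1) by exact: is_deriveN.
rewrite -[X in is_derive X](oppr0 R) in D.
have D1 := @is_derive1_comp _
  (fun t : R => f (t *: delta_mx ord0 i + (x - y))) (fun t : R => - t) 0 _ _ D D0.
have E : (fun t : R => f (t *: delta_mx ord0 i + (x - y))) \o (fun t : R => - t) =
         (fun h : R => f (x - (h *: delta_mx ord0 i + y))).
  by apply/funext => h /=; rewrite scaleNr opprD addrCA.
rewrite E mulrN1 in D1.
apply: DeriveDef.
  by apply/(derivable_line (fun z => f (x - z)));
    exact: (@ex_derive _ _ _ _ _ _ _ D1).
by rewrite (derive_line (fun z => f (x - z))); exact: (@derive_val _ _ _ _ _ _ _ D1).
Qed.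

Lemma continuous_at_reflect f x y : {for (x - y), continuous f} ->
  {for y, continuous (fun z : 'rV[R]_n => f (x - z))}.
Proof.
move=> cf; have ct : {for y, continuous ((cst x : 'rV[R]_n -> 'rV[R]_n) - id)}.
  by apply: continuousB; [exact: cst_continuous|exact: cvg_id].
exact: (continuous_comp ct cf).
Qed.

Lemma C1_on_reflect f x : C1_on setT f -> C1_on setT (fun y => f (x - y)).
Proof.
move=> cf; apply: (@C1_onP _ _ _ _ (fun i y => - partial i f (x - y))); first exact: openT.
- by move=> y _; apply: continuous_at_reflect; exact: (C1_on_continuous cf).
- by move=> i y _; apply: is_derive_reflect; exact: (C1_on_derivable i cf).
- move=> i y _; apply: continuousN.
  by apply: (continuous_at_reflect (f := partial i f)); exact: (C1_on_partial i cf).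
Qed.

Lemma partial_reflect f x y i : C1_on setT f ->
  partial i (fun z => f (x - z)) y = - partial i f (x - y).
Proof.
move=> cf; apply: (@derive_val _ _ _ _ _ _ _ (is_derive_reflect _)).
exact: (C1_on_derivable i cf).
Qed.

End Reflection.

Section Convolution.
Context {R : realType} {n : nat}.
Local Notation mu := (lebesgue_rV n : {sigma_finite_measure set 'rV[R]_n -> \bar R}).
Local Notation Int U f := (\int[mu]_(x in U) f x)%R.
Local Notation T := [set: 'rV[R]_n].
Implicit Types (h k : 'rV[R]_n -> R) (x y : 'rV[R]_n).

Definition conv h k x := Int T (fun y => h y * k (x - y)).

Variables (r M : R).

Definition kernel_supp k := forall z, ~ cube r z -> k z = 0.

Lemma kernel_ccube k x y : kernel_supp k -> ~ ccube x r y -> k (x - y) = 0.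
Proof.
move=> ks nxy; apply: ks => H; apply: nxy => i.
by have := H i; rewrite !mxE distrC.
Qed.

Lemma cont_kernel k x : cont_on T k -> cont_on T (fun y => k (x - y)).
Proof. by move=> ck y _; apply: continuous_at_reflect; exact: ck. Qed.

Arguments cont_kernel [k] x.

Lemma intg_conv h k x : cont_on T h -> cont_on T k -> kernel_supp k ->
  intg T (fun y => h y * k (x - y)).
Proof.
move=> ch ck ks.
refine (intg_cont_compact openT (cont_onM ch (cont_kernel x ck))
  (compact_ccube x r) (@subsetT _ _) _) => y _ ny.
by rewrite kernel_ccube// mulr0.
Qed.

Lemma bdd_kernel k : cont_on T k -> kernel_supp k ->
  exists2 B : R, 0 <= B & forall z, `|k z| <= B.
Proof.
move=> ck ks; have [B B0 HB] := bdd_compact (@compact_cube R n r) ck.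
exists B => // z; have [zr|zr] := pselect (cube r z); first exact: HB.
by rewrite ks// normr0.
Qed.

Lemma intg_indic_ccube (C : R) x s : intg T (fun y => C * \1_(ccube x s) y).
Proof.
have mK : measurable (ccube x s) by apply: measurable_closed; exact: closed_ccube.
apply: (intgZ C openT); apply/integrableP; split; first exact/measurable_EFinP.
rewrite (eq_integral (fun x0 => (\1_(ccube x s) x0)%:E)); last first.
  by move=> t _; rewrite gee0_abs// lee_fin.
by rewrite integral_indic// setIT; exact: (lebesgue_rV_compact (compact_ccube x s)).
Qed.

(** Kernels centred within distance 1 of [x] are all supported in the cube of radius r + 1 around
    [x], where a constant is a majorant. The same cube serves for differentiation in
    [is_derive_conv]. *)
Lemma continuous_conv h k : cont_on T h -> (forall y, `|h y| <= M) ->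
  cont_on T k -> kernel_supp k -> cont_on T (conv h k).
Proof.
move=> ch hM ck ks x _; have [B B0 kB] := bdd_kernel ck ks.
have M0 : 0 <= M by exact: le_trans (hM 0).
apply: continuous_at_seq => u xu.
apply: (Int_dominated openT (fun j => cont_onM ch (cont_kernel (u j) ck))
  (intg_indic_ccube (M * B) x (r + 1)) _ _).2 => [y _|j y _].
  apply: cvgMr; have cu : u j @[j --> \oo] --> x.
    apply/cvg_ballP => e e0; have [N NE] : exists N : nat, N.+1%:R^-1 <= e.
      exists (Num.truncn e^-1); rewrite invf_ple ?posrE ?ltr0n//.
      exact: ltW (truncnS_gt _).
    exists N => // j /= Nj; apply: le_ball (xu j); apply: le_trans NE.
    by rewrite lef_pV2 ?posrE ?ltr0n// ler_nat ltnS.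
  apply: (@cvg_comp _ _ _ u (fun z => k (z - y)) _ _ _ cu).
  exact: (continuous_at_shift (ck _ I)).
rewrite normrM indicE; case: (boolP (y \in ccube x (r + 1))); rewrite ?inE => yx.
  by rewrite mulr1 ler_pM.
rewrite kernel_ccube//; first by rewrite normr0 !mulr0.
move=> yu; move/negP: yx; rewrite inE; apply => i.
rewrite -(subrK (u j ord0 i) (y ord0 i)) -addrA (le_trans (ler_normD _ _))// lerD//.
have [_ /(_ ord0 i)] := xu j; rewrite /ball/= distrC => /ltW/le_trans; apply.
by rewrite invf_le1 ?ltr0n// ler1n.
Qed.

Lemma partial_kernel_supp k i : kernel_supp k -> kernel_supp (partial i k).
Proof.
move=> ks z nz; apply: (@partial_zero _ _ _ (~` cube r)) => //.
exact: open_setC_cube.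
Qed.

Lemma is_derive_conv h k x i : cont_on T h -> (forall y, `|h y| <= M) ->
  C1_on T k -> kernel_supp k ->
  is_derive x (delta_mx ord0 i) (conv h k) (conv h (partial i k) x).
Proof.
move=> ch hM ck ks.
have M0 : 0 <= M by exact: le_trans (hM 0).
have cpk := C1_on_cont_partial (i := i) ck.
have [B B0 kB] := bdd_kernel cpk (partial_kernel_supp i ks).
pose f (t : R) y := h y * k (t *: delta_mx ord0 i + x - y).
have dk t y : is_derive t (1 : R) (fun t => k (t *: delta_mx ord0 i + x - y))
    (partial i k (t *: delta_mx ord0 i + x - y)).
  have := @is_derive_C1_line _ _ T k (x - y) i t ck I.
  by under eq_fun do rewrite addrA; rewrite addrA.
have df t y : is_derive t (1 : R) (f ^~ y) (h y * partial i k (t *: delta_mx ord0 i + x - y)).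
  exact: (is_deriveZ (h y) (dk t y)).
have I0 : (`](-1 : R), 1[%classic : set R) 0 by rewrite /= in_itv/= ltrN10 ltr01.
have p1 t y : partial1of2 f t y = h y * partial i k (t *: delta_mx ord0 i + x - y).
  by rewrite partial1of2E; exact: (@derive_val _ _ _ _ _ _ _ (df t y)).
have Gb t y : (`](-1 : R), 1[%classic : set R) t -> T y ->
    `|partial1of2 f t y| <= M * B * \1_(ccube x (r + 1)) y.
  rewrite /= in_itv/= => t1 _; rewrite p1 normrM indicE.
  case: (boolP (y \in ccube x (r + 1))); rewrite ?inE => yx; first by rewrite mulr1 ler_pM.
  rewrite kernel_ccube//; first by rewrite normr0 !mulr0.
    exact: partial_kernel_supp.
  move=> yu; move/negP: yx; rewrite inE; apply => j.
  have := yu j; rewrite !mxE eqxx /= => H.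
  set d : R := t * (j == i)%:R in H.
  have d1 : `|d| <= 1.
    rewrite /d normrM; case: (j == i); rewrite ?normr1 ?normr0 ?mulr0 ?mulr1//.
    by rewrite ler_norml !ltW//; case/andP: t1.
  rewrite (_ : y ord0 j - x ord0 j = (y ord0 j - (d + x ord0 j)) + d); last by ring.
  by rewrite (le_trans (ler_normD _ _))// lerD.
have intf t : (`](-1 : R), 1[%classic : set R) t -> mu.-integrable T (EFin \o f t).
  by move=> _; exact: (intg_conv (t *: delta_mx ord0 i + x) ch (C1_on_cont ck) ks).
have G0 y : 0 <= M * B * \1_(ccube x (r + 1)) y by rewrite !mulr_ge0// indicE ler0n.
have C := @cvg_differentiation_under_integral R _ _ mu f T measurableT 0 (-1) 1 I0 intf
  (fun t y _ _ => @ex_derive _ _ _ _ _ _ _ (df t y)) _ G0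
  (intg_indic_ccube (M * B) x (r + 1)) Gb.
have E1 t : \int[mu]_(y in T) f t y = conv h k (t *: delta_mx ord0 i + x) by [].
have E2 : \int[mu]_(y in T) partial1of2 f 0 y = conv h (partial i k) x.
  by apply: Int_eq => y _; rewrite p1 scale0r add0r.
rewrite E2 in C.
have {}C : (fun t : R =>
    t^-1 *: (conv h k (t *: delta_mx ord0 i + x) - conv h k x)) @ 0^' --> conv h (partial i k) x.
  have E : (fun t : R => t^-1 *: (conv h k (t *: delta_mx ord0 i + x) - conv h k x)) =
     (fun t : R => t^-1 *: (\int[mu]_(y in T) f (t + 0) y - \int[mu]_(y in T) f 0 y)).
    by apply/funext => t; rewrite !E1 addr0 scale0r add0r.
  by rewrite E; exact: C.
by apply: DeriveDef; [apply/cvg_ex; eexists; exact: C|exact/cvg_lim].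
Qed.

End Convolution.

Section Mollification.
Context {R : realType} {n : nat}.
Local Notation mu := (lebesgue_rV n : {sigma_finite_measure set 'rV[R]_n -> \bar R}).
Local Notation T := [set: 'rV[R]_n].
Implicit Types (h k : 'rV[R]_n -> R) (x y : 'rV[R]_n).

Lemma C1_conv (r M : R) h k : cont_on T h -> (forall y, `|h y| <= M) ->
  C1_on T k -> kernel_supp r k -> C1_on T (conv h k) /\
  forall i, partial i (conv h k) = conv h (partial i k).
Proof.
move=> ch hM ck ks; have D i x := is_derive_conv x i ch hM ck ks.
split.
  refine (@C1_onP _ _ _ _ (fun i => conv h (partial i k)) openT _ (fun i x _ => D i x) _).
    exact: (continuous_conv ch hM (C1_on_cont ck) ks).
  move=> i; exact: (continuous_conv ch hM (C1_on_cont_partial (i := i) ck)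
    (partial_kernel_supp i ks)).
by move=> i; apply/funext => x; exact: (@derive_val _ _ _ _ _ _ _ (D i x)).
Qed.

Lemma smooth_conv (r M : R) h k : cont_on T h -> (forall y, `|h y| <= M) ->
  smooth_on T k -> kernel_supp r k -> smooth_on T (conv h k).
Proof.
move=> ch hM sk ks; apply/smooth_onP => m.
elim: m k sk ks => [|m IH] k sk ks.
  by have [] := C1_conv ch hM (smooth_on_C1 sk) ks.
have [c p] := C1_conv ch hM (smooth_on_C1 sk) ks.
split=> // i; rewrite p; apply: IH; first exact: smooth_on_partial.
exact: partial_kernel_supp.
Qed.

Lemma conv_by_parts (r : R) h k i x : C1_on T h -> C1_on T k -> kernel_supp r k ->
  conv h (partial i k) x = conv (partial i h) k x.
Proof.
move=> ch ck ks.
have cr := C1_on_reflect x ck.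
have z0 y : T y -> ~ ccube x r y -> h y * k (x - y) = 0.
  by move=> _ ny; rewrite (kernel_ccube ks ny) mulr0.
have [_ I0] := Int_partial0 i openT (compact_ccube x r) (@subsetT _ _) (C1_onM openT ch cr) z0.
have i1 := intg_conv x (C1_on_cont_partial (i := i) ch) (C1_on_cont ck) ks.
have i2 := intg_conv x (C1_on_cont ch) (C1_on_cont_partial (i := i) ck) (partial_kernel_supp i ks).
apply/eqP; rewrite eq_sym -subr_eq0 /conv -(IntB openT i1 i2) -[X in _ == X]I0; apply/eqP.
apply: Int_eq => y _.
by rewrite (C1_partialM i ch cr I) (partial_reflect _ _ _ ck) mulrN.
Qed.

Definition kern (r : R) := @bump R n 0 r.
Definition mass (r : R) := conv (fun=> 1) (kern r).
(** The kernel is not normalised; dividing by its total mass as seen from [x] makes this a weighted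
    mean of [h]. *)
Definition mollify (r : R) h x := (mass r x)^-1 * conv h (kern r) x.

Lemma kern_supp r : 0 < r -> kernel_supp r (kern r).
Proof.
move=> r0 z nz; apply/eqP/negPn/negP => /(bump_ccube r0) H; apply: nz => i.
by have := H i; rewrite mxE subr0.
Qed.

Lemma smooth_kern r : smooth_on T (kern r). Proof. exact: smooth_on_bump. Qed.

Let c1 : cont_on T (fun=> 1 : R). Proof. exact: cont_on_cst. Qed.
Let b1 (y : 'rV[R]_n) : `|1 : R| <= 1. Proof. by rewrite normr1. Qed.

Lemma smooth_mass r : 0 < r -> smooth_on T (mass r).
Proof. by move=> r0; exact: (smooth_conv c1 b1 (smooth_kern r) (kern_supp r0)). Qed.

(* Integrating by parts shows that mass r has zero gradient, which makes
   translation invariance of the measure unnecessary. *)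
Lemma partial_mass r i x : 0 < r -> partial i (mass r) x = 0.
Proof.
move=> r0; have ck := smooth_on_C1 (smooth_kern r).
have [_ ->] := C1_conv c1 b1 ck (kern_supp r0).
rewrite (conv_by_parts i x (@C1_on_cst _ _ T 1) ck (kern_supp r0)) /conv.
rewrite (Int_eq (g := fun=> 0)) => [|y _]; last by rewrite partial_cst mul0r.
by rewrite /Rintegral integral0.
Qed.

Lemma mass_gt0 r x : 0 < r -> 0 < mass r x.
Proof.
move=> r0; have ck := C1_on_cont (smooth_on_C1 (smooth_kern r)).
have ic := intg_conv x c1 ck (kern_supp r0).
rewrite lt_neqAle eq_sym; apply/andP; split; last first.
  by apply: Int_ge0 => y _; rewrite mul1r bump_ge0.
apply/eqP => I0.
have : (\int[mu]_(y in T) `|(1 * kern r (x - y))%:E| = 0)%E.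
  rewrite (eq_integral (fun y => (1 * kern r (x - y))%:E)); last first.
    by move=> y _; rewrite gee0_abs// lee_fin mul1r bump_ge0.
  by rewrite Int_EFin//; [rewrite -[LHS]/((mass r x)%:E) I0|exact: openT].
have mk : measurable_fun T (fun y => (1 * kern r (x - y))%:E).
  apply/measurable_EFinP; apply: measurable_continuous; first exact: openT.
  refine (cont_onM c1 (cont_kernel (x := x) ck)).
move/(ae_eq_integral_abs mu measurableT mk) => [N [mN N0 NP]].
pose B := [set y | sqdist x y < r ^+ 2].
have BN : B `<=` N.
  move=> y yB; apply: NP => /= H; have := H I => /eqP; rewrite eqe mul1r => /eqP k0.
  have E : sqdist 0 (x - y) = sqdist x y.
    by apply: eq_bigr => i _; rewrite !mxE subr0 -sqrrN opprB.
  have kB : sqdist 0 (x - y) < r ^+ 2 by rewrite E.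
  by have := bump_gt0 kB; rewrite -/(kern r) k0 ltxx.
have oB : open B by exact: open_sqdist.
have Bx : B x by rewrite /B /= sqdistxx exprn_gt0.
have := lebesgue_rV_open_gt0 oB Bx.
by rewrite -N0 ltNge le_measure ?inE//; exact (measurable_open oB).
Qed.

Lemma smooth_mollify r (M : R) h : 0 < r -> cont_on T h -> (forall y, `|h y| <= M) ->
  smooth_on T (mollify r h).
Proof.
move=> r0 ch hM; apply: (smooth_onM openT).
  apply: (smooth_onV openT) (smooth_mass r0) => x _; exact: mass_gt0.
exact: (smooth_conv ch hM (smooth_kern r) (kern_supp r0)).
Qed.

Lemma partial_mollify r (M : R) h i x : 0 < r -> C1_on T h -> (forall y, `|h y| <= M) ->
  partial i (mollify r h) x = mollify r (partial i h) x.
Proof.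
move=> r0 ch hM; have ck := smooth_on_C1 (smooth_kern r).
have sm := smooth_mass r0; have m0 y : T y -> 0 < mass r y by move=> _; exact: mass_gt0.
have [cc pc] := C1_conv (C1_on_cont ch) hM ck (kern_supp r0).
have E : mollify r h = fun x => mass r x `^ (-1) * conv h (kern r) x.
  by apply/funext => y; rewrite /mollify powR_inv1// ltW// mass_gt0.
rewrite E (C1_partialM i (smooth_on_C1 (smooth_on_powR (-1) openT m0 sm)) cc I).
rewrite (C1_partial_powR i (-1) openT (smooth_on_C1 sm) m0 I) (partial_mass i x r0).
rewrite mulr0 mul0r add0r pc (conv_by_parts i x ch ck (kern_supp r0)) powR_inv1//.
by rewrite ltW// mass_gt0.
Qed.

(** A weighted mean of numbers within [e] of [c] is within [e] of [c]. Convergence follows with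
    [c = h x], boundedness with [c = 0]. *)
Lemma mollify_dist r h x (c e : R) : 0 < r -> cont_on T h ->
  (forall y, ccube x r y -> `|h y - c| <= e) -> `|mollify r h x - c| <= e.
Proof.
move=> r0 ch he; have ck := C1_on_cont (smooth_on_C1 (smooth_kern r)).
have mx := mass_gt0 x r0.
have ih := intg_conv x ch ck (kern_supp r0).
have ic := intg_conv x c1 ck (kern_supp r0).
have e0 : 0 <= e.
  by apply: le_trans (he x _) => // i; rewrite subrr normr0 ltW.
have cE : c = (mass r x)^-1 * (c * mass r x) by rewrite mulrCA mulVf ?mulr1// gt_eqF.
rewrite /mollify [X in _ - X]cE -mulrBr normrM ger0_norm ?invr_ge0 ?(ltW mx)//.
rewrite ler_pdivrMl// /mass /conv -(IntZ c openT ic) -(IntB openT ih (intgZ c openT ic)).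
have iN := intgB openT ih (intgZ c openT ic).
apply: (le_trans (le_normr_Rintegral measurableT iN)).
rewrite mulrC -(IntZ e openT ic).
apply: (Int_le openT (integrable_norm iN) (intgZ e openT ic)) => y _.
rewrite -[leLHS]/(`|h y * kern r (x - y) - c * (1 * kern r (x - y))|).
rewrite mul1r -mulrBl normrM [X in _ * X]ger0_norm ?bump_ge0//.
have [yx|yx] := pselect (ccube x r y); first by rewrite ler_wpM2r ?bump_ge0// he.
by rewrite (kernel_ccube (kern_supp r0) yx) !mulr0.
Qed.

Lemma mollify_cvg h x (r_ : nat -> R) : cont_on T h -> (forall k : nat, 0 < r_ k) ->
  r_ m @[m --> \oo] --> (0 : R) -> mollify (r_ m) h x @[m --> \oo] --> h x.
Proof.
move=> ch r0 cr; apply/cvgrPdist_le => e e0.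
have n1 : nbhs x [set y | `|h x - h y| < e] by have /cvgrPdist_lt/(_ e e0) := ch x I.
have [d d0 dE] := nbhs_ccube n1.
have /cvgrPdist_lt/(_ d d0) := cr; apply: filterS => k.
rewrite sub0r normrN gtr0_norm// => rd; rewrite distrC.
apply: (mollify_dist (r0 k) ch) => y yx; rewrite distrC ltW//; apply: dE => i.
by rewrite (le_trans (yx i))// ltW.
Qed.

Lemma mollify_bounded r (M : R) h x : 0 < r -> cont_on T h -> (forall y, `|h y| <= M) ->
  `|mollify r h x| <= M.
Proof.
move=> r0 ch hM; rewrite -[mollify r h x]subr0; apply: mollify_dist => // y _.
by rewrite subr0.
Qed.

Lemma mollify_eq0 r h x : 0 < r -> (forall y, ccube x r y -> h y = 0) -> mollify r h x = 0.
Proof.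
move=> r0 h0; rewrite /mollify /conv (Int_eq (g := fun=> 0)).
  by rewrite /Rintegral integral0 mulr0.
move=> y _; have [yx|yx] := pselect (ccube x r y); first by rewrite h0// mul0r.
by rewrite (kernel_ccube (kern_supp r0) yx) mulr0.
Qed.

(** A Lebesgue number argument: [K] is covered by finitely many balls of radius [rho p] whose cubes
    of twice the radius lie in [Omega], and [r] is at most each of these radii. *)
Lemma thicken (K Omega : set 'rV[R]_n) : compact K -> K `<=` Omega -> open Omega ->
  exists2 r : R, 0 < r & exists2 K', compact K' /\ K' `<=` Omega &
    forall x y, K y -> ccube x r y -> K' x.
Proof.
move=> cK KO oO.
have /choice[rho rhoP] p : exists r : R, K p -> 0 < r /\ ccube p (r + r) `<=` Omega.
  have [Kp|nKp] := pselect (K p); last by exists 0.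
  have [r r0 rO] := nbhs_ccube (open_nbhs_nbhs (conj oO (KO p Kp))).
  by exists (r / 2) => _; rewrite divr_gt0// -splitr.
have [s [sK Ks]] := bump_cover cK (fun p Kp => (rhoP p Kp).1).
have [r r0 rs] : exists2 r : R, 0 < r & forall p, p \in s -> r <= rho p.
  elim: {Ks} s sK => [|q s IH] sK; first by exists 1.
  have [|r r0 rs] := IH; first by move=> p ps; apply: sK; rewrite in_cons ps orbT.
  have q0 : 0 < rho q by apply: (rhoP q _).1; apply: sK; rewrite mem_head.
  exists (Num.min r (rho q)); first by rewrite lt_min r0.
  move=> p; rewrite in_cons => /orP[/eqP->|/rs pr]; first by rewrite ge_min lexx orbT.
  by rewrite ge_min pr.
exists r => //; exists (\big[setU/set0]_(p <- s | p \in s) ccube p (rho p + rho p)).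
  split; first by apply: bigsetU_compact => p _; exact: compact_ccube.
  rewrite -big_seq -bigcup_seq => x [p /= ps]; exact: (rhoP p (sK p ps)).2.
move=> x y Ky xy; rewrite -big_seq -bigcup_seq.
have [p ps py] := Ks y Ky; exists p => // i.
rewrite -[x ord0 i](subrK (y ord0 i)) -addrA (le_trans (ler_normD _ _))// lerD//.
  by rewrite distrC (le_trans (xy i))// rs.
exact: (sqdist_ccube (rhoP p (sK p ps)).1 py).
Qed.

(** Test fields must be smooth while phi is only C^1. Mollification commutes with [partial], so the
    derivatives of the approximants are means of the derivatives of [phi] and inherit their bounds
    and limits. *)
Lemma smooth_approximation (K Omega : set 'rV[R]_n) phi : compact K -> K `<=` Omega ->
  open Omega -> C1_on T phi -> (forall x, ~ K x -> phi x = 0) ->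
  exists (psi : nat -> 'rV[R]_n -> R) B K', [/\ compact K' /\ K' `<=` Omega,
    (forall k : nat, smooth_on T (psi k)) /\ 0 <= B,
    forall (k : nat) x, ~ K' x -> psi k x = 0,
    forall (k : nat) x, `|psi k x| <= B /\ forall j, `|partial j (psi k) x| <= B &
    forall x, psi m x @[m --> \oo] --> phi x /\
      forall j, partial j (psi m) x @[m --> \oo] --> partial j phi x].
Proof.
move=> cK KO oO cphi phi0.
have [r r0 [K' [cK' K'O] KK']] := thicken cK KO oO.
have p0 j x : ~ K x -> partial j phi x = 0.
  by move=> nK; apply: (@partial_zero _ _ _ (~` K)) => //; exact: compactC.
have bd h : cont_on T h -> (forall x, ~ K x -> h x = 0) ->
    exists2 B : R, 0 <= B & forall x, `|h x| <= B.
  move=> ch h0; have [B B0 HB] := bdd_compact cK ch; exists B => // x.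
  by have [Kx|nK] := pselect (K x); [exact: HB|rewrite h0// normr0].
have [B0 B00 HB0] := bd phi (C1_on_cont cphi) phi0.
have /choice[B HB] j : exists B : R, 0 <= B /\ forall x, `|partial j phi x| <= B.
  by have [B ? ?] := bd _ (C1_on_cont_partial (i := j) cphi) (p0 j); exists B.
have S0 : 0 <= \sum_j B j by apply: sumr_ge0 => j _; have [] := HB j.
pose rk (k : nat) := r / k.+1%:R.
have rk0 (k : nat) : 0 < rk k by rewrite divr_gt0// ltr0n.
have rkr (k : nat) : rk k <= r by rewrite ler_pdivrMr ?ltr0n// ler_peMr ?(ltW r0)// ler1n.
have rkc : rk m @[m --> \oo] --> (0 : R).
  by rewrite -[X in _ --> X](mulr0 r); apply: cvgMr; exact: cvg_harmonic.
exists (fun k : nat => mollify (rk k) phi), (B0 + \sum_j B j), K'; split=> //.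
- by split; [move=> k; exact: (smooth_mollify (rk0 k) (C1_on_cont cphi) HB0)|exact: addr_ge0].
- move=> k x nK'; apply: mollify_eq0 => // y xy; apply: phi0 => Ky; apply: nK'.
  by apply: (KK' x y Ky) => i; rewrite (le_trans (xy i)).
- move=> k x; split.
    by rewrite (le_trans (mollify_bounded _ (rk0 k) (C1_on_cont cphi) HB0))// lerDl.
  move=> j; rewrite (partial_mollify _ _ (rk0 k) cphi HB0).
  apply: (le_trans (mollify_bounded _ (rk0 k) (C1_on_cont_partial cphi) (HB j).2)).
  by rewrite (bigD1 j)//= addrCA lerDl addr_ge0// sumr_ge0// => i _; have [] := HB i.
- move=> x; split; first exact: mollify_cvg (C1_on_cont cphi) rk0 rkc.
  move=> j; have -> : (fun m => partial j (mollify (rk m) phi) x) =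
      fun m => mollify (rk m) (partial j phi) x.
    by apply/funext => m; exact: (partial_mollify _ _ (rk0 m) cphi HB0).
  exact: (mollify_cvg (C1_on_cont_partial (i := j) cphi) rk0 rkc).
Qed.

End Mollification.

(* No differentiability is assumed: the junk value of a directional derivative is 0. *)
Lemma partial_at_min (R : realType) n (f : 'rV[R]_n -> R) i x :
  nbhs x [set y | 0 <= f y] -> f x = 0 -> partial i f x = 0.
Proof.
move=> f0 fx.
have [df|ndf] := pselect (derivable f x (delta_mx ord0 i)); last exact: (dvgP ndf).
have c : h^-1 *: (f (h *: delta_mx ord0 i + x) - f x) @[h --> (0 : R)^'] --> partial i f x by exact: df.
have N0 := nbhs_line (delta_mx ord0 i) f0.
have Nl : \forall h \near (0 : R)^'-, 0 <= f (h *: delta_mx ord0 i + x) by apply: filterS N0.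
have Nr : \forall h \near (0 : R)^'+, 0 <= f (h *: delta_mx ord0 i + x) by apply: filterS N0.
have cr := cvg_dnbhs_at_right c; have cl := cvg_dnbhs_at_left c.
apply/eqP; rewrite eq_le; apply/andP; split.
  rewrite -(cvg_lim _ cl)//; apply: limr_le; first by apply/cvg_ex; eexists; exact: cl.
  near=> h; rewrite fx subr0 /GRing.scale/= mulr_le0_ge0 ?invr_le0//.
  by near: h; exact: Nl.
rewrite -(cvg_lim _ cr)//; apply: limr_ge; first by apply/cvg_ex; eexists; exact: cr.
near=> h; rewrite fx subr0 /GRing.scale/= mulr_ge0 ?invr_ge0//.
by near: h; exact: Nr.
Unshelve. all: by end_near. Qed.

(** * Approximation by normal components of test fields *)

Section C1Convergence.
Context {R : realType} {n : nat} (U K : set 'rV[R]_n).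
Hypotheses (oU : open U).
Implicit Types (f h : 'rV[R]_n -> R).

(** Pointwise convergence to first order with a bound uniform in [k]: precisely what dominated
    convergence in [Q_limit] consumes, and stable under products and finite sums. *)
Definition C1_cvg (f_ : nat -> 'rV[R]_n -> R) f := [/\ forall k, C1_on U (f_ k), C1_on U f,
  forall x, U x -> f_ k x @[k --> \oo] --> f x /\
    forall i, partial i (f_ k) x @[k --> \oo] --> partial i f x &
  exists2 B, 0 <= B & forall k x, U x -> K x ->
    `|f_ k x| <= B /\ forall i, `|partial i (f_ k) x| <= B].

Lemma C1_cvg_cst f : C1_on U f -> bdd (U `&` K) f ->
  (forall i, bdd (U `&` K) (partial i f)) -> C1_cvg (fun=> f) f.
Proof.
move=> cf [B0 B00 HB0] bd; split=> //; first by move=> x _; split=> [|i]; exact: cvg_cst.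
have /choice[B HB] i : exists B : R, 0 <= B /\ forall x, (U `&` K) x -> `|partial i f x| <= B.
  by have [B ? ?] := bd i; exists B.
have S0 : 0 <= \sum_i B i by apply: sumr_ge0 => j _; have [] := HB j.
exists (B0 + \sum_i B i) => [|_ x Ux Kx]; first exact: addr_ge0.
split=> [|i]; first by rewrite (le_trans (HB0 x (conj Ux Kx)))// lerDl.
have [_ /(_ x (conj Ux Kx)) H] := HB i; apply: (le_trans H).
rewrite (bigD1 i)//= addrCA lerDl addr_ge0//.
by apply: sumr_ge0 => k _; have [] := HB k.
Qed.

Lemma C1_cvgM (f_ h_ : nat -> 'rV[R]_n -> R) f h : C1_cvg f_ f -> C1_cvg h_ h ->
  C1_cvg (fun k x => f_ k x * h_ k x) (fun x => f x * h x).
Proof.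
move=> [cf_ cf lf [B B0 HB]] [ch_ ch lh [C C0 HC]]; split.
- by move=> k; exact: (C1_onM oU (cf_ k) (ch_ k)).
- exact: (C1_onM oU cf ch).
- move=> x Ux; have [lf0 lf1] := lf x Ux; have [lh0 lh1] := lh x Ux.
  split=> [|i]; first exact: (cvgM lf0 lh0).
  rewrite (C1_partialM i cf ch Ux).
  have -> : (fun k => partial i (fun x => f_ k x * h_ k x) x) =
      (fun k => partial i (f_ k) x * h_ k x + f_ k x * partial i (h_ k) x).
    by apply/funext => k; exact: (C1_partialM i (cf_ k) (ch_ k) Ux).
  exact: (cvgD (cvgM (lf1 i) lh0) (cvgM lf0 (lh1 i))).
- exists (B * C + B * C) => [|k x Ux Kx]; first by rewrite addr_ge0// mulr_ge0.
  have [HB0 HB1] := HB k x Ux Kx; have [HC0 HC1] := HC k x Ux Kx.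
  split=> [|i]; first by rewrite normrM (le_trans (ler_pM _ _ HB0 HC0))// lerDl mulr_ge0.
  rewrite (C1_partialM i (cf_ k) (ch_ k) Ux) (le_trans (ler_normD _ _))// !normrM.
  by rewrite lerD// ler_pM.
Qed.

Lemma C1_cvg_sum (I : Type) (r : seq I) (F_ : I -> nat -> 'rV[R]_n -> R) F :
  (forall a, C1_cvg (F_ a) (F a)) ->
  C1_cvg (fun k x => \sum_(a <- r) F_ a k x) (fun x => \sum_(a <- r) F a x).
Proof.
move=> H; have cF_ a k : C1_on U (F_ a k) by have [] := H a.
have cF a : C1_on U (F a) by have [] := H a.
have pE k x i : U x -> partial i (fun x => \sum_(a <- r) F_ a k x) x =
    \sum_(a <- r) partial i (F_ a k) x.
  by move=> Ux; exact: (C1_partial_sum r i oU (fun a => cF_ a k) Ux).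
split.
- by move=> k; exact: (C1_on_sum r oU (fun a => cF_ a k)).
- exact: (C1_on_sum r oU cF).
- move=> x Ux; split=> [|i].
    refine (@cvg_seq_sum R I r (fun a k => F_ a k x) (fun a => F a x) _) => a.
    by have [_ _ /(_ x Ux)[]] := H a.
  rewrite (C1_partial_sum r i oU cF Ux).
  have -> : (fun k => partial i (fun x => \sum_(a <- r) F_ a k x) x) =
      (fun k => \sum_(a <- r) partial i (F_ a k) x).
    by apply/funext => k; exact: pE.
  refine (@cvg_seq_sum R I r (fun a k => partial i (F_ a k) x) (fun a => partial i (F a) x) _) => a.
  by have [_ _ /(_ x Ux)[_]] := H a.
- elim: r {pE} => [|a r [B B0 HB]].
    exists 0 => // k x Ux _; split=> [|i]; first by rewrite big_nil normr0.
    by rewrite (C1_partial_sum _ i oU (fun a => cF_ a k) Ux) big_nil normr0.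
  have [_ _ _ [C C0 HC]] := H a; exists (C + B) => [|k x Ux Kx]; first exact: addr_ge0.
  have [HB0 HB1] := HB k x Ux Kx; have [HC0 HC1] := HC k x Ux Kx.
  split=> [|i]; first by rewrite big_cons (le_trans (ler_normD _ _))// lerD.
  rewrite (C1_partial_sum _ i oU (fun a => cF_ a k) Ux) big_cons.
  have := HB1 i; rewrite (C1_partial_sum _ i oU (fun a => cF_ a k) Ux) => HB1i.
  by rewrite (le_trans (ler_normD _ _))// lerD.
Qed.

End C1Convergence.

Lemma smooth_onM_supp (R : realType) n (V C : set 'rV[R]_n) (b f : 'rV[R]_n -> R) :
  open V -> closed C -> C `<=` V -> smooth_on setT b -> smooth_on V f ->
  (forall x, ~ C x -> b x = 0) -> smooth_on setT (fun x => b x * f x).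
Proof.
move=> oV cC CV sb sf b0; apply: smooth_on_local => x _.
have [Cx|nC] := pselect (C x).
  by exists V; [exact: CV|exact: (smooth_onM oV (smooth_on_sub (@subsetT _ _) sb) sf)].
exists (~` C) => //; apply: (@smooth_on_eq _ _ _ (fun=> 0)) (smooth_on_cst _) => [|y /b0 ->].
  exact: closed_openC.
by rewrite mul0r.
Qed.

(* Off V the derivative of f is a junk value, which is multiplied by b = 0. *)
Lemma partialM_supp (R : realType) n (V C : set 'rV[R]_n) (b f : 'rV[R]_n -> R) i x :
  open V -> closed C -> C `<=` V -> C1_on setT b -> C1_on V f ->
  (forall x, ~ C x -> b x = 0) ->
  partial i (fun y => b y * f y) x = partial i b x * f x + b x * partial i f x.
Proof.
move=> oV cC CV cb cf b0; have [Cx|nC] := pselect (C x).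
  exact: (C1_partialM i (C1_on_sub (@subsetT _ _) cb) cf (CV _ Cx)).
have oC : open (~` C) by exact: closed_openC.
rewrite (@partial_zero _ _ b _ i x oC nC b0) (b0 _ nC) !mul0r addr0.
by apply: (@partial_zero _ _ _ (~` C)) => // y /b0 ->; rewrite mul0r.
Qed.

Lemma open_cont_lt (R : realType) n (V : set 'rV[R]_n) f h : open V -> cont_on V f ->
  cont_on V h -> open [set x | V x /\ f x < h x].
Proof.
move=> oV cf ch; rewrite openE => x [Vx fh]; rewrite /interior.
have N1 : nbhs x V by exact: open_nbhs_nbhs.
have c : {for x, continuous (fun y => h y - f y)}.
  exact: (cont_onB ch cf Vx).
have N2 : nbhs x [set y | 0 < h y - f y].
  have hf : 0 < h x - f x by rewrite subr_gt0.
  by exact: (cvgr_gt (h x - f x) c _ hf).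
by apply: filterS2 N1 N2 => y Vy /=; rewrite subr_gt0.
Qed.

Lemma cvg_push (R : realType) n (f : 'rV[R]_n -> R) x e (t_ : nat -> R) :
  {for x, continuous f} -> t_ k @[k --> \oo] --> (0 : R) ->
  f (x + t_ k *: e) @[k --> \oo] --> f x.
Proof.
move=> cf ct; apply/cvgrPdist_lt => d d0.
have N : nbhs x [set y | `|f x - f y| < d] by have /cvgrPdist_lt/(_ d d0) := cf.
have N0 : nbhs (0 : R) [set h | `|f x - f (h *: e + x)| < d] by exact: nbhs_line N.
have Nk : \forall k \near \oo, `|f x - f (t_ k *: e + x)| < d by exact: (ct _ N0).
by apply: filterS Nk => k; rewrite [x + _]addrC.
Qed.

Section Push.
Context {R : realType} {n : nat}.
Variables (Omega : set 'rV[R]_n) (v : 'rV[R]_n -> R) (alpha : R).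
Local Notation U := (positivity_set Omega v).
Local Notation g i := (partial i v).
Hypothesis oO : open Omega.
Hypothesis v_ge0 : forall x, Omega x -> 0 <= v x.
Hypothesis v_smooth : smooth_up_to_boundary U Omega v.
Hypothesis alpha_gt0 : 0 < alpha.
Hypothesis gsq_gt0 : forall x, U x -> 0 < gsq v x.
Hypothesis pde_v : forall x, U x -> v x * lap v x = alpha / 2 * (1 - gsq v x).

Let oU : open U. Proof. by case: v_smooth. Qed.
Let sv : smooth_on U v. Proof. by case: v_smooth. Qed.
Let cv : cont_on Omega v := v_continuous oO v_ge0 v_smooth.

(** Scaled not to unit length but so that its product with grad v is 1. *)
Definition normal j x : R := (gsq v x)^-1 * g j x.
(** Zero where v <= d, hence smooth on all of [Omega], and equal to [normal] where v >= 2 d in the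
    positivity set. *)
Definition cut_normal (d : R) j x := step (v x / d) * normal j x.

Lemma smooth_normal j : smooth_on U (normal j).
Proof. exact: (smooth_onM oU (smooth_onV oU gsq_gt0 (smooth_gsq oU sv)) (smooth_g sv j)). Qed.

Lemma bdd_normal j K : compact K -> K `<=` Omega -> bdd (U `&` K) (normal j).
Proof.
move=> cK KO; have [c c0 HB] := gsq_lower_bound v_ge0 v_smooth alpha_gt0 gsq_gt0 pde_v cK KO.
apply: bddM; last exact: (bdd_g v_smooth j cK KO).
by apply: (bdd_inv c0) => x [Ux Kx]; exact: HB.
Qed.

Lemma bdd_partial_normal i j K : compact K -> K `<=` Omega ->
  bdd (U `&` K) (partial i (normal j)).
Proof.
move=> cK KO; have [c c0 HB] := gsq_lower_bound v_ge0 v_smooth alpha_gt0 gsq_gt0 pde_v cK KO.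
have iE x : U x -> (gsq v x)^-1 = gsq v x `^ (-1).
  by move=> Ux; rewrite powR_inv1// ltW// gsq_gt0.
have sg := smooth_on_C1 (smooth_gsq oU sv).
have sV := smooth_on_C1 (smooth_onV oU gsq_gt0 (smooth_gsq oU sv)).
apply: (@bdd_eq _ _ _ (fun x => - ((gsq v x)^-1 * (gsq v x)^-1 * (2 * \sum_k g k x * partial i (g k) x))
    * g j x + (gsq v x)^-1 * partial i (g j) x)).
  move=> x [Ux _]; rewrite (C1_partialM i sV (smooth_on_C1 (smooth_g sv j)) Ux).
  congr (_ * _ + _).
  have N : nbhs x [set y | (gsq v y)^-1 = gsq v y `^ (-1)].
    by apply: filterS (open_nbhs_nbhs (conj oU Ux)) => y; exact: iE.
  rewrite (partial_near i N) (C1_partial_powR i (-1) oU sg gsq_gt0 Ux).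
  rewrite (partial_gsq oU sv i Ux) powRD; last by rewrite (gt_eqF (gsq_gt0 Ux)) implybT.
  by rewrite -(iE x Ux) mulN1r mulNr.
have bI : bdd (U `&` K) (fun x => (gsq v x)^-1) by apply: (bdd_inv c0) => x [Ux Kx]; exact: HB.
apply: bddD.
  apply: bddM; last exact: (bdd_g v_smooth j cK KO).
  apply: bddN; apply: bddM; first exact: bddM.
  apply: bddM; first exact: bdd_cst.
  apply: bdd_sum => k; apply: bddM; [exact: (bdd_g v_smooth k cK KO)|exact: (bdd_H v_smooth k i cK KO)].
apply: bddM => //; exact: (bdd_H v_smooth j i cK KO).
Qed.

Lemma smooth_cut_normal d j : 0 < d -> smooth_on Omega (cut_normal d j).
Proof.
move=> d0; apply: smooth_on_local => x Ox.
have [Ux|nUx] := pselect (U x).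
  exists U => //; apply: (smooth_onM oU) (smooth_normal j); apply: (smooth_on_step oU).
  exact: (smooth_onM oU sv (smooth_on_cst (U := U) d^-1)).
exists [set y | Omega y /\ v y < d]; first by split=> //; rewrite (v_eq0 v_ge0 Ox nUx).
apply: (@smooth_on_eq _ _ _ (fun=> 0)) (smooth_on_cst _) => [|y [_ yd]].
  exact: (open_cont_lt oO cv (cont_on_cst (c := d))).
by rewrite /cut_normal step_eq0 ?mul0r// ler_pdivrMr// mul1r ltW.
Qed.

Lemma cut_normalE d j x : 0 < d -> U x -> 2 * d < v x ->
  nbhs x [set y | cut_normal d j y = normal j y].
Proof.
move=> d0 [Ox _] dv.
have O : open [set y | Omega y /\ 2 * d < v y].
  exact: (open_cont_lt oO (cont_on_cst (c := 2 * d)) cv).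
apply: filterS (open_nbhs_nbhs (conj O (conj Ox dv))) => y [_ yd].
by rewrite /= /cut_normal step_eq1 ?mul1r// ler_pdivlMr// ltW.
Qed.

Section OnePoint.
Variables (p : 'rV[R]_n) (r : R) (e : 'rV[R]_n) (c t0 : R) (K : set 'rV[R]_n).
Hypothesis H : pushes_inside Omega v p r e c t0 K.
Local Notation b := (bump p r).

(** The level c t / 3 lies strictly below half of the height c t that [v] reaches at pushed points.
    At those points the cutoff equals 1 on a neighbourhood, so it changes neither values nor
    derivatives there. *)
Definition pushed t j x := b x * cut_normal (c * t / 3) j (x + t *: e).

Let bK t x : 0 < t < t0 -> ~ K (x + t *: e) -> b x = 0.
Proof.
move=> /andP[t1 t2] nK; apply/eqP/negPn/negP => /bump_neq0 bx; apply: nK.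
have [_ [_ [HK _]]] := H; apply: HK => //.
by rewrite ltW.
Qed.

Let d0 t : 0 < t < t0 -> 0 < c * t / 3.
Proof.
move=> /andP[t1 _]; have [[_ c0 _ _] _] := H.
by rewrite divr_gt0// mulr_gt0.
Qed.

Let oV t : open [set x | Omega (x + t *: e)].
Proof.
rewrite openE => x Ox; rewrite /interior.
have cs : {for x, continuous (fun y : 'rV[R]_n => y + t *: e)}.
  by apply: (@continuousD _ _ _ id (cst (t *: e))); [exact: id|exact: cst_continuous].
by have := cs _ (open_nbhs_nbhs (conj oO Ox)).
Qed.

Let cC t : closed [set x | K (x + t *: e)].
Proof.
have [[_ _ _ cK] _] := H.
apply: (@closed_comp _ _ (fun y : 'rV[R]_n => y + t *: e)).
  move=> x _; apply: (@continuousD _ _ _ id (cst (t *: e))); [exact: id|exact: cst_continuous].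
by move: (compactC cK); rewrite openC.
Qed.

Let CV t : 0 < t < t0 -> [set x | K (x + t *: e)] `<=` [set x | Omega (x + t *: e)].
Proof. by move=> _ x; have [_ [KO _]] := H; exact: KO. Qed.

Let sb : smooth_on setT b := smooth_on_bump p r.

Lemma smooth_pushed t j : 0 < t < t0 -> smooth_on setT (pushed t j).
Proof.
move=> t1; apply: (@smooth_onM_supp _ _ _ _ b (fun x => cut_normal (c * t / 3) j (x + t *: e))
  (@oV t) (@cC t) (CV t1) sb _ (fun x => @bK t x t1)).
exact: (smooth_on_shift (smooth_cut_normal j (d0 t1))).
Qed.

Let pushed_cases t j x : 0 < t < t0 -> U x ->
  (b x = 0 /\ forall i, partial i b x = 0) \/
  [/\ U (x + t *: e), K (x + t *: e), cut_normal (c * t / 3) j (x + t *: e) = normal j (x + t *: e)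
    & forall i, partial i (cut_normal (c * t / 3) j) (x + t *: e) = partial i (normal j) (x + t *: e)].
Proof.
move=> t1 Ux; have [b0|bn] := eqVneq (b x) 0; [left|right].
  (* The bump is nonnegative, so where it vanishes it has a minimum and its derivatives vanish
     too. *)
  split=> // i; apply: partial_at_min => //.
  by apply: filterE => y; exact: bump_ge0.
have bx := bump_neq0 bn; have [[_ c0 _ _] [_ [HK HU]]] := H.
have [Ut vt] := HU x t Ux bx t1.
have E : 2 * (c * t / 3) < v (x + t *: e).
  have : 0 < c * t by case/andP: t1 => t1 _; rewrite mulr_gt0.
  by move: (c * t) vt => w; lra.
have N := cut_normalE j (d0 t1) Ut E.
split=> //; last by move=> i; exact: partial_near.
  by case/andP: t1 => t1 t2; apply: HK => //; rewrite t2 ltW.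
exact: (nbhs_singleton N).
Qed.

Lemma partial_pushed t j i x : 0 < t < t0 ->
  partial i (pushed t j) x = partial i b x * cut_normal (c * t / 3) j (x + t *: e) +
    b x * partial i (cut_normal (c * t / 3) j) (x + t *: e).
Proof.
move=> t1; rewrite -partial_shift.
apply: (@partialM_supp _ _ _ _ b (fun x => cut_normal (c * t / 3) j (x + t *: e)) i x
  (@oV t) (@cC t) (CV t1) (smooth_on_C1 sb) _ (fun x => @bK t x t1)).
exact: (smooth_on_C1 (smooth_on_shift (smooth_cut_normal j (d0 t1)))).
Qed.

(** The derivatives of the cutoff are of size 1 / t, but no point of the positivity set sees them:
    there either the bump is 0 to first order, or the pushed point lies in [U] and [K] with [normal]
    in place of [cut_normal]. The bounds on [normal] and its derivatives over [K] are therefore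
    uniform in [k]. *)
Lemma C1_cvg_pushed (t_ : nat -> R) A j : (forall k, 0 < t_ k < t0) ->
  t_ k @[k --> \oo] --> (0 : R) -> compact A ->
  C1_cvg U A (fun k => pushed (t_ k) j) (fun x => b x * normal j x).
Proof.
move=> t1 ct cA; have cb := smooth_on_C1 sb.
have cn := smooth_on_C1 (smooth_normal j).
have cbU : C1_on U b by exact: (C1_on_sub (@subsetT _ _) cb).
have pE k x : U x -> pushed (t_ k) j x = b x * normal j (x + t_ k *: e).
  move=> Ux; rewrite /pushed; have [[-> _]|[_ _ -> _]//] := pushed_cases j (t1 k) Ux.
  by rewrite !mul0r.
have dE k x i : U x -> partial i (pushed (t_ k) j) x =
    partial i b x * normal j (x + t_ k *: e) + b x * partial i (normal j) (x + t_ k *: e).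
  move=> Ux; rewrite (partial_pushed j i x (t1 k)).
  have [[-> /(_ i) ->]|[_ _ -> /(_ i) ->]//] := pushed_cases j (t1 k) Ux.
  by rewrite !mul0r.
split.
- by move=> k; exact: (C1_on_sub (@subsetT _ _) (smooth_on_C1 (smooth_pushed j (t1 k)))).
- exact: (C1_onM oU cbU cn).
- move=> x Ux.
  have c0 := cvg_push e (C1_on_continuous cn Ux) ct.
  have c1 i := cvg_push e (C1_on_partial i cn Ux) ct.
  split=> [|i].
    have -> : (fun k => pushed (t_ k) j x) = (fun k => b x * normal j (x + t_ k *: e)).
      by apply/funext => k; exact: pE.
    by apply: cvgMr.
  rewrite (C1_partialM i cbU cn Ux).
  have -> : (fun k => partial i (pushed (t_ k) j) x) = (fun k =>
      partial i b x * normal j (x + t_ k *: e) + b x * partial i (normal j) (x + t_ k *: e)).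
    by apply/funext => k; exact: dE.
  exact: (cvgD (cvgM (cvg_cst (partial i b x)) c0) (cvgM (cvg_cst (b x)) (c1 i))).
- have [[_ _ _ cK] [KO _]] := H.
  have [B B0 HB] := bdd_normal j cK KO.
  have /choice[C HC] i : exists C : R, 0 <= C /\ forall x, (U `&` K) x -> `|partial i (normal j) x| <= C.
    by have [C ? ?] := bdd_partial_normal i j cK KO; exists C.
  have [D D0 HD] := bdd_compact cA (C1_on_cont cb).
  have /choice[E HE] i : exists E : R, 0 <= E /\ forall x, A x -> `|partial i b x| <= E.
    by have [E ? ?] := bdd_compact cA (C1_on_cont_partial (i := i) cb); exists E.
  have M0 i : 0 <= E i * B + D * C i.
    by rewrite addr_ge0// mulr_ge0//; [have [] := HE i|have [] := HC i].
  have S0 : 0 <= \sum_i (E i * B + D * C i) by apply: sumr_ge0.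
  exists (D * B + \sum_i (E i * B + D * C i)) => [|k x Ux Ax].
    by rewrite addr_ge0// mulr_ge0.
  have [[b0 db0]|[Ut Kt nE dnE]] := pushed_cases j (t1 k) Ux.
    split=> [|i]; first by rewrite (pE k x Ux) b0 mul0r normr0 addr_ge0// mulr_ge0.
    by rewrite (dE k x i Ux) b0 db0 !mul0r addr0 normr0 addr_ge0// mulr_ge0.
  split=> [|i].
    rewrite (pE k x Ux) normrM (le_trans (ler_pM _ _ (HD x Ax) (HB _ (conj Ut Kt))))//.
    by rewrite lerDl.
  have [E0 /(_ x Ax) hE] := HE i; have [C0 /(_ _ (conj Ut Kt)) hC] := HC i.
  rewrite (dE k x i Ux) (le_trans (ler_normD _ _))// (normrM (partial i b x)) (normrM (b x)).
  refine (le_trans (lerD (ler_pM (normr_ge0 _) (normr_ge0 _) hE (HB _ (conj Ut Kt)))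
    (ler_pM (normr_ge0 _) (normr_ge0 _) (HD x Ax) hC)) _).
  rewrite (bigD1 i)//= addrCA lerDl addr_ge0// ?mulr_ge0//.
  by apply: sumr_ge0.
Qed.

End OnePoint.

End Push.

Lemma C1_cvg_eq (R : realType) n (U K : set 'rV[R]_n) (f_ : nat -> 'rV[R]_n -> R) f h :
  open U -> (forall x, U x -> f x = h x) -> C1_cvg U K f_ f -> C1_cvg U K f_ h.
Proof.
move=> oU fh [cf_ cf lf Bf].
refine (And4 cf_ (C1_on_eq oU fh cf) _ Bf) => x Ux; have [l0 l1] := lf x Ux.
rewrite -(fh x Ux); split=> [|i]; first exact: l0.
by rewrite -(partial_near i (open_near_eq oU Ux fh)).
Qed.

Section Stability.
Context {R : realType} {n : nat}.
Variables (Omega : set 'rV[R]_n) (v : 'rV[R]_n -> R) (alpha : R).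
Local Notation U := (positivity_set Omega v).
Local Notation g i := (partial i v).
Local Notation mu := (lebesgue_rV n : {sigma_finite_measure set 'rV[R]_n -> \bar R}).
Local Notation Int U f := (\int[mu]_(x in U) f x)%R.
Hypothesis oO : open Omega.
Hypothesis v_ge0 : forall x, Omega x -> 0 <= v x.
Hypothesis v_smooth : smooth_up_to_boundary U Omega v.
Hypothesis alpha_gt0 : 0 < alpha.
Hypothesis gsq_gt0 : forall x, U x -> 0 < gsq v x.
Hypothesis pde_v : forall x, U x -> v x * lap v x = alpha / 2 * (1 - gsq v x).
Hypothesis stable : forall (F : 'I_n -> 'rV[R]_n -> R) (K : set 'rV[R]_n),
  (forall i, smooth_on setT (F i)) -> compact K -> K `<=` Omega ->
  (forall i x, ~ K x -> F i x = 0) -> 0 <= Int U (second_density v alpha F).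

Let oU : open U. Proof. by case: v_smooth. Qed.
Let sv : smooth_on U v. Proof. by case: v_smooth. Qed.

Lemma normal_sum x : U x -> \sum_j g j x * normal v j x = 1.
Proof.
move=> Ux; rewrite (eq_bigr (fun j => (gsq v x)^-1 * g j x ^+ 2)).
  by rewrite -mulr_sumr mulVf// gt_eqF// gsq_gt0.
by move=> j _; rewrite /normal mulrCA.
Qed.

Lemma controlled_of_cvg K (f_ : nat -> 'rV[R]_n -> R) f : compact K ->
  C1_cvg U K f_ f -> (forall k x, U x -> ~ K x -> f_ k x = 0) ->
  exists2 B, 0 <= B & forall k, controlled Omega v K B (f_ k).
Proof.
move=> cK [cf_ _ _ [B B0 HB]] f0; exists B => // k.
have p0 j x : U x -> ~ K x -> partial j (f_ k) x = 0.
  move=> Ux nK; have oUK : open (U `&` ~` K) by apply: openI => //; exact: compactC.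
  by apply: (@partial_zero _ _ _ _ j x oUK) => // y [Uy Ky]; exact: f0.
split=> // [x|x Ux|j x Ux]; first exact: f0.
- have [Kx|nK] := pselect (K x); first exact: (HB k x Ux Kx).1.
  by rewrite f0// normr0.
- have [Kx|nK] := pselect (K x); first exact: (HB k x Ux Kx).2.
  by rewrite p0// normr0.
Qed.

Variables (phi : 'rV[R]_n -> R) (K : set 'rV[R]_n).
Hypothesis cphi : C1_on setT phi.
Hypothesis cK : compact K.
Hypothesis KO : K `<=` Omega.
Hypothesis phi0 : forall x, ~ K x -> phi x = 0.

Let cphiU : C1_on U phi := C1_on_sub (@subsetT _ _) cphi.

Lemma intg_Q_test : intg U (Q_grad v alpha phi) /\ intg U (Q_pot v alpha phi).
Proof.
have KI : U `&` K `<=` K by move=> x [].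
have [B B0 cB] := controlled_exists v_smooth cphiU (fun x _ => @phi0 x) cK
  (bdd_sub KI (bdd_compact cK (C1_on_cont cphi)))
  (fun j => bdd_sub KI (bdd_compact cK (C1_on_cont_partial (i := j) cphi))).
exact: (intg_Q oO v_ge0 v_smooth alpha_gt0 gsq_gt0 pde_v cK KO B0 cB).
Qed.

(* The test fields are psi_k * sum_p b_p N(. + t_k e_p), where psi_k mollifies
   phi / sum_p b_p and N = grad v / |grad v|^2. The inward shifts push the
   support of N's argument off the free boundary, where N is not smooth, and
   grad v . N = 1 makes the normal component converge to phi. *)
Theorem Q_stable : alpha / 2 * Int U (Q_pot v alpha phi) <= Int U (Q_grad v alpha phi).
Proof.
have /choice[r rP] p : exists r : R, Omega p ->
    exists e c t0 L, pushes_inside Omega v p r e c t0 L.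
  have [Op|nO] := pselect (Omega p); last by exists 0.
  have [r H] := push_inside oO v_ge0 v_smooth alpha_gt0 gsq_gt0 pde_v Op.
  by exists r.
have r0 p : K p -> 0 < r p.
  by move=> /KO/rP[e [c [t0 [L [[]]]]]].
have [s [sK sc]] := bump_cover cK r0.
pose q (a : 'I_(size s)) := nth 0 s a.
have qs a : q a \in s by rewrite mem_nth.
have /choice[e eP] a := rP (q a) (KO (sK _ (qs a))).
have /choice[c cP] a := eP a.
have /choice[t0 tP] a := cP a.
have /choice[L LP] a := tP a.
pose b a := bump (q a) (r (q a)).
have sb a : smooth_on setT (b a) by exact: smooth_on_bump.
pose P x := \sum_a b a x.
have sP : smooth_on setT P by exact: (smooth_on_sum _ openT sb).
have P0 x : K x -> 0 < P x.
  move=> Kx; have [p ps px] := sc x Kx.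
  have ps' : (index p s < size s)%N by rewrite index_mem.
  rewrite /P (bigD1 (Ordinal ps'))//= ltr_pwDl//.
    by rewrite /b /q /= nth_index// bump_gt0.
  by apply: sumr_ge0 => a _; exact: bump_ge0.
(* Dividing by [P] turns the bumps into a partition of unity on [K]. Where [P] may vanish, outside
   [K], [chi] is 0 because [phi] is. *)
pose chi x := phi x * (P x)^-1.
have chi0 x : ~ K x -> chi x = 0 by move=> nK; rewrite /chi phi0// mul0r.
have cchi : C1_on setT chi.
  apply: C1_on_local => x _; have [Kx|nK] := pselect (K x); last first.
    exists (~` K) => //; apply: (@C1_on_eq _ _ _ (fun=> 0)) (@C1_on_cst _ _ _ 0); last first.
      by move=> y nKy; rewrite chi0.
    exact: compactC.
  exists [set y | setT y /\ 0 < P y]; first by split=> //; exact: P0.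
  have oW : open [set y | [set: 'rV[R]_n] y /\ 0 < P y].
    exact: (open_cont_lt openT (cont_on_cst (c := 0)) (C1_on_cont (smooth_on_C1 sP))).
  apply: (C1_onM oW (C1_on_sub (@subsetT _ _) cphi)); apply: smooth_on_C1.
  by apply: (smooth_onV oW _ (smooth_on_sub (@subsetT _ _) sP)) => y [].
have [psi [B [K' [[cK' K'O] [spsi B0] psi0 psiB psic]]]] :=
  smooth_approximation cK KO oO cchi chi0.
(* With [k.+2] the shift is strictly smaller than [t0 a] already at k = 0. *)
pose t_ a (k : nat) := t0 a / k.+2%:R.
have t0P a : 0 < t0 a by have [[]] := LP a.
have t1 a k : 0 < t_ a k < t0 a.
  rewrite divr_gt0// ?ltr0n//= ltr_pdivrMr ?ltr0n// ltr_pMr//.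
  by rewrite ltr1n.
have tc a : t_ a k @[k --> \oo] --> (0 : R).
  have h : (k.+2%:R^-1 : R) @[k --> \oo] --> (0 : R).
    have := @cvg_harmonic R; rewrite -(cvg_shiftn 1).
    by under [X in X @ _ --> _ -> _]eq_fun do rewrite /harmonic addn1.
  by rewrite -[X in _ --> X](mulr0 (t0 a)); exact: (cvgM (cvg_cst (t0 a)) h).
pose F k j x := psi k x * \sum_a pushed v (q a) (r (q a)) (e a) (c a) (t_ a k) j x.
have sF k j : smooth_on setT (F k j).
  apply: (smooth_onM openT (spsi k)); apply: (smooth_on_sum _ openT) => a.
  exact: (smooth_pushed oO v_ge0 v_smooth gsq_gt0 (LP a) j (t1 a k)).
have F0 k j x : ~ K' x -> F k j x = 0 by move=> nK; rewrite /F psi0// mul0r.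
have cvF : C1_cvg U K' (fun k => gF v (F k))
    (fun x => \sum_j g j x * (chi x * \sum_a b a x * normal v j x)).
  refine (C1_cvg_sum oU _ (F_ := fun j k x => g j x * F k j x)
    (F := fun j x => g j x * (chi x * \sum_a b a x * normal v j x)) _) => j.
  apply: (C1_cvgM oU (f_ := fun=> g j)).
    apply: (C1_cvg_cst (smooth_on_C1 (smooth_g sv j)) (bdd_g v_smooth j cK' K'O)) => i.
    exact: (bdd_H v_smooth j i cK' K'O).
  apply: (C1_cvgM oU (f_ := psi)).
    split.
    - by move=> k; exact: (C1_on_sub (@subsetT _ _) (smooth_on_C1 (spsi k))).
    - exact: (C1_on_sub (@subsetT _ _) cchi).
    - by move=> x _; exact: psic.
    - by exists B => // k x _ _; exact: psiB.
  refine (C1_cvg_sum oU _ (F_ := fun a k => pushed v (q a) (r (q a)) (e a) (c a) (t_ a k) j)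
    (F := fun a x => b a x * normal v j x) _) => a.
  exact: (C1_cvg_pushed oO v_ge0 v_smooth alpha_gt0 gsq_gt0 pde_v (LP a) j (t1 a) (tc a) cK').
have E x : U x -> \sum_j g j x * (chi x * \sum_a b a x * normal v j x) = phi x.
  move=> Ux; transitivity (chi x * P x).
    rewrite -[RHS]mulr1 -(normal_sum Ux) mulr_sumr; apply: eq_bigr => j _.
    by rewrite -mulr_suml -/(P x); move: (P x) (chi x) (g j x) (normal v j x) => ? ? ? ?; ring.
  have [Kx|nK] := pselect (K x); last by rewrite chi0// phi0// mul0r.
  by rewrite /chi mulfVK// gt_eqF// P0.
have [_ _ lphi _] := C1_cvg_eq oU E cvF.
have gF0 k x : U x -> ~ K' x -> gF v (F k) x = 0.
  by move=> _ nK; rewrite /gF big1// => j _; rewrite F0// mulr0.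
have [C C0 HC] := controlled_of_cvg cK' cvF gF0.
apply: (Q_limit oO v_ge0 v_smooth alpha_gt0 gsq_gt0 pde_v cK' K'O C0 HC).
- by move=> x /lphi[].
- by move=> j x /lphi[_ /(_ j)].
- move=> k; rewrite -subr_ge0.
  have [_ <-] := second_variation_Q oO v_ge0 v_smooth alpha_gt0 gsq_gt0 pde_v (sF k) cK' K'O (F0 k).
  exact: (stable (sF k) cK' K'O (F0 k)).
Qed.

End Stability.

Section ContinuousBounded.
Context {R : realType} {n : nat} (U A : set 'rV[R]_n).
Implicit Types a b : 'rV[R]_n -> R.

Definition cont_bdd a := cont_on U a /\ bdd A a.

Lemma cont_bdd_cst c : cont_bdd (fun=> c).
Proof. by split; [exact: cont_on_cst|exact: bdd_cst]. Qed.

Lemma cont_bddD a b : cont_bdd a -> cont_bdd b -> cont_bdd (fun x => a x + b x).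
Proof. by move=> [ca ba] [cb bb]; split; [exact: cont_onD|exact: bddD]. Qed.

Lemma cont_bddB a b : cont_bdd a -> cont_bdd b -> cont_bdd (fun x => a x - b x).
Proof. by move=> [ca ba] [cb bb]; split; [exact: cont_onB|exact: bddB]. Qed.

Lemma cont_bddM a b : cont_bdd a -> cont_bdd b -> cont_bdd (fun x => a x * b x).
Proof. by move=> [ca ba] [cb bb]; split; [exact: cont_onM|exact: bddM]. Qed.

Lemma cont_bdd_sum (I : Type) (r : seq I) (F : I -> 'rV[R]_n -> R) :
  (forall i, cont_bdd (F i)) -> cont_bdd (fun x => \sum_(i <- r) F i x).
Proof.
move=> H; split; first by apply: cont_on_sum => i; have [] := H i.
by apply: bdd_sum => i; have [] := H i.
Qed.

End ContinuousBounded.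

(** * Integrability of the separate terms of the variations *)

Section VariationDensities.
Context {R : realType} {n : nat}.
Variables (Omega : set 'rV[R]_n) (v : 'rV[R]_n -> R) (alpha : R).
Local Notation U := (positivity_set Omega v).
Local Notation g i := (partial i v).
Local Notation f := (fun x => v x `^ alpha).
Hypothesis v_smooth : smooth_up_to_boundary U Omega v.
Hypothesis alpha_gt0 : 0 < alpha.
Variables (F : 'I_n -> 'rV[R]_n -> R) (K : set 'rV[R]_n).
Hypothesis sF : forall i, smooth_on setT (F i).
Hypothesis cK : compact K.
Hypothesis KO : K `<=` Omega.
Hypothesis F0 : forall i x, ~ K x -> F i x = 0.
Local Notation D i j := (partial j (F i)).
Local Notation good := (cont_bdd U (U `&` K)).

Let oU : open U. Proof. by case: v_smooth. Qed.
Let sv : smooth_on U v. Proof. by case: v_smooth. Qed.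
Let v_gt0 x : U x -> 0 < v x. Proof. by case. Qed.

Let D0 i j x : ~ K x -> D i j x = 0.
Proof.
move=> nK; apply: (@partial_zero _ _ _ (~` K)) => //; first exact: compactC.
by move=> y; exact: F0.
Qed.

Let good_D i j : good (D i j).
Proof.
have cD : cont_on setT (D i j) by exact: (C1_on_cont_partial (smooth_on_C1 (sF i))).
split; first by move=> x _; exact: cD.
by apply: (@bdd_sub _ _ K); [move=> x []|exact: (bdd_compact cK cD)].
Qed.

Let good_g i : good (g i).
Proof.
by split; [exact: (C1_on_cont (smooth_on_C1 (smooth_g sv i)))|exact: (bdd_g v_smooth i cK KO)]. Qed.

Let good_f : good f.
Proof.
split; last exact: (bdd_pow v_smooth alpha_gt0 cK KO).
exact: (C1_on_cont (smooth_on_C1 (smooth_pow oU v_gt0 sv alpha))).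
Qed.

Let good_gsq1 : good (fun x => gsq v x + 1).
Proof. by apply: cont_bddD (cont_bdd_cst _ _ 1); apply: cont_bdd_sum => i; exact: cont_bddM. Qed.

Let good_divF : good (divF F). Proof. by apply: cont_bdd_sum => i; exact: good_D. Qed.

Let good_Dg i : good (Dg v F i).
Proof. by apply: cont_bdd_sum => j; exact: (cont_bddM (good_D i j) (good_g j)). Qed.

Let good_kk : good (kk v F).
Proof. by apply: cont_bdd_sum => i; exact: (cont_bddM (good_g i) (good_Dg i)). Qed.

Let intg_good a : good a -> (forall x, ~ K x -> a x = 0) -> intg U a.
Proof. by move=> [ca ba] a0; apply: (intg_bdd oU ca cK ba) => x _; exact: a0. Qed.

Let kk0 x : ~ K x -> kk v F x = 0.
Proof.
move=> nK; rewrite /kk big1// => i _; rewrite /Dg big1 ?mulr0// => j _.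
by rewrite (D0 _ _ nK) mul0r.
Qed.

Let divF0 x : ~ K x -> divF F x = 0.
Proof. by move=> nK; rewrite /divF big1// => i _; exact: D0. Qed.

(** The variations are sums of separate integrals with values in the extended reals. Each term must
    be integrable by itself before they can be merged into [first_density] or [second_density]. *)
Definition energy_term x := f x * ((gsq v x + 1) * divF F x).
Definition gradient_term x := f x * kk v F x.
Definition energy_term2 x := f x * ((gsq v x + 1) * ((divF F x ^+ 2 - trD2 F x) / 2)).
Definition norm_term2 x := f x * w2 v F x.
Definition gradient_term2 x := f x * (2 * zz v F x - 2 * (kk v F x * divF F x)).

Lemma intg_energy_term : intg U energy_term.
Proof.
apply: intg_good => [|x nK]; last by rewrite /energy_term divF0// !mulr0.
exact: (cont_bddM good_f (cont_bddM good_gsq1 good_divF)).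
Qed.

Lemma intg_gradient_term : intg U gradient_term.
Proof.
apply: intg_good => [|x nK]; last by rewrite /gradient_term kk0// !mulr0.
exact: (cont_bddM good_f good_kk).
Qed.

Lemma intg_energy_term2 : intg U energy_term2.
Proof.
apply: intg_good => [|x nK].
  apply: (cont_bddM good_f (cont_bddM good_gsq1 _)); apply: cont_bddM (cont_bdd_cst _ _ 2^-1).
  apply: (cont_bddB (cont_bddM good_divF good_divF)).
  by apply: cont_bdd_sum => i; apply: cont_bdd_sum => j; exact: (cont_bddM (good_D i j) (good_D j i)).
rewrite /energy_term2 divF0// (_ : trD2 F x = 0) ?expr0n ?subrr ?mul0r ?mulr0//.
by rewrite /trD2 big1// => i _; rewrite big1// => j _; rewrite (D0 _ _ nK) mul0r.
Qed.

Lemma intg_norm_term2 : intg U norm_term2.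
Proof.
have gW j : good (fun x => \sum_i D i j x * g i x).
  by apply: cont_bdd_sum => i; exact: (cont_bddM (good_D i j) (good_g i)).
apply: intg_good => [|x nK].
  by apply: (cont_bddM good_f); apply: cont_bdd_sum => j; exact: (cont_bddM (gW j) (gW j)).
rewrite /norm_term2 /w2 big1 ?mulr0// => j _; rewrite big1 ?expr0n// => i _.
by rewrite (D0 _ _ nK) mul0r.
Qed.

Lemma intg_gradient_term2 : intg U gradient_term2.
Proof.
apply: intg_good => [|x nK].
  apply: (cont_bddM good_f); apply: cont_bddB.
    apply: (cont_bddM (cont_bdd_cst _ _ 2)); apply: cont_bdd_sum => i.
    apply: (cont_bddM (good_g i)); apply: cont_bdd_sum => j.
    exact: (cont_bddM (good_D i j) (good_Dg j)).
  exact: (cont_bddM (cont_bdd_cst _ _ 2) (cont_bddM good_kk good_divF)).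
rewrite /gradient_term2 kk0// mul0r mulr0 subr0 (_ : zz v F x = 0) ?mulr0//.
rewrite /zz big1// => i _; rewrite big1 ?mulr0// => j _.
by rewrite (D0 _ _ nK) mul0r.
Qed.

Lemma second_density_split x :
  second_density v alpha F x = energy_term2 x + norm_term2 x + gradient_term2 x.
Proof.
rewrite /second_density /energy_term2 /norm_term2 /gradient_term2.
by rewrite -!mulrDr -addrA.
Qed.

End VariationDensities.

Lemma first_density_split (R : realType) n (v : 'rV[R]_n -> R) alpha (Phi : 'rV[R]_n -> 'rV[R]_n) x :
  let F i (y : 'rV[R]_n) : R := Phi y ord0 i in
  first_density v alpha Phi x = energy_term v alpha F x - 2 * gradient_term v alpha F x.
Proof.
move=> F; rewrite /first_density /energy_term /gradient_term /divF /kk /Dg.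
rewrite !mulr_sumr -sumrB; apply: eq_bigr => i _.
rewrite (eq_bigr (fun j => v x `^ alpha * (gsq v x + 1) * (partial j (F i) x * (i == j)%:R) -
  2 * (v x `^ alpha * (partial i v x * (partial j (F i) x * partial j v x))))); last first.
  move=> j _; rewrite /stress -/(F i); move: (v x `^ alpha) (gsq v x) ((i == j)%:R) => a b c.
  by move: (partial i v x) (partial j v x) (partial j (F i) x) => ? ? ?; ring.
rewrite sumrB -!mulr_sumr sum_delta; congr (_ - _).
by rewrite mulrA.
Qed.

Lemma enorm_sqr (R : realType) m (a : 'cV[R]_m) : enorm a ^+ 2 = vdot a a.
Proof. by rewrite sqr_sqrtr// sumr_ge0// => i _; rewrite -expr2 sqr_ge0. Qed.

Lemma enorm_grad (R : realType) n (w : 'rV[R]_n -> R) x :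
  enorm (grad w x) ^+ 2 = \sum_i partial i w x ^+ 2.
Proof. by rewrite enorm_sqr; apply: eq_bigr => i _; rewrite !mxE. Qed.

(** * Reduction of both functionals to the positivity set *)

Section Collinear.
Context {R : realType} {n : nat}.
Variables (w v : 'rV[R]_n -> R) (Phi : 'rV[R]_n -> 'rV[R]_n) (x : 'rV[R]_n) (l : R).
Hypothesis wv : forall i, partial i w x = l * partial i v x.
Local Notation F := (fun i (y : 'rV[R]_n) => Phi y ord0 i).

Lemma divergenceE : divergence Phi x = divF F x.
Proof. by apply: eq_bigr => i _; rewrite mxE. Qed.

Lemma trace_sqr : \tr (Dvec Phi x *m Dvec Phi x) = trD2 F x.
Proof. by apply: eq_bigr => i _; rewrite mxE; apply: eq_bigr => j _; rewrite !mxE. Qed.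

Lemma enorm_grad_collinear : enorm (grad w x) ^+ 2 = l ^+ 2 * gsq v x.
Proof. by rewrite enorm_grad /gsq mulr_sumr; apply: eq_bigr => i _; rewrite wv exprMn. Qed.

Lemma vdot_collinear : vdot (grad w x) (Dvec Phi x *m grad w x) = l ^+ 2 * kk v F x.
Proof.
rewrite /vdot /kk mulr_sumr; apply: eq_bigr => i _.
rewrite /Dg !mxE wv !mulr_sumr; apply: eq_bigr => j _; rewrite !mxE wv.
by move: (partial _ _ _) (partial _ _ _) (partial _ _ _) => a b c; ring.
Qed.

Lemma enorm_collinear : enorm ((Dvec Phi x)^T *m grad w x) ^+ 2 = l ^+ 2 * w2 v F x.
Proof.
rewrite enorm_sqr /vdot /w2 mulr_sumr; apply: eq_bigr => j _.
rewrite mxE -expr2 -exprMn mulr_sumr; congr (_ ^+ 2); apply: eq_bigr => i _.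
by rewrite !mxE wv; move: (partial _ _ _) (partial _ _ _) => a b; ring.
Qed.

Lemma sum_collinear : \sum_i \sum_j \sum_k
  partial i w x * partial j w x * Dvec Phi x i k * Dvec Phi x k j = l ^+ 2 * zz v F x.
Proof.
rewrite /zz mulr_sumr; apply: eq_bigr => i _; rewrite exchange_big /=.
rewrite !mulr_sumr; apply: eq_bigr => k _; rewrite /Dg !mulr_sumr; apply: eq_bigr => j _.
rewrite !mxE !wv.
by move: (partial i v x) (partial j v x) (partial _ _ _) (partial _ _ _) => a b c d; ring.
Qed.

End Collinear.

Section Variations.
Context {R : realType} {n : nat}.
Variables (Omega : set 'rV[R]_n) (v : 'rV[R]_n -> R) (alpha : R).
Local Notation U := (positivity_set Omega v).
Local Notation mu := (lebesgue_rV n : {sigma_finite_measure set 'rV[R]_n -> \bar R}).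
Local Notation Int U f := (\int[mu]_(x in U) f x)%R.
Hypothesis v_smooth : smooth_up_to_boundary U Omega v.
Hypothesis alpha_gt0 : 0 < alpha.
(** Both functionals at once. For the modified one w = v, with l = 1 and kappa = 1. For the
    Alt-Phillips one w = u and G = 1, with l = (v / beta)^(beta - 1) and kappa = beta^(-alpha). Off
    the positivity set the integrands vanish because G does in the former case, and because grad u
    and the potential do in the latter. *)
Variables (w : 'rV[R]_n -> R) (G V : R -> R) (kappa : R).
Hypothesis w_pos : forall x, U x -> exists l, [/\ forall i, partial i w x = l * partial i v x,
  G (w x) * l ^+ 2 = kappa * v x `^ alpha & G (w x) * V (w x) = kappa * v x `^ alpha].
Hypothesis w_zero : forall x, Omega x -> ~ U x ->
  G (w x) = 0 \/ (forall i, partial i w x = 0) /\ V (w x) = 0.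
Variable Phi : 'rV[R]_n -> 'rV[R]_n.
Hypothesis tPhi : test_field Omega Phi.
Local Notation F := (fun i (y : 'rV[R]_n) => Phi y ord0 i).

Let oU : open U. Proof. by case: v_smooth. Qed.

Lemma test_field_support : exists K, [/\ compact K, K `<=` Omega &
  forall i x, ~ K x -> F i x = 0].
Proof.
have [_ [cK KO]] := tPhi; exists (closure [set x | Phi x != 0]); split=> // i x nK.
have -> : Phi x = 0 by apply/eqP/negPn/negP => nz; apply: nK; exact: subset_closure.
by rewrite mxE.
Qed.

Lemma integral_pos_set h a : (forall x, Omega x -> ~ U x -> h x = 0) ->
  (forall x, U x -> h x = kappa * a x) -> intg U a ->
  (\int[mu]_(x in Omega) (h x)%:E)%E = (kappa * Int U a)%:E.
Proof.
move=> h0 hU ia; transitivity (\int[mu]_(x in U) (h x)%:E)%E.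
  rewrite integral_mkcond [RHS]integral_mkcond; apply: eq_integral => x _.
  rewrite !patchE; case: ifPn => [|]; rewrite ?inE => Ox.
    case: ifPn => [//|]; rewrite notin_setE => nU.
    by rewrite (h0 x Ox nU).
  by rewrite ifF//; apply/negP; rewrite inE => -[Ox' _]; rewrite mem_set in Ox.
rewrite -(IntZ kappa oU ia) -(Int_EFin oU (intgZ kappa oU ia)).
by apply: eq_integral => x; rewrite inE => /hU ->.
Qed.

(** A zero gradient is collinear with grad v with factor 0, so the lemmas of [Collinear] serve off
    the positivity set as well. *)
Let vanish x : Omega x -> ~ U x -> G (w x) = 0 \/
  (forall i, partial i w x = 0 * partial i v x) /\ V (w x) = 0.
Proof.
move=> Ox nU; have [|[p0 V0]] := w_zero Ox nU; first by left.
by right; split=> // i; rewrite p0 mul0r.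
Qed.

Lemma first_variationE :
  first_variation Omega G V w Phi = (kappa * Int U (first_density v alpha Phi))%:E.
Proof.
have [K [cK KO F0]] := test_field_support; have [sF _] := tPhi.
have i1 := intg_energy_term v_smooth alpha_gt0 sF cK KO F0.
have i2 := intg_gradient_term v_smooth alpha_gt0 sF cK KO F0.
rewrite /first_variation (@integral_pos_set _ (energy_term v alpha F))//; first last.
- move=> x Ux; have [l [wv Gl GV]] := w_pos Ux.
  rewrite (enorm_grad_collinear wv) divergenceE mulrDr mulrA Gl GV /energy_term.
  by move: (gsq v x) (divF F x) (v x `^ alpha) => a b c; ring.
- move=> x Ox nU; have [->|[wv ->]] := vanish Ox nU; first by rewrite !mul0r.
  by rewrite (enorm_grad_collinear wv) expr0n mul0r addr0 mulr0 mul0r.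
rewrite (@integral_pos_set _ (gradient_term v alpha F))//; first last.
- move=> x Ux; have [l [wv Gl GV]] := w_pos Ux.
  by rewrite (vdot_collinear Phi wv) mulrA Gl /gradient_term mulrA.
- move=> x Ox nU; have [->|[wv _]] := vanish Ox nU; first by rewrite !mul0r.
  by rewrite (vdot_collinear Phi wv) expr0n mul0r mulr0.
rewrite -EFinM -EFinB; congr (_%:E).
rewrite (Int_eq (f := first_density v alpha Phi)
  (g := fun x => energy_term v alpha F x - 2 * gradient_term v alpha F x)).
  by rewrite (IntB oU i1 (intgZ 2 oU i2)) (IntZ 2 oU i2); ring.
by move=> x _; exact: first_density_split.
Qed.

Lemma second_variationE :
  second_variation Omega G V w Phi = (kappa * Int U (second_density v alpha F))%:E.
Proof.
have [K [cK KO F0]] := test_field_support; have [sF _] := tPhi.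
have i1 := intg_energy_term2 v_smooth alpha_gt0 sF cK KO F0.
have i2 := intg_norm_term2 v_smooth alpha_gt0 sF cK KO F0.
have i3 := intg_gradient_term2 v_smooth alpha_gt0 sF cK KO F0.
rewrite /second_variation (@integral_pos_set _ (energy_term2 v alpha F))//; first last.
- move=> x Ux; have [l [wv Gl GV]] := w_pos Ux.
  rewrite (enorm_grad_collinear wv) divergenceE trace_sqr mulrDr.
  rewrite [G _ * (_ * gsq v x)]mulrA Gl GV /energy_term2.
  move: (_ / 2) (gsq v x) (v x `^ alpha) => a b c; ring.
- move=> x Ox nU; have [->|[wv ->]] := vanish Ox nU; first by rewrite !mul0r.
  by rewrite (enorm_grad_collinear wv) expr0n mul0r addr0 mulr0 mul0r.
rewrite (@integral_pos_set _ (norm_term2 v alpha F))//; first last.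
- move=> x Ux; have [l [wv Gl GV]] := w_pos Ux.
  by rewrite (enorm_collinear Phi wv) mulrA Gl /norm_term2 mulrA.
- move=> x Ox nU; have [->|[wv _]] := vanish Ox nU; first by rewrite !mul0r.
  by rewrite (enorm_collinear Phi wv) expr0n mul0r mulr0.
rewrite (@integral_pos_set _ (gradient_term2 v alpha F))//; first last.
- move=> x Ux; have [l [wv Gl GV]] := w_pos Ux.
  rewrite (sum_collinear Phi wv) (vdot_collinear Phi wv) divergenceE /gradient_term2.
  rewrite [RHS]mulrA -Gl; move: (G _) (zz _ _ _) (kk _ _ _) (divF _ _) => a b c d; ring.
- move=> x Ox nU; have [->|[wv _]] := vanish Ox nU; first by rewrite !mul0r.
  rewrite (sum_collinear Phi wv) (vdot_collinear Phi wv) expr0n !mul0r !mulr0.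
  by rewrite mul0r subr0 mulr0.
rewrite -!EFinD; congr (_%:E).
rewrite (Int_eq (f := second_density v alpha F)
  (g := fun x => energy_term2 v alpha F x + norm_term2 v alpha F x + gradient_term2 v alpha F x)).
  by rewrite (IntD oU (intgD oU i1 i2) i3) (IntD oU i1 i2); ring.
by move=> x _; exact: second_density_split.
Qed.

End Variations.

(** * Conclusion *)

Section StableCriticalPoint.
Context {R : realType} {n : nat}.
Variables (Omega : set 'rV[R]_n) (v : 'rV[R]_n -> R) (alpha : R).
Local Notation U := (positivity_set Omega v).
Local Notation mu := (lebesgue_rV n : {sigma_finite_measure set 'rV[R]_n -> \bar R}).
Local Notation Int U f := (\int[mu]_(x in U) f x)%R.
Hypothesis oO : open Omega.
Hypothesis v_ge0 : forall x, Omega x -> 0 <= v x.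
Hypothesis v_smooth : smooth_up_to_boundary U Omega v.
Hypothesis alpha_gt0 : 0 < alpha.
Hypothesis gsq_gt0 : forall x, U x -> 0 < gsq v x.
Variables (w : 'rV[R]_n -> R) (G V : R -> R) (kappa : R).
Hypothesis kappa_gt0 : 0 < kappa.
Hypothesis w_pos : forall x, U x -> exists l, [/\ forall i, partial i w x = l * partial i v x,
  G (w x) * l ^+ 2 = kappa * v x `^ alpha & G (w x) * V (w x) = kappa * v x `^ alpha].
Hypothesis w_zero : forall x, Omega x -> ~ U x ->
  G (w x) = 0 \/ (forall i, partial i w x = 0) /\ V (w x) = 0.
Hypothesis w_stable : stable_critical_point Omega G V w.

Lemma stability_inequality phi : C1c Omega phi ->
  [/\ intg U (Q_pot v alpha phi), intg U (Q_grad v alpha phi) &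
      alpha / 2 * Int U (Q_pot v alpha phi) <= Int U (Q_grad v alpha phi)].
Proof.
have [oU sv _ _] := v_smooth; have [[_ crit] stab] := w_stable.
have v_gt0 x : U x -> 0 < v x by case.
have UO : U `<=` Omega by move=> x [].
have k0 : kappa != 0 by rewrite gt_eqF.
have critical Phi : test_field Omega Phi -> Int U (first_density v alpha Phi) = 0.
  move=> tPhi; have := crit Phi tPhi.
  rewrite (first_variationE v_smooth alpha_gt0 w_pos w_zero tPhi) => /eqP.
  by rewrite eqe mulf_eq0 (negPf k0) => /eqP.
have pde_v := pde oU UO v_gt0 sv critical gsq_gt0.
have st (F : 'I_n -> 'rV[R]_n -> R) (K : set 'rV[R]_n) : (forall i, smooth_on setT (F i)) ->
    compact K -> K `<=` Omega -> (forall i x, ~ K x -> F i x = 0) ->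
    0 <= Int U (second_density v alpha F).
  move=> sF cK KO F0; pose Phi x : 'rV[R]_n := \row_i F i x.
  have FE : (fun i (y : 'rV[R]_n) => Phi y ord0 i) = F.
    by apply/funext => i; apply/funext => y; rewrite mxE.
  have tPhi : test_field Omega Phi.
    split; first by move=> i; rewrite (congr1 (@^~ i) FE); exact: sF.
    apply: (compactly_supported cK KO) => x; apply: contra_neqP => nK.
    by apply/rowP => i; rewrite !mxE F0.
  have := stab Phi tPhi.
  by rewrite (second_variationE v_smooth alpha_gt0 w_pos w_zero tPhi) FE lee_fin pmulr_rge0.
move=> [cphi [cK KO]].
have phi0 x : ~ closure [set x | phi x != 0] x -> phi x = 0.
  by move=> nK; apply/eqP/negPn/negP => nz; apply: nK; exact: subset_closure.
have [i1 i2] := intg_Q_test oO v_ge0 v_smooth alpha_gt0 gsq_gt0 pde_v cphi cK KO phi0.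
split=> //.
exact: (Q_stable oO v_ge0 v_smooth alpha_gt0 gsq_gt0 pde_v st cphi cK KO phi0).
Qed.

End StableCriticalPoint.

(** The two formulations differ from one inequality by constant factors only; [c * k = l * d] says
    that these factors are compatible with the constants in front. *)
Lemma integral_le_of_intg (R : realType) n (U : set 'rV[R]_n) (c k l d : R)
    (a b f g : 'rV[R]_n -> R) :
  open U -> (forall x, U x -> f x = k * a x) -> (forall x, U x -> g x = l * b x) ->
  0 <= l -> c * k = l * d ->
  intg U a -> intg U b ->
  d * (\int[lebesgue_rV n]_(x in U) a x)%R <= (\int[lebesgue_rV n]_(x in U) b x)%R ->
  integral_le c U f g.
Proof.
move=> oU fa gb l0 ckld ia ib ab.
have iff : intg U f by apply: (intg_eq oU _ (intgZ k oU ia)) => x /fa.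
have ig : intg U g by apply: (intg_eq oU _ (intgZ l oU ib)) => x /gb.
split=> //; rewrite (Int_EFin oU iff) (Int_EFin oU ig) -EFinM lee_fin.
rewrite (Int_eq fa) (Int_eq gb) (IntZ k oU ia) (IntZ l oU ib) mulrA ckld -mulrA.
exact: ler_wpM2l.
Qed.

Theorem theorem4p1 (R : realType) (n : nat) (n_gt0 : (0 < n)%N)
  (gamma beta alpha : R) (gamma_gt0 : 0 < gamma) (gamma_lt2 : gamma < 2)
  (betaE : beta = 2 / (2 - gamma)) (alphaE : alpha = gamma * beta)
  (Omega : set 'rV[R]_n) (Omega_domain : domain Omega)
  (Omega_lipschitz : locally_lipschitz_boundary Omega)
  (u v : 'rV[R]_n -> R)
  (u_ge0 : forall x, Omega x -> 0 <= u x)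
  (vE : forall x, Omega x -> v x = beta * u x `^ beta^-1)
  (stable : stable_critical_AP gamma Omega u \/
            stable_critical_M alpha Omega v)
  (v_smooth : smooth_up_to_boundary (positivity_set Omega v) Omega v)
  (fb_smooth : smooth_hypersurface (free_boundary Omega u))
  (grad_v_gt0 : forall x, positivity_set Omega v x -> 0 < enorm (grad v x)) :
  forall phi : 'rV[R]_n -> R, C1c Omega phi ->
    integral_le ((2 - gamma) / 2 * (gamma / 2)) (positivity_set Omega u)
      (fun x => u x `^ gamma *
         ((u x `^ gamma - enorm (grad u x) ^+ 2) / u x ^+ 2) * phi x ^+ 2)
      (fun x => u x `^ gamma * enorm (grad phi x) ^+ 2)
    /\
    integral_le (alpha / 2) (positivity_set Omega v)
      (fun x => v x `^ alpha *
         ((1 - enorm (grad v x) ^+ 2) / v x ^+ 2) * phi x ^+ 2)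
      (fun x => v x `^ alpha * enorm (grad phi x) ^+ 2).
Proof.
move=> phi cphi; have [oO _ _] := Omega_domain; have [oU sv _ _] := v_smooth.
have g2 : 0 < 2 - gamma by rewrite subr_gt0.
have b0 : 0 < beta by rewrite betaE divr_gt0.
have bV0 : beta^-1 != 0 by rewrite invr_eq0 gt_eqF.
have a0 : 0 < alpha by rewrite alphaE mulr_gt0.
have v_ge0 x : Omega x -> 0 <= v x by move=> /vE ->; rewrite mulr_ge0 ?powR_ge0// ltW.
have u0 x : Omega x -> ~ positivity_set Omega v x -> u x = 0.
  move=> Ox nU; apply/eqP; rewrite eq_le u_ge0// andbT leNgt; apply/negP => ux; apply: nU.
  by split=> //; rewrite vE// mulr_gt0// powR_gt0.
have UE : positivity_set Omega u = positivity_set Omega v.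
  apply/seteqP; split=> x [Ox x0]; split=> //; first by rewrite vE// mulr_gt0// powR_gt0.
  rewrite lt_neqAle u_ge0// andbT; apply: contraTneq x0 => ux.
  by rewrite vE// -ux powR0// mulr0 ltxx.
have gsq_gt0 x : positivity_set Omega v x -> 0 < gsq v x.
  move=> Ux; have := grad_v_gt0 x Ux; rewrite sqrtr_gt0.
  by rewrite -enorm_sqr enorm_grad.
(* From u = (v / beta)^beta and beta gamma = alpha, u^gamma = beta^(-alpha) v^alpha. *)
set k := beta^-1 `^ alpha.
have k0 : 0 < k by rewrite powR_gt0// invr_gt0.
have uE x : positivity_set Omega v x -> u x = (beta^-1 * v x) `^ beta.
  move=> [Ox _]; rewrite vE// mulKf ?gt_eqF// -powRrM mulVf ?gt_eqF// powRr1//.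
  exact: u_ge0.
have kE x : positivity_set Omega v x -> u x `^ gamma = k * v x `^ alpha.
  move=> Ux; rewrite uE// -powRrM [beta * _]mulrC -alphaE powRM ?invr_ge0 ?(ltW b0)//.
  by case: Ux => Ox _; exact: v_ge0.
(* The derivative of s |-> (s / beta)^beta at s = v x: the factors beta and 1 / beta cancel. *)
pose l x := (beta^-1 * v x) `^ (beta - 1).
have du x : positivity_set Omega v x -> forall i, partial i u x = l x * partial i v x.
  move=> Ux i; rewrite (partial_near i (open_near_eq oU Ux uE)).
  have cv : C1_on (positivity_set Omega v) (fun y => beta^-1 * v y).
    exact: (smooth_on_C1 (smooth_onM oU (smooth_on_cst (U := positivity_set Omega v) beta^-1) sv)).
  rewrite (C1_partial_powR i beta oU cv _ Ux).
    rewrite (C1_partialZ i beta^-1 (smooth_on_C1 sv) Ux) /l.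
    by rewrite mulrCA mulrA mulrA mulVf ?gt_eqF// mul1r.
  by move=> y [_ y0]; rewrite mulr_gt0 ?invr_gt0.
have lE x : positivity_set Omega v x -> l x ^+ 2 = k * v x `^ alpha.
  move=> Ux; have vx : 0 <= v x by case: Ux => Ox _; exact: v_ge0.
  (* The relation 2 (beta - 1) = alpha is the reason for the choice of beta: |grad u|^2 and u^gamma
     acquire the same weight beta^(-alpha) v^alpha. *)
  rewrite /l -powR_mulrn ?powR_ge0// -powRrM (_ : (beta - 1) * 2 = alpha).
    by rewrite powRM// invr_ge0 ltW.
  by rewrite alphaE betaE; field; rewrite gt_eqF.
have [i1 i2 le12] : [/\ intg (positivity_set Omega v) (Q_pot v alpha phi),
    intg (positivity_set Omega v) (Q_grad v alpha phi) &
    alpha / 2 * (\int[lebesgue_rV n]_(x in positivity_set Omega v) Q_pot v alpha phi x)%R <=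
    (\int[lebesgue_rV n]_(x in positivity_set Omega v) Q_grad v alpha phi x)%R].
  case: stable => st.
    apply: (stability_inequality oO v_ge0 v_smooth a0 gsq_gt0 k0 _ _ st cphi) => x.
      move=> Ux; exists (l x); split; [exact: du|by rewrite mul1r lE|].
      rewrite mul1r /chi_pos indicE mem_set ?mulr1; first exact: kE.
      by move: Ux; rewrite -UE => -[].
    move=> Ox nU; right; split; last first.
      by rewrite (u0 x Ox nU) powR0 ?mul0r// gt_eqF.
    (* Differentiability of [u] at its zeros is not known. There [u] has a minimum, so [partial i u]
       is 0 either by the first-order condition or as the default value. *)
    move=> i; apply: partial_at_min; last exact: u0.
    by apply: filterS (open_nbhs_nbhs (conj oO Ox)) => y /u_ge0.
  apply: (stability_inequality oO v_ge0 v_smooth a0 gsq_gt0 ltr01 _ _ st cphi) => x.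
    move=> Ux; exists 1; split; first by move=> i; rewrite mul1r.
      by rewrite expr1n mulr1 mul1r /chi_pos indicE mem_set ?mulr1//; case: Ux.
    by rewrite mulr1 mul1r /chi_pos indicE mem_set ?mulr1//; case: Ux.
  move=> Ox nU; left; rewrite /chi_pos indicE memNset ?mulr0//= => vx.
  exact: nU.
split; last first.
  apply: (integral_le_of_intg (k := 1) oU _ _ ler01 _ i1 i2 le12) => [x _|x _|].
  - by rewrite mul1r enorm_grad.
  - by rewrite mul1r enorm_grad.
  - by rewrite mul1r mulr1.
rewrite UE.
(* Since u^2 = k v^alpha (v / beta)^2, the potential of [u] is k beta^2 times that of [v], while the
   gradient term only gains k. The extra beta^2 is absorbed by the constant: (2 - gamma) / 2 times
   gamma / 2 times beta^2 equals alpha / 2. *)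
apply: (integral_le_of_intg (k := k * beta ^+ 2) oU _ _ (ltW k0) _ i1 i2 le12) => [x Ux|x Ux|].
- have u2 : u x ^+ 2 = k * v x `^ alpha * (v x / beta) ^+ 2.
    have vx : 0 < v x by case: Ux.
    rewrite -lE// /l -exprMn uE// [v x / _]mulrC -[X in _ `^ _ * X]powRr1; last first.
      by rewrite mulr_ge0// ?invr_ge0 ltW.
    by rewrite -powRD ?subrK// gt_eqF ?implybT// mulr_gt0// invr_gt0.
  rewrite kE// (enorm_grad_collinear (du x Ux)) lE// u2 /Q_pot.
  have vx : v x != 0 by case: Ux => _ vx; rewrite gt_eqF.
  have fx : v x `^ alpha != 0 by rewrite powR_eq0 negb_and vx.
  move: (v x `^ alpha) fx (gsq v x) (phi x) => f fx a b.
  by field; rewrite vx fx !gt_eqF.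
- by rewrite kE// enorm_grad /Q_grad mulrA.
- by rewrite alphaE betaE; field; rewrite gt_eqF.
Qed.
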